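(* Let $n\ge 1$, $a\ge 1$ and $s_0>0$. Let $\phi:\mathbb{R}^n\setminus\{0\}\to\mathbb{R}$ be smooth and positively homogeneous of degree $a$, i.e. $\phi(r\xi)=r^a\phi(\xi)$ for all $r>0$ and $\xi\neq 0$. Assume that for every multi-index $\alpha$ there is a constant $c_\alpha$ with $$|\partial^\alpha\phi(\xi)|\le c_\alpha|\xi|^{a-|\alpha|}\quad\text{for all }\xi\in\mathbb{R}^n\setminus\{0\},$$ and that $\min_{|\xi|=1}|\nabla\phi(\xi)|>0$. For $f\in\mathcal{S}(\mathbb{R}^n)$ and $t\in\mathbb{R}$ let $$T_tf(x)=\int_{\mathbb{R}^n}e^{ix\cdot\xi+it\phi(\xi)}\,\widehat f(\xi)\,d\xi,\qquad x\in\mathbb{R}^n.$$ Suppose that for every $s>s_0$ there is a constant $C_s$ such that $$\Big\|\sup_{0<t<1}|T_tf|\Big\|_{L^2(B(0,1))}\le C_s\|f\|_{H^s(\mathbb{R}^n)}\quad\text{for all }f\in\mathcal{S}(\mathbb{R}^n).$$ Then for every $s>as_0$ there is a constant $C'_s$ such that $$\Big\|\sup_{0<t<1}|T_tf|\Big\|_{L^2(\mathbb{R}^n)}\le C'_s\|f\|_{H^s(\mathbb{R}^n)}\quad\text{for all }f\in\mathcal{S}(\mathbb{R}^n).$$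
   Context: $\mathcal{S}(\mathbb{R}^n)$ is the Schwartz class, and $B(0,1)$ is the unit ball centred at the origin. The Fourier transform is $\widehat f(\xi)=\int_{\mathbb{R}^n}e^{-ix\cdot\xi}f(x)\,dx$ (note that no factor $(2\pi)^{-n}$ is included in the definition of $T_t$). $H^s(\mathbb{R}^n)$ is the space of tempered distributions $f$ with $\langle\xi\rangle^s\widehat f\in L^2(\mathbb{R}^n)$, where $\langle\xi\rangle=(1+|\xi|^2)^{1/2}$, with norm $\|f\|_{H^s}=\|\langle\xi\rangle^s\widehat f\|_{L^2}$. *)

(* Defs.v *)
From HB Require Import structures.
From mathcomp Require Import all_boot all_order all_algebra.
From mathcomp Require Import all_classical all_reals all_analysis.
From mathcomp.real_closed Require Export complex.

Set Implicit Arguments.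
Unset Strict Implicit.
Unset Printing Implicit Defensive.
Import Order.TTheory GRing.Theory Num.Theory.
Import numFieldNormedType.Exports.

Local Open Scope classical_set_scope.
Local Open Scope ring_scope.

(* R^n is 'rV[R]_n, with the product sigma-algebra generated by the
   coordinate maps, as the library does for n.-tuple. *)
Fact measure_rV_display : measure_display.
Proof. exact: default_measure_display. Qed.

Section measurable_rV.
Context {R : realType} (n : nat).

Definition rV_coord (i : 'I_n) (x : 'rV[R]_n) : measurableTypeR R := x 0 i.

Let rV_set0 : g_sigma_preimage rV_coord set0.
Proof. exact: sigma_algebra0. Qed.

Let rV_setC A : g_sigma_preimage rV_coord A -> g_sigma_preimage rV_coord (~` A).
Proof. exact: sigma_algebraC. Qed.

Let rV_bigcup (F : _^nat) : (forall i, g_sigma_preimage rV_coord (F i)) ->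
  g_sigma_preimage rV_coord (\bigcup_i (F i)).
Proof. exact: sigma_algebra_bigcup. Qed.

HB.instance Definition _ := @isMeasurable.Build measure_rV_display
  'rV[R]_n (g_sigma_preimage rV_coord) rV_set0 rV_setC rV_bigcup.

End measurable_rV.

Section measurable_rV_theory.
Context {R : realType}.

Lemma measurable_rV_coord n (i : 'I_n) :
  measurable_fun [set: 'rV[R]_n] (rV_coord i).
Proof.
move=> _ Y mY; rewrite setTI; apply: sub_sigma_algebra => /=.
rewrite -bigcup_seq/=; exists i => /=; first by rewrite mem_index_enum.
by exists Y => //; rewrite setTI.
Qed.

Lemma measurable_fun_rVP d (T : measurableType d) n (f : T -> 'rV[R]_n) :
  measurable_fun [set: T] f <->
  forall i, measurable_fun [set: T] (rV_coord i \o f).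
Proof.
split=> [mf i|mf]; first exact: (measurableT_comp (measurable_rV_coord i)).
apply: (@measurability _ _ _ _ setT f
  (\big[setU/set0]_(i < n) preimage_set_system setT (@rV_coord R n i) measurable)).
  by [].
move=> _ [B + <-]; rewrite -bigcup_seq => -[i _ [A mA <-]].
by rewrite setTI -comp_preimage setTI -[X in measurable X]setTI; exact: mf.
Qed.

Definition rV_cons n (p : measurableTypeR R * 'rV[R]_n) : 'rV[R]_n.+1 :=
  row_mx (p.1%:M : 'rV[R]_1) p.2.

Definition rV_uncons n (x : 'rV[R]_n.+1) : measurableTypeR R * 'rV[R]_n :=
  (x 0 ord0, \row_i x 0 (lift ord0 i)).

Lemma rV_cons0 n (p : measurableTypeR R * 'rV[R]_n) : rV_cons p 0 ord0 = p.1.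
Proof.
transitivity (row_mx (p.1%:M : 'rV[R]_1) p.2 0 (lshift n ord0)).
  by congr (fun_of_matrix _ _ _); exact/val_inj.
by rewrite row_mxEl mxE.
Qed.

Lemma rV_consS n (p : measurableTypeR R * 'rV[R]_n) i :
  rV_cons p 0 (lift ord0 i) = p.2 0 i.
Proof.
transitivity (row_mx (p.1%:M : 'rV[R]_1) p.2 0 (rshift 1 i)).
  by congr (fun_of_matrix _ _ _); exact/val_inj.
by rewrite row_mxEr.
Qed.

Lemma rV_consK n : cancel (@rV_cons n) (@rV_uncons n).
Proof.
move=> [r x]; rewrite /rV_uncons rV_cons0; congr pair.
by apply/rowP => i; rewrite mxE rV_consS.
Qed.

Lemma rV_unconsK n : cancel (@rV_uncons n) (@rV_cons n).
Proof.
move=> x; apply/rowP => i; case: (unliftP ord0 i) => [j|] ->.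
  by rewrite rV_consS mxE.
by rewrite rV_cons0.
Qed.

Lemma measurable_rV_cons n : measurable_fun setT (@rV_cons n).
Proof.
apply/measurable_fun_rVP => i; case: (unliftP ord0 i) => [j|] ->.
  rewrite (_ : _ \o _ = rV_coord j \o snd).
    exact: (measurableT_comp (measurable_rV_coord j)).
  by apply/funext => p; rewrite /= /rV_coord rV_consS.
rewrite (_ : _ \o _ = fst) //.
by apply/funext => p; rewrite /= /rV_coord rV_cons0.
Qed.

Lemma measurable_rV_uncons n : measurable_fun setT (@rV_uncons n).
Proof.
apply/measurable_fun_pairP; split; first exact: (measurable_rV_coord ord0).
apply/measurable_fun_rVP => i.
rewrite (_ : _ \o _ = rV_coord (lift ord0 i)); first exact: measurable_rV_coord.
by apply/funext => x; rewrite /= /rV_coord mxE.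
Qed.

Fixpoint lebesgue_rV n : set 'rV[R]_n -> \bar R :=
  match n with
  | 0 => \d_(0 : 'rV[R]_0)
  | n'.+1 => pushforward (lebesgue_measure \x @lebesgue_rV n')%E (@rV_cons n')
  end.

Section lebesgue_rV_step.
Local Open Scope ereal_scope.
Variables (n : nat) (m : {sigma_finite_measure set 'rV[R]_n -> \bar R}).
Let mu : {measure set (measurableTypeR R * 'rV[R]_n)%type -> \bar R} :=
  lebesgue_measure \x m.
Let nu : set 'rV[R]_n.+1 -> \bar R := pushforward mu (@rV_cons n).

Let mcons (A : set 'rV[R]_n.+1) :
  measurable A -> measurable (@rV_cons n @^-1` A).
Proof.
by move=> mA; rewrite -[X in measurable X]setTI; exact: measurable_rV_cons.
Qed.

Let nu0 : nu set0 = 0.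
Proof. by rewrite /nu /pushforward preimage_set0 /mu measure0. Qed.

Let nu_ge0 A : 0 <= nu A.
Proof. exact: (measure_ge0 mu). Qed.

Let nu_sigma_additive : semi_sigma_additive nu.
Proof.
move=> F mF tF mUF; rewrite /nu /pushforward preimage_bigcup.
apply: (@measure_semi_sigma_additive _ _ _ mu).
- by move=> k; exact: mcons.
- apply/trivIsetP => /= i j _ _ ij; rewrite -preimage_setI.
  by move/trivIsetP : tF => /(_ _ _ _ _ ij) ->//; rewrite preimage_set0.
- by rewrite -preimage_bigcup; exact: mcons.
Qed.

#[local] HB.instance Definition _ := isMeasure.Build _ _ _ nu
  nu0 nu_ge0 nu_sigma_additive.

Let nu_sigma_finite : sigma_finite setT nu.
Proof.
have /sigma_finiteP[F [TF ndF Foo]] := sigma_finiteT (@lebesgue_measure R).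
have /sigma_finiteP[G [TG ndG Goo]] := sigma_finiteT m.
exists (fun k => @rV_uncons n @^-1` (F k `*` G k)).
  rewrite -preimage_bigcup; apply/esym; rewrite -subTset => x _.
  have [i _ Fi] : (\bigcup_i F i) (rV_uncons x).1 by rewrite -TF.
  have [j _ Gj] : (\bigcup_i G i) (rV_uncons x).2 by rewrite -TG.
  exists (maxn i j) => //; split.
    by move: Fi; apply/subsetPset/ndF/leq_maxl.
  by move: Gj; apply/subsetPset/ndG/leq_maxr.
move=> k; have [mFk Fkoo] := Foo k; have [mGk Gkoo] := Goo k; split.
  rewrite -[X in measurable X]setTI.
  by apply: measurable_rV_uncons => //; exact: measurableX.
rewrite /nu /pushforward -comp_preimage.
rewrite (_ : _ \o _ = id); last by apply/funext => p; exact: rV_consK.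
rewrite preimage_id [mu _]product_measure1E// lte_mul_pinfty// ge0_fin_numE//.
Qed.

#[local] HB.instance Definition _ := Measure_isSigmaFinite.Build _ _ _ nu
  nu_sigma_finite.

Lemma lebesgue_rV_step :
  exists m' : {sigma_finite_measure set 'rV[R]_n.+1 -> \bar R},
    m' = pushforward mu (@rV_cons n) :> (set _ -> \bar R).
Proof. by exists nu. Qed.

End lebesgue_rV_step.

Let lebesgue_rV_sigma_finite_measure n :
  exists m : {sigma_finite_measure set 'rV[R]_n -> \bar R},
    m = @lebesgue_rV n :> (set _ -> \bar R).
Proof.
elim: n => [|n [m mE]] /=; first by exists \d_(0 : 'rV[R]_0).
by rewrite -mE; exact: lebesgue_rV_step.
Qed.

Let lebesgue_rV_measure n :
  exists m : {measure set 'rV[R]_n -> \bar R},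
    m = @lebesgue_rV n :> (set _ -> \bar R).
Proof. by have [m mE] := lebesgue_rV_sigma_finite_measure n; exists m. Qed.

Section instances.
Variable n : nat.

Let lebesgue_rV0 : @lebesgue_rV n set0 = 0%E.
Proof. by have [m <-] := lebesgue_rV_measure n; exact: measure0. Qed.

Let lebesgue_rV_ge0 A : (0 <= @lebesgue_rV n A)%E.
Proof. by have [m <-] := lebesgue_rV_measure n; exact: measure_ge0. Qed.

Let lebesgue_rV_sigma_additive : semi_sigma_additive (@lebesgue_rV n).
Proof.
have [m <-] := lebesgue_rV_measure n; exact: measure_semi_sigma_additive.
Qed.

HB.instance Definition _ := isMeasure.Build _ _ _ (@lebesgue_rV n)
  lebesgue_rV0 lebesgue_rV_ge0 lebesgue_rV_sigma_additive.

Let lebesgue_rV_sigma_finite : sigma_finite setT (@lebesgue_rV n).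
Proof.
by have [m <-] := lebesgue_rV_sigma_finite_measure n; exact: sigma_finiteT.
Qed.

HB.instance Definition _ := Measure_isSigmaFinite.Build _ _ _ (@lebesgue_rV n)
  lebesgue_rV_sigma_finite.

End instances.

Lemma lebesgue_rV_box n (A : 'I_n -> set (measurableTypeR R)) :
  (forall i, measurable (A i)) ->
  lebesgue_rV [set x : 'rV[R]_n | forall i, A i (x 0 i)] =
  (\prod_(i < n) lebesgue_measure (A i))%E.
Proof.
elim: n A => [|n IH] A mA.
  by rewrite big_ord0 /= diracE mem_set // => -[].
rewrite big_ord_recl -IH//= /pushforward.
set B := [set x : 'rV[R]_n | _].
rewrite (_ : _ @^-1` _ = A ord0 `*` B); last first.
  apply/seteqP; split=> -[r x] /=.
    move=> h; split=> [|i]; first by have := h ord0; rewrite rV_cons0.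
    by have := h (lift ord0 i); rewrite rV_consS.
  move=> [h0 hS] i; case: (unliftP ord0 i) => [j|] ->.
    by rewrite rV_consS; exact: hS.
  by rewrite rV_cons0.
rewrite product_measure1E//.
rewrite (_ : B = \bigcap_(i in [set: 'I_n]) (@rV_coord R n i @^-1` A (lift ord0 i))).
  apply: fin_bigcap_measurable => // i _.
  by rewrite -[X in measurable X]setTI; exact: measurable_rV_coord.
by apply/seteqP; split=> x h i; [move=> _|]; exact: h.
Qed.

End measurable_rV_theory.
Arguments lebesgue_rV {R n}.

Section euclidean_space.
Context {R : realType} {n : nat}.
Implicit Types (x y : 'rV[R]_n) (g : 'rV[R]_n -> R) (alpha : 'I_n -> nat).

Definition rV_dot x y : R := \sum_(i < n) x 0 i * y 0 i.

(* `|x| is the sup norm on 'rV[R]_n. *)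
Definition enorm x : R := Num.sqrt (rV_dot x x).

Definition japanese x : R := Num.sqrt (1 + enorm x ^+ 2).

Definition partial (i : 'I_n) g : 'rV[R]_n -> R := 'D_(delta_mx 0 i) g.

Definition partials (w : seq 'I_n) g : 'rV[R]_n -> R := foldr partial g w.

Definition mdegree alpha : nat := \sum_(i < n) alpha i.

Definition mpartial alpha g : 'rV[R]_n -> R :=
  partials (flatten [seq nseq (alpha i) i | i <- enum 'I_n]) g.

Definition mpower alpha x : R := \prod_(i < n) x 0 i ^+ alpha i.

Definition gradient g x : 'rV[R]_n := \row_i partial i g x.

(* Meaningful for U open. *)
Definition smooth_on (U : set 'rV[R]_n) g : Prop :=
  forall (w : seq 'I_n) x, U x ->
    {for x, continuous (partials w g)} /\
    forall i, derivable (partials w g) x (delta_mx 0 i).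

Definition real_schwartz g : Prop :=
  smooth_on setT g /\
  forall alpha beta, exists C : R,
    forall x, `|mpower alpha x * mpartial beta g x| <= C.

(* Complex-valued functions are smooth, rapidly decreasing and integrated
   componentwise. *)
Definition schwartz (f : 'rV[R]_n -> R[i]) : Prop :=
  real_schwartz (fun x => complex.Re (f x)) /\ real_schwartz (fun x => complex.Im (f x)).

Definition cintegral (f : 'rV[R]_n -> R[i]) : R[i] :=
  Complex (\int[lebesgue_rV]_x complex.Re (f x)) (\int[lebesgue_rV]_x complex.Im (f x)).

(* e^{i theta} *)
Definition cexpi (theta : R) : R[i] := Complex (cos theta) (sin theta).

Definition fourier (f : 'rV[R]_n -> R[i]) (xi : 'rV[R]_n) : R[i] :=
  cintegral (fun x => cexpi (- rV_dot x xi) * f x).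

(* The H^s norm of a Schwartz function f. *)
Definition sobolev_norm (s : R) (f : 'rV[R]_n -> R[i]) : \bar R :=
  ('N[lebesgue_rV]_2%:E[
     (fun xi => (japanese xi `^ s * Normc.normc (fourier f xi))%R%:E)])%E.

(* phi is only meant on R^n minus the origin: for n > 0 its value at 0 is
   irrelevant here, the origin being negligible. *)
Definition propagator (phi : 'rV[R]_n -> R) (t : R) (f : 'rV[R]_n -> R[i])
    (x : 'rV[R]_n) : R[i] :=
  cintegral (fun xi => cexpi (rV_dot x xi + t * phi xi) * fourier f xi).

Definition maximal_function (phi : 'rV[R]_n -> R) (f : 'rV[R]_n -> R[i])
    (x : 'rV[R]_n) : \bar R :=
  ereal_sup [set (Normc.normc (propagator phi t f x))%:E |
                t in [set t : R | 0 < t < 1]].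

Definition L2norm_on (D : set 'rV[R]_n) (F : 'rV[R]_n -> \bar R) : \bar R :=
  ('N[lebesgue_rV]_2%:E[F \_ D])%E.

Definition unit_ball : set 'rV[R]_n := [set x | enorm x < 1].

End euclidean_space.

(* Main.v *)
(* A frequency box of size N is treated at scale l = N^(a-1). By homogeneity
   the local estimate on the unit ball turns into one on balls of radius l
   with frequencies of size l N = N^a, hence with loss N^(a s). To pass from
   balls of radius l to R^n, multiply T_t f, near a point y of a lattice of
   spacing comparable to l, by a function whose Fourier transform lives on the
   box of size 1/l. This replaces the datum h by averages over shifts |v| <= 1/l
   of h(xi - v) with the additional phase t(phi(xi - v) - phi(xi)), which is
   O(1) since |grad phi| = O(N^(a-1)). Expanding the exponential of this phase
   in its power series decouples t from xi - v, and for each power the averages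
   attached to the lattice points y are Fourier coefficients in v, so that
   Bessel's inequality sums their L^2 norms with a constant independent of N.
   The dyadic frequency pieces are then summed, the exponent being strictly
   larger than a s. Sharp frequency cut-offs are admissible because the local
   estimate extends from Schwartz data to bounded data with bounded frequency
   support, by convolving h with Gaussians and Fatou's lemma. *)
Require Import Defs.
From HB Require Import structures.
From mathcomp Require Import all_boot all_order all_algebra.
From mathcomp Require Import all_classical all_reals all_analysis.
From mathcomp Require Import measurable_realfun.
From mathcomp Require Import ring lra.

Set Implicit Arguments.
Unset Strict Implicit.
Unset Printing Implicit Defensive.
Import Order.TTheory GRing.Theory Num.Theory.
Import numFieldNormedType.Exports.

Local Open Scope classical_set_scope.
Local Open Scope ring_scope.

(** The supremum over t sits inside the L^2 norm, so the localized data must not depend on t. The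
    power series achieves this cheaply: as 0 < t < 1, the term of order l costs 1/l!, and
    Cauchy-Schwarz with the weights 1/l! leaves B^(2 l)/l!, whose sum is exp(B^2). Independence of N
    rests on a cancellation: with shifts of size p = N^(1-a) and half period q = pi n p, Bessel
    yields (2 q)^n (2 p)^n, while the localizing function is at least (2 p)^n cos 1 on a tile, so
    that dividing by its square leaves (pi n)^n / cos(1)^2. Estimates are written for squares, as
    integrals with values in [0, +oo], so that no finiteness has to be known beforehand. Since phi
    is singular at the origin it is first given the value 0 there. It then becomes homogeneous,
    continuous and Lipschitz on each box of size r with constant O(r^(a-1)), across the origin as
    well, and the main estimates start from these three facts. *)

Notation Re := complex.Re.
Notation Im := complex.Im.

(* [Normc.normc] with codomain [R] on the nose, for the measurability lemmas. *)
Definition cmod {R : realType} (z : R[i]) : R := Normc.normc z.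
Arguments cmod : simpl never.

(** * Modulus and components of complex numbers *)

Section complex_modulus.
Context {R : realType}.
Implicit Types z w : R[i].

Lemma cmodE z : cmod z = Num.sqrt (Re z ^+ 2 + Im z ^+ 2).
Proof. by case: z. Qed.

Lemma cmod0 : cmod (0 : R[i]) = 0. Proof. exact: Normc.normc0. Qed.
Lemma cmod1 : cmod (1 : R[i]) = 1. Proof. exact: Normc.normc1. Qed.
Lemma cmodM z w : cmod (z * w) = cmod z * cmod w.
Proof. exact: Normc.normcM. Qed.
Lemma cmodN z : cmod (- z) = cmod z. Proof. exact: normcN. Qed.
Lemma le_cmodD z w : cmod (z + w) <= cmod z + cmod w.
Proof. exact: le_normcD. Qed.

Lemma cmod_ge0 z : 0 <= cmod z.
Proof. by rewrite cmodE sqrtr_ge0. Qed.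

Lemma sqr_cmod z : cmod z ^+ 2 = Re z ^+ 2 + Im z ^+ 2.
Proof. by rewrite cmodE sqr_sqrtr// addr_ge0// sqr_ge0. Qed.

Lemma normr_Re_le z : `|Re z| <= cmod z.
Proof.
rewrite -(ler_pXn2r (ltn0Sn 1)) ?nnegrE ?cmod_ge0//.
by rewrite real_normK ?num_real// sqr_cmod lerDl sqr_ge0.
Qed.

Lemma normr_Im_le z : `|Im z| <= cmod z.
Proof.
rewrite -(ler_pXn2r (ltn0Sn 1)) ?nnegrE ?cmod_ge0//.
by rewrite real_normK ?num_real// sqr_cmod lerDr sqr_ge0.
Qed.

Lemma cmod_le_ReIm z : cmod z <= `|Re z| + `|Im z|.
Proof.
rewrite -(ler_pXn2r (ltn0Sn 1)) ?nnegrE ?cmod_ge0// ?addr_ge0//.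
rewrite sqr_cmod sqrrD !real_normK ?num_real//.
by rewrite addrAC lerDl mulrn_wge0// mulr_ge0.
Qed.

Lemma cmod_real (x : R) : cmod (x%:C)%C = `|x|.
Proof. by rewrite cmodE /= expr0n addr0 sqrtr_sqr. Qed.

Lemma cmodX z k : cmod (z ^+ k) = cmod z ^+ k.
Proof.
by elim: k => [|k IH]; [rewrite !expr0 cmod1|rewrite !exprS cmodM IH].
Qed.

Lemma cmodB z w : cmod (z - w) = cmod (w - z).
Proof. by rewrite -cmodN opprB. Qed.

Lemma cmod_sum I (s : seq I) (P : pred I) (F : I -> R[i]) :
  cmod (\sum_(i <- s | P i) F i) <= \sum_(i <- s | P i) cmod (F i).
Proof.
elim/big_rec2: _ => [|i x y _ h]; first by rewrite cmod0.
by rewrite (le_trans (le_cmodD _ _))// lerD2l.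
Qed.

Lemma cmod_le_dist z w : cmod z - cmod w <= cmod (z - w).
Proof. by rewrite lerBlDr -{1}(subrK w z) le_cmodD. Qed.

Lemma ReD z w : Re (z + w) = Re z + Re w. Proof. by case: z; case: w. Qed.
Lemma ImD z w : Im (z + w) = Im z + Im w. Proof. by case: z; case: w. Qed.
Lemma ReM z w : Re (z * w) = Re z * Re w - Im z * Im w.
Proof. by case: z; case: w. Qed.
Lemma ImM z w : Im (z * w) = Re z * Im w + Im z * Re w.
Proof. by case: z; case: w. Qed.

Lemma cmod_cexpi (t : R) : cmod (cexpi t) = 1.
Proof. by rewrite cmodE /= cos2Dsin2 sqrtr1. Qed.

Lemma cexpiD (s t : R) : cexpi (s + t) = cexpi s * cexpi t.
Proof.
by apply/eqP; rewrite eq_complex ReM ImM /= cosD sinD; apply/andP; split;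
  apply/eqP; ring.
Qed.

Lemma cexpi0 : cexpi 0 = 1 :> R[i].
Proof. by rewrite /cexpi cos0 sin0. Qed.

End complex_modulus.

(** * Integration of complex-valued functions, with dominated convergence *)

Section complex_integral.
Context d (T : measurableType d) {R : realType}.
Implicit Types (f g : T -> R[i]) (u v : T -> R).

Definition cmeas f := measurable_fun setT (fun x => Re (f x)) /\
  measurable_fun setT (fun x => Im (f x)).

Lemma cmeas_cst z : cmeas (cst z).
Proof. by split; exact: measurable_cst. Qed.

Lemma cmeasD f g : cmeas f -> cmeas g -> cmeas (fun x => f x + g x).
Proof.
move=> [f1 f2] [g1 g2]; split.
  by under eq_fun do rewrite ReD; exact: measurable_funD.
by under eq_fun do rewrite ImD; exact: measurable_funD.
Qed.

Lemma cmeasM f g : cmeas f -> cmeas g -> cmeas (fun x => f x * g x).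
Proof.
move=> [f1 f2] [g1 g2]; split.
  by under eq_fun do rewrite ReM; apply: measurable_funB; exact: measurable_funM.
by under eq_fun do rewrite ImM; apply: measurable_funD; exact: measurable_funM.
Qed.

Lemma cmeasB f g : cmeas f -> cmeas g -> cmeas (fun x => f x - g x).
Proof.
move=> mf mg; have := cmeasD mf (cmeasM (cmeas_cst (-1)) mg).
by congr cmeas; apply/funext => x /=; rewrite mulN1r.
Qed.

Lemma cmeasX f k : cmeas f -> cmeas (fun x => f x ^+ k).
Proof.
move=> mf; elim: k => [|k IH].
  by under eq_fun do rewrite expr0; exact: cmeas_cst.
by under eq_fun do rewrite exprS; exact: cmeasM.
Qed.

Lemma cmeas_sum I (s : seq I) (F : I -> T -> R[i]) :
  (forall i, cmeas (F i)) -> cmeas (fun x => \sum_(i <- s) F i x).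
Proof.
move=> mF; elim: s => [|i s IH].
  by under eq_fun do rewrite big_nil; exact: cmeas_cst.
by under eq_fun do rewrite big_cons; exact: cmeasD.
Qed.

Lemma cmeas_real u : measurable_fun setT u -> cmeas (fun x => (u x)%:C%C).
Proof. by move=> mu; split => //=; exact: measurable_cst. Qed.

Lemma measurable_cos : measurable_fun setT (@cos R).
Proof. by apply: continuous_measurable_fun; exact: continuous_cos. Qed.

Lemma measurable_sin : measurable_fun setT (@sin R).
Proof. by apply: continuous_measurable_fun; exact: continuous_sin. Qed.

Lemma cmeas_cexpi u : measurable_fun setT u -> cmeas (fun x => cexpi (u x)).
Proof.
move=> mu; split => /=; first exact: (measurableT_comp measurable_cos).
exact: (measurableT_comp measurable_sin).
Qed.

Lemma measurable_cmod f : cmeas f -> measurable_fun setT (fun x => cmod (f x)).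
Proof.
move=> [f1 f2]; under eq_fun do rewrite cmodE.
apply: (@measurableT_comp _ _ _ _ _ _ (@Num.sqrt R)).
  by apply: continuous_measurable_fun; exact: sqrt_continuous.
by apply: measurable_funD; exact: measurable_funX.
Qed.

Variable mu : {measure set T -> \bar R}.

Definition cint f : R[i] :=
  Complex (\int[mu]_x Re (f x)) (\int[mu]_x Im (f x)).

Definition cintegrable f :=
  cmeas f /\ (\int[mu]_x (cmod (f x))%:E < +oo)%E.

Lemma integrableD_EFin u v : mu.-integrable setT (EFin \o u) ->
  mu.-integrable setT (EFin \o v) ->
  mu.-integrable setT (EFin \o (fun x => u x + v x)).
Proof. by move=> ui vi; exact: (integrableD measurableT ui vi). Qed.

Lemma integrableZl_EFin (k : R) u : mu.-integrable setT (EFin \o u) ->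
  mu.-integrable setT (EFin \o (fun x => k * u x)).
Proof. by move=> ui; exact: (integrableZl measurableT k ui). Qed.

Lemma cintegrable_Re f : cintegrable f ->
  mu.-integrable setT (EFin \o (fun x => Re (f x))).
Proof.
move=> [[f1 f2] foo]; apply/integrableP; split; first exact/measurable_EFinP.
apply: le_lt_trans foo; apply: ge0_le_integral => //.
- by apply: measurableT_comp => //; exact/measurable_EFinP.
- by apply/measurable_EFinP; exact: measurable_cmod.
- by move=> x _; rewrite /= lee_fin normr_Re_le.
Qed.

Lemma cintegrable_Im f : cintegrable f ->
  mu.-integrable setT (EFin \o (fun x => Im (f x))).
Proof.
move=> [[f1 f2] foo]; apply/integrableP; split; first exact/measurable_EFinP.
apply: le_lt_trans foo; apply: ge0_le_integral => //.
- by apply: measurableT_comp => //; exact/measurable_EFinP.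
- by apply/measurable_EFinP; exact: measurable_cmod.
- by move=> x _; rewrite /= lee_fin normr_Im_le.
Qed.

Lemma cintegrable_cmod f : cintegrable f ->
  mu.-integrable setT (fun x => (cmod (f x))%:E).
Proof.
move=> [mf foo]; apply/integrableP; split.
  apply: (measurable_EFinP _ _).2; exact: measurable_cmod.
by under eq_integral do rewrite /= ger0_norm ?cmod_ge0//.
Qed.

Lemma le_cintegrable f u : cmeas f -> mu.-integrable setT (EFin \o u) ->
  (forall x, cmod (f x) <= u x) -> cintegrable f.
Proof.
move=> mf /integrableP[mu' uoo] fu; split => //.
apply: le_lt_trans uoo; apply: ge0_le_integral => //.
- by move=> x _; rewrite lee_fin cmod_ge0.
- by apply/measurable_EFinP; exact: measurable_cmod.
- exact: measurableT_comp.
- by move=> x _; rewrite /= lee_fin (le_trans (fu x))// ler_norm.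
Qed.

Lemma cintegrable_real u : mu.-integrable setT (EFin \o u) ->
  cintegrable (fun x => (u x)%:C%C).
Proof.
move=> iu; apply: (@le_cintegrable _ (fun x => `|u x|)).
- by apply: cmeas_real; apply/measurable_EFinP; case/integrableP : iu.
- exact: integrable_norm.
- by move=> x; rewrite cmod_real.
Qed.

Lemma cintegrableD f g : cintegrable f -> cintegrable g ->
  cintegrable (fun x => f x + g x).
Proof.
move=> fi gi; apply: (@le_cintegrable _ (fun x => cmod (f x) + cmod (g x))).
- by apply: cmeasD; [case: fi|case: gi].
- by apply: integrableD_EFin; exact: cintegrable_cmod.
- by move=> x; exact: le_cmodD.
Qed.

Lemma cintegrableMl f g (B : R) : cmeas g -> (forall x, cmod (g x) <= B) ->
  cintegrable f -> cintegrable (fun x => g x * f x).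
Proof.
move=> mg gB fi; apply: (@le_cintegrable _ (fun x => B * cmod (f x))).
- by apply: cmeasM => //; case: fi.
- by apply: integrableZl_EFin; exact: cintegrable_cmod.
- by move=> x; rewrite cmodM ler_wpM2r ?cmod_ge0.
Qed.

Lemma cintegrableZ z f : cintegrable f -> cintegrable (fun x => z * f x).
Proof. exact: (@cintegrableMl _ (cst z) (cmod z) (cmeas_cst z)). Qed.

Lemma cintegrableB f g : cintegrable f -> cintegrable g ->
  cintegrable (fun x => f x - g x).
Proof.
move=> fi gi; have := cintegrableD fi (cintegrableZ (-1) gi).
by congr cintegrable; apply/funext => x /=; rewrite mulN1r.
Qed.

Lemma cintegrable0 : cintegrable (cst 0).
Proof.
split; first exact: cmeas_cst.
by under eq_integral do rewrite /= cmod0; rewrite integral0.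
Qed.

Lemma cintegrable_sum I (s : seq I) (F : I -> T -> R[i]) :
  (forall i, cintegrable (F i)) -> cintegrable (fun x => \sum_(i <- s) F i x).
Proof.
move=> mF; elim: s => [|i s IH].
  by under eq_fun do rewrite big_nil; exact: cintegrable0.
by under eq_fun do rewrite big_cons; exact: cintegrableD.
Qed.

Lemma cintD f g : cintegrable f -> cintegrable g ->
  cint (fun x => f x + g x) = cint f + cint g.
Proof.
move=> fi gi; apply/eqP; rewrite eq_complex ReD ImD /=; apply/andP; split; apply/eqP.
  by under eq_Rintegral do rewrite ReD; rewrite RintegralD//; exact: cintegrable_Re.
by under eq_Rintegral do rewrite ImD; rewrite RintegralD//; exact: cintegrable_Im.
Qed.

Lemma cintZ z f : cintegrable f -> cint (fun x => z * f x) = z * cint f.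
Proof.
move=> fi; have [rf jf] := (cintegrable_Re fi, cintegrable_Im fi).
apply/eqP; rewrite eq_complex ReM ImM /=; apply/andP; split; apply/eqP.
  under eq_Rintegral do rewrite ReM.
  rewrite RintegralB// ?RintegralZl//.
    exact: integrableZl_EFin.
  exact: integrableZl_EFin.
under eq_Rintegral do rewrite ImM.
rewrite RintegralD// ?RintegralZl//.
  exact: integrableZl_EFin.
exact: integrableZl_EFin.
Qed.

Lemma cintB f g : cintegrable f -> cintegrable g ->
  cint (fun x => f x - g x) = cint f - cint g.
Proof.
move=> fi gi; rewrite -[- cint g]mulN1r -cintZ// -cintD//; last exact: cintegrableZ.
by congr cint; apply/funext => x; rewrite mulN1r.
Qed.

Lemma cint0 : cint (cst 0) = 0.
Proof. by rewrite /cint /= Rintegral_cst// mul0r. Qed.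

Lemma cint_sum I (s : seq I) (F : I -> T -> R[i]) :
  (forall i, cintegrable (F i)) ->
  cint (fun x => \sum_(i <- s) F i x) = \sum_(i <- s) cint (F i).
Proof.
move=> mF; elim: s => [|i s IH].
  by under eq_fun do rewrite big_nil; rewrite big_nil cint0.
under eq_fun do rewrite big_cons; rewrite big_cons -IH cintD//.
exact: cintegrable_sum.
Qed.

Lemma cint_real u : cint (fun x => (u x)%:C%C) = (\int[mu]_x u x)%:C%C.
Proof. by rewrite /cint /= Rintegral_cst// mul0r. Qed.

(* |z|^2 = Re (conj z * z) with z = cint f, and the conjugate moves inside. *)
Lemma cmod_cint_Rintegral f : cintegrable f ->
  cmod (cint f) <= \int[mu]_x cmod (f x).
Proof.
move=> fi; set z := cint f.
have [z0|z0] := eqVneq (cmod z) 0.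
  by rewrite z0; apply: Rintegral_ge0 => x _; exact: cmod_ge0.
have zgt0 : 0 < cmod z by rewrite lt_def z0 cmod_ge0.
rewrite -(ler_pM2l zgt0) -expr2.
have -> : cmod z ^+ 2 = Re (cint (fun x => conjc z * f x)).
  by rewrite cintZ// -/z sqr_cmod; case: z {z0 zgt0} => a b /=; ring.
rewrite -RintegralZl//; last exact: cintegrable_cmod.
apply: le_Rintegral => //.
- by apply: cintegrable_Re; exact: cintegrableZ.
- by apply: integrableZl_EFin; exact: cintegrable_cmod.
- move=> x _; rewrite (le_trans (ler_norm _))// (le_trans (normr_Re_le _))//.
  rewrite cmodM ler_wpM2r ?cmod_ge0//.
  by rewrite !cmodE; case: (z) => a b /=; rewrite sqrrN.
Qed.

Lemma cmod_cint f : cintegrable f ->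
  ((cmod (cint f))%:E <= \int[mu]_x (cmod (f x))%:E)%E.
Proof.
move=> fi; apply: (@le_trans _ _ (\int[mu]_x cmod (f x))%:E).
  by rewrite lee_fin cmod_cint_Rintegral.
by rewrite fineK//; apply: integrable_fin_num => //; exact: cintegrable_cmod.
Qed.

(** Convergence in [R[i]] is expressed by the modulus of a difference tending to 0, which keeps all
    limits in [R]. The bound [u] passes to the limit [f], so the differences are dominated by 2
    u. *)
Lemma cint_dominated (F : nat -> T -> R[i]) f u :
  (forall k, cmeas (F k)) -> cmeas f -> mu.-integrable setT (EFin \o u) ->
  (forall k x, cmod (F k x) <= u x) ->
  (forall x, cmod (F k x - f x) @[k --> \oo] --> (0 : R)) ->
  cmod (cint (F k) - cint f) @[k --> \oo] --> (0 : R).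
Proof.
move=> mF mf ui Fu Ff.
have fu x : cmod (f x) <= u x.
  apply/ler_addgt0Pr => e e0.
  have /cvgrPdist_lt/(_ _ e0)[N _ /(_ N (leqnn N))/=] := Ff x.
  rewrite sub0r normrN ger0_norm ?cmod_ge0// => /ltW h.
  rewrite -[f x](addrNK (F N x)) addrC (le_trans (le_cmodD _ _))//.
  by rewrite lerD ?Fu// cmodB.
have iF k : cintegrable (F k) := le_cintegrable (mF k) ui (Fu k).
have if_ : cintegrable f := le_cintegrable mf ui fu.
have : (fun k => (\int[mu]_x (cmod (F k x - f x))%:E)%E) @ \oo --> (\int[mu]_x (cst 0 x))%E.
  have := @dominated_convergence _ _ R mu setT measurableT
    (fun k x => (cmod (F k x - f x))%:E) (cst 0%E) (fun x => (2 * u x)%:E).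
  case => //.
  - by move=> k; apply/measurable_EFinP/measurable_cmod/cmeasB.
  - by apply: aeW => x _; apply: cvg_EFin; [exact: nearW|exact: Ff].
  - exact: integrableZl_EFin.
  - apply: aeW => x k _ /=; rewrite lee_fin ger0_norm ?cmod_ge0//.
    by rewrite (le_trans (le_cmodD _ _))// cmodN mulr2n mulrDl mul1r lerD.
rewrite integral0 => /fine_cvg /= h.
apply: (squeeze_cvgr _ (cvg_cst 0) h); apply: nearW => k.
rewrite cmod_ge0 /= -cintB// -lee_fin.
have ? := cintegrableB (iF k) if_.
rewrite fineK ?cmod_cint//.
by apply: integrable_fin_num => //; exact: cintegrable_cmod.
Qed.

End complex_integral.
Arguments cmeas {d T R} f.
Arguments cint {d T R} mu f.
Arguments cintegrable {d T R} mu f.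

Lemma eq_cint d (T : measurableType d) (R : realType) (mu : {measure set T -> \bar R})
  (f g : T -> R[i]) : f =1 g -> cint mu f = cint mu g.
Proof. by move=> /funext ->. Qed.

(** * Fubini's theorem for complex-valued functions *)

Section complex_fubini.
Context d1 d2 (T1 : measurableType d1) (T2 : measurableType d2) {R : realType}.
Variables (m1 : {sigma_finite_measure set T1 -> \bar R})
          (m2 : {sigma_finite_measure set T2 -> \bar R}).
Implicit Types (u : T1 * T2 -> R) (F : T1 * T2 -> R[i]).

(** No integrability is required: Tonelli treats the positive and the negative part, and [fine]
    sends infinite values to 0 without harming measurability. *)
Lemma measurable_Rintegral2 u : measurable_fun setT u ->
  measurable_fun setT (fun x => \int[m2]_y u (x, y)).
Proof.
move=> mu.
have mE : measurable_fun setT (EFin \o u) by exact/measurable_EFinP.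
apply: (@measurableT_comp _ _ _ _ _ _ fine) => //.
under eq_fun do rewrite integralE.
apply: emeasurable_funB.
- have h := measurable_fun_fubini_tonelli_F (m2 := m2) ((EFin \o u)^\+)%E
    (measurable_funepos mE) (fun=> funepos_ge0 _ _).
  by apply: eq_measurable_fun h => x _; apply: eq_integral => y _; rewrite !funeposE.
- have h := measurable_fun_fubini_tonelli_F (m2 := m2) ((EFin \o u)^\-)%E
    (measurable_funeneg mE) (fun=> funeneg_ge0 _ _).
  by apply: eq_measurable_fun h => x _; apply: eq_integral => y _; rewrite !funenegE.
Qed.

Lemma cmeas_cint2 F : cmeas F -> cmeas (fun x => cint m2 (fun y => F (x, y))).
Proof.
by move=> [F1 F2]; split => /=; exact: (@measurable_Rintegral2 (fun z => _ (F z))).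
Qed.

Lemma cintegrable_prod F : cmeas F ->
  (\int[m1]_x \int[m2]_y (cmod (F (x, y)))%:E < +oo)%E ->
  cintegrable (m1 \x m2)%E F.
Proof.
move=> mF Foo; split => //; rewrite fubini_tonelli1//.
- by apply/measurable_EFinP; exact: measurable_cmod.
- by move=> z; rewrite lee_fin cmod_ge0.
Qed.

(** Sections are asked to be integrable for every x, not only almost every x, so that [fine] can be
    removed pointwise. *)
Lemma Rintegral_fubini1 u : (m1 \x m2)%E.-integrable setT (EFin \o u) ->
  (forall x, m2.-integrable setT (EFin \o (fun y => u (x, y)))) ->
  \int[(m1 \x m2)%E]_z u z = \int[m1]_x \int[m2]_y u (x, y).
Proof.
move=> iu iu2; rewrite /Rintegral -integral12_prod_meas1//; congr fine.
apply: eq_integral => x _; rewrite /fubini_F fineK//.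
by apply: integrable_fin_num => //; exact: iu2.
Qed.

Lemma Rintegral_fubini2 u : (m1 \x m2)%E.-integrable setT (EFin \o u) ->
  (forall y, m1.-integrable setT (EFin \o (fun x => u (x, y)))) ->
  \int[(m1 \x m2)%E]_z u z = \int[m2]_y \int[m1]_x u (x, y).
Proof.
move=> iu iu2; rewrite /Rintegral -integral21_prod_meas1//; congr fine.
apply: eq_integral => x _; rewrite /fubini_G fineK//.
by apply: integrable_fin_num => //; exact: iu2.
Qed.

Lemma cint_fubini1 F : cintegrable (m1 \x m2)%E F ->
  (forall x, cintegrable m2 (fun y => F (x, y))) ->
  cint (m1 \x m2)%E F = cint m1 (fun x => cint m2 (fun y => F (x, y))).
Proof.
move=> iF iF2; rewrite /cint /=; congr Complex.
  rewrite (@Rintegral_fubini1 (fun z => Re (F z)))//; first exact: cintegrable_Re.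
  by move=> x; exact: (cintegrable_Re (iF2 x)).
rewrite (@Rintegral_fubini1 (fun z => Im (F z)))//; first exact: cintegrable_Im.
by move=> x; exact: (cintegrable_Im (iF2 x)).
Qed.

Lemma cint_fubini2 F : cintegrable (m1 \x m2)%E F ->
  (forall y, cintegrable m1 (fun x => F (x, y))) ->
  cint (m1 \x m2)%E F = cint m2 (fun y => cint m1 (fun x => F (x, y))).
Proof.
move=> iF iF2; rewrite /cint /=; congr Complex.
  rewrite (@Rintegral_fubini2 (fun z => Re (F z)))//; first exact: cintegrable_Re.
  by move=> x; exact: (cintegrable_Re (iF2 x)).
rewrite (@Rintegral_fubini2 (fun z => Im (F z)))//; first exact: cintegrable_Im.
by move=> x; exact: (cintegrable_Im (iF2 x)).
Qed.

Lemma cint_fubini F : cintegrable (m1 \x m2)%E F ->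
  (forall x, cintegrable m2 (fun y => F (x, y))) ->
  (forall y, cintegrable m1 (fun x => F (x, y))) ->
  cint m1 (fun x => cint m2 (fun y => F (x, y))) =
  cint m2 (fun y => cint m1 (fun x => F (x, y))).
Proof. by move=> iF i1 i2; rewrite -cint_fubini1// cint_fubini2. Qed.

End complex_fubini.

(** * Measurable sets and functions on R^n *)

Section rV_measurability.
Context {R : realType}.

Lemma measurable_rV_dot n d (T : measurableType d) (f g : T -> 'rV[R]_n) :
  measurable_fun setT f -> measurable_fun setT g ->
  measurable_fun setT (fun t => rV_dot (f t) (g t)).
Proof.
move=> /measurable_fun_rVP mf /measurable_fun_rVP mg.
apply: measurable_sum => i; apply: measurable_funM; [exact: mf|exact: mg].
Qed.

Lemma measurable_enorm n : measurable_fun setT (@enorm R n).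
Proof.
apply: (@measurableT_comp _ _ _ _ _ _ (@Num.sqrt R)).
  by apply: continuous_measurable_fun; exact: sqrt_continuous.
exact: measurable_rV_dot.
Qed.

Lemma measurable_japanese n : measurable_fun setT (@japanese R n).
Proof.
apply: (@measurableT_comp _ _ _ _ _ _ (@Num.sqrt R)).
  by apply: continuous_measurable_fun; exact: sqrt_continuous.
apply: measurable_funD => //; apply: measurable_funX; exact: measurable_enorm.
Qed.

Lemma measurable_rV_affine n d (T : measurableType d) (a b : R)
    (f g : T -> 'rV[R]_n) :
  measurable_fun setT f -> measurable_fun setT g ->
  measurable_fun setT (fun t => a *: f t + b *: g t).
Proof.
move=> /measurable_fun_rVP mf /measurable_fun_rVP mg.
apply/measurable_fun_rVP => i.
rewrite (_ : _ \o _ = (fun t => a * (rV_coord i \o f) t + b * (rV_coord i \o g) t)).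
  by apply: measurable_funD; apply: measurable_funM => //; [exact: mf|exact: mg].
by apply/funext => t; rewrite /= /rV_coord !mxE.
Qed.

Lemma measurable_rVB n d (T : measurableType d) (f g : T -> 'rV[R]_n) :
  measurable_fun setT f -> measurable_fun setT g ->
  measurable_fun setT (fun t => f t - g t).
Proof.
move=> mf mg; have := measurable_rV_affine 1 (-1) mf mg.
by under eq_fun do rewrite scale1r scaleN1r.
Qed.

Definition box n (r : R) : set 'rV[R]_n := [set x | forall i, `|x 0 i| <= r].

Lemma measurable_rV_box n (A : 'I_n -> set (measurableTypeR R)) :
  (forall i, measurable (A i)) ->
  measurable [set x : 'rV[R]_n | forall i, A i (x 0 i)].
Proof.
move=> mA; rewrite (_ : [set _ | _] =
    \bigcap_(i in [set: 'I_n]) (@rV_coord R n i @^-1` A i)).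
  apply: fin_bigcap_measurable => // i _.
  by rewrite -[X in measurable X]setTI; exact: measurable_rV_coord.
by apply/seteqP; split=> x h i; [move=> _|]; exact: h.
Qed.

Lemma boxE n (r : R) :
  @box n r = [set x : 'rV[R]_n | forall i, (`[-r, r]%classic : set R) (x 0 i)].
Proof.
by apply/seteqP; split=> x /= h i; have := h i; rewrite in_itv/= ler_norml.
Qed.

Lemma measurable_box n (r : R) : measurable (@box n r).
Proof.
rewrite boxE; apply: (@measurable_rV_box _ (fun=> `[- r, r]%classic)) => i.
exact: measurable_itv.
Qed.

Lemma measurable_rV_set1 n (x : 'rV[R]_n) : measurable [set x].
Proof.
rewrite (_ : [set x] = [set y : 'rV[R]_n | forall i, [set x 0 i] (y 0 i)]).
  by apply: (@measurable_rV_box _ (fun i => [set x 0 i])) => i.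
by apply/seteqP; split=> [y ->//|y h]; apply/rowP => i; exact: h.
Qed.

Lemma lebesgue_rV_set1 n (x : 'rV[R]_n) : (0 < n)%N -> lebesgue_rV [set x] = 0%E.
Proof.
move=> n0; rewrite (_ : [set x] = [set y : 'rV[R]_n | forall i, [set x 0 i] (y 0 i)]).
  rewrite (@lebesgue_rV_box _ _ (fun i => [set x 0 i])); last by move=> i; exact: measurable_set1.
  case: n n0 x => // n _ x; rewrite big_ord_recl lebesgue_measure_set1 mul0e.
  by [].
by apply/seteqP; split=> [y ->//|y h]; apply/rowP => i; exact: h.
Qed.

Lemma rV_nearP n (x : 'rV[R]_n) (P : set 'rV[R]_n) :
  (\forall y \near x, P y) <->
  exists2 e : R, 0 < e &
    forall y : 'rV[R]_n, (forall i, `|x 0 i - y 0 i| < e) -> P y.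
Proof.
split=> [/nbhs_ballP[e /= e0 eP]|[e e0 eP]].
  exists e => // y xy; apply: eP; split => // i j.
  by rewrite (ord1 i); exact: xy.
apply/nbhs_ballP; exists e => //= y [_ xy]; apply: eP => i; exact: xy.
Qed.

(** Any preimage is a countable union of fibres. *)
Lemma countable_preimage_measurable d (T : measurableType d) (I : countType)
    (z : T -> I) (S : set I) :
  (forall m, measurable (z @^-1` [set m])) -> measurable (z @^-1` S).
Proof.
move=> mz.
rewrite (_ : _ @^-1` _ = \bigcup_k (if unpickle k is Some m then
    if m \in S then z @^-1` [set m] else set0 else set0)).
  by apply: bigcupT_measurable => k; case: unpickle => // m; case: ifP.
apply/seteqP; split => [x /= Sx|x [k _]].
  by exists (pickle (z x)) => //; rewrite pickleK mem_set.
by case: unpickle => // m; case: ifPn => // /set_mem Sm /= ->.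
Qed.

(* Rounding down to the grid of mesh 1/(k+1) has countable range. *)
Lemma continuous_measurable_rV n (f : 'rV[R]_n -> R) :
  continuous f -> measurable_fun setT f.
Proof.
move=> cf.
pose z k (x : 'rV[R]_n) : 'rV[int]_n := \row_i Num.floor (k.+1%:R * x 0 i).
pose r k (m : 'rV[int]_n) : 'rV[R]_n := \row_i ((m 0 i)%:~R / k.+1%:R).
apply: (@measurable_fun_cvg _ _ _ _ (fun k x => f (r k (z k x)))).
  move=> k _ Y mY; rewrite setTI.
  rewrite (_ : _ @^-1` _ = z k @^-1` [set m | Y (f (r k m))])//.
  apply: countable_preimage_measurable => m.
  rewrite [X in measurable X](_ : _ =
      [set x : 'rV[R]_n | forall i, [set t : R | Num.floor (k.+1%:R * t) = m 0 i] (x 0 i)]).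
    apply: (@measurable_rV_box _
      (fun i => [set t : R | Num.floor (k.+1%:R * t) = m 0 i])) => i.
    rewrite (_ : [set t | _] =
        `[(m 0 i)%:~R / k.+1%:R, (m 0 i + 1)%:~R / k.+1%:R[%classic).
      exact: measurable_itv.
    apply/seteqP; split => t /=; rewrite in_itv/= ler_pdivrMr ?ltr0n//
      ltr_pdivlMr ?ltr0n// ![t * _]mulrC.
      by move=> <-; rewrite floor_le floorD1_gt.
    by move=> h; apply/eqP; rewrite floor_eq.
  apply/seteqP; split => x /=.
    by move=> <- i; rewrite mxE.
  by move=> h; apply/rowP => i; rewrite mxE h.
move=> x _; apply/cvgrPdist_lt => e e0.
have /cvgrPdist_lt/(_ e e0)/rV_nearP[del del0 h] := cf x.
near=> k; apply: h => i; rewrite !mxE.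
have k0 : (0 : R) < k.+1%:R by rewrite ltr0n.
have hk : k.+1%:R^-1 < del by near: k; exact: near_infty_natSinv_lt (PosNum del0).
apply: le_lt_trans hk.
have -> : x 0 i - (Num.floor (k.+1%:R * x 0 i))%:~R / k.+1%:R =
  (k.+1%:R * x 0 i - (Num.floor (k.+1%:R * x 0 i))%:~R) / k.+1%:R.
  by field; rewrite nat1r gt_eqF.
rewrite normrM [X in _ * X]gtr0_norm ?invr_gt0// ler_piMl ?invr_ge0 ?ltW//.
have := floor_itv (k.+1%:R * x 0 i); rewrite intrD => /andP[h1 h2].
by rewrite ltr_norml; apply/andP; split; lra.
Unshelve. all: by end_near. Qed.

End rV_measurability.

(** * Affine changes of variables and product integrals on R^n *)

Section lebesgue_rV_integration.
Context {R : realType}.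
Notation leb := (@lebesgue_measure R).

Lemma ge0_integral_affine1 (c y : R) (f : measurableTypeR R -> \bar R) : 0 < c ->
  measurable_fun setT f -> (forall x, 0 <= f x)%E ->
  (c%:E * \int[leb]_x f (c * x + y)%R = \int[leb]_x f x)%E.
Proof.
move=> c0 mf f0.
pose T := (fun x => c * x + y : R) : measurableTypeR R -> measurableTypeR R.
have mT : measurable_fun setT T.
  by apply: measurable_funD => //; exact: measurable_funM.
pose nu : {measure set (measurableTypeR R) -> \bar R} :=
  mscale (NngNum (ltW c0)) (pushforward leb T).
have E A : measurable A -> leb A = nu mT A.
  apply: lebesgue_measure_unique => _ [[a b]] _ <-.
  rewrite /nu /= /mscale /= /pushforward.
  rewrite (_ : _ @^-1` _ = `](a - y) / c, (b - y) / c]%classic); last first.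
    by apply/seteqP; split=> x /=; rewrite !in_itv/= /T ltr_pdivrMr// ler_pdivlMr//
      ltrBlDr lerBrDr mulrC.
  rewrite !lebesgue_measure_itv/= !lte_fin ltr_pM2r ?invr_gt0// ltrD2r.
  case: ifPn => _; last by rewrite mule0.
  rewrite -!EFinD -EFinM; congr EFin; field; exact: lt0r_neq0.
rewrite [RHS](eq_measure_integral (nu mT)); last by move=> A mA _; exact: E.
rewrite /nu /= ge0_integral_mscale//=; congr (_ * _)%E.
by rewrite (ge0_integral_pushforward mT).
Qed.

Lemma ge0_integral_rV_cons n (f : 'rV[R]_n.+1 -> \bar R) :
  measurable_fun setT f -> (forall x, 0 <= f x)%E ->
  (\int[lebesgue_rV]_x f x =
   \int[leb]_r \int[lebesgue_rV]_x f (rV_cons (r, x)))%E.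
Proof.
move=> mf f0 /=.
rewrite (ge0_integral_pushforward (@measurable_rV_cons R n))//=.
rewrite preimage_setT fubini_tonelli1//=.
by apply: measurableT_comp => //; exact: measurable_rV_cons.
Qed.

Lemma rV_cons_affine n (c : R) (p q : measurableTypeR R * 'rV[R]_n) :
  c *: rV_cons p + rV_cons q = rV_cons (c * p.1 + q.1, c *: p.2 + q.2).
Proof.
apply/rowP => i; rewrite mxE [X in X + _ = _]mxE.
case: (unliftP ord0 i) => [j|] ->; last by rewrite !rV_cons0.
by rewrite !rV_consS mxE [X in _ = X + _]mxE.
Qed.

Lemma measurable_affine n (c : R) (y : 'rV[R]_n) :
  measurable_fun setT (fun x : 'rV[R]_n => c *: x + y).
Proof.
have h := @measurable_rV_affine R n _ _ c 1 id (cst y) (@measurable_id _ _ _)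
  (measurable_cst _).
by apply: eq_measurable_fun h => x _; rewrite /= scale1r.
Qed.

(** Induction on the dimension: Tonelli peels off the first coordinate, whose one-dimensional
    integral contributes one factor c. *)
Lemma ge0_integral_rV_affine n (c : R) (y : 'rV[R]_n) (f : 'rV[R]_n -> \bar R) :
  0 < c -> measurable_fun setT f -> (forall x, 0 <= f x)%E ->
  ((c ^+ n)%:E * \int[lebesgue_rV]_x f (c *: x + y)%R = \int[lebesgue_rV]_x f x)%E.
Proof.
move=> c0; elim: n y f => [|n IH] y f mf f0.
  rewrite expr0 mul1e; apply: eq_integral => x _; congr f.
  by apply/rowP => -[].
have m1 : measurable_fun setT (fun x : 'rV[R]_n.+1 => f (c *: x + y)).
  by apply: (measurableT_comp mf); exact: measurable_affine.
rewrite !ge0_integral_rV_cons//.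
rewrite -[RHS](@ge0_integral_affine1 c (rV_uncons y).1)//.
- rewrite exprS EFinM -muleA; congr (_ * _)%E; rewrite -ge0_integralZl//.
  + apply: eq_integral => r _.
    rewrite -[RHS](IH (rV_uncons y).2)//.
    * congr (_ * _)%E; apply: eq_integral => x _.
      by rewrite -{1}(rV_unconsK y) rV_cons_affine.
    * apply: measurableT_comp => //; apply: measurableT_comp.
        exact: measurable_rV_cons.
      exact: measurable_fun_pair.
  + apply: (measurable_fun_fubini_tonelli_F (m2 := @lebesgue_rV R n)
      (fun p => f (c *: rV_cons p + y))) => //.
    by apply: (measurableT_comp m1); exact: measurable_rV_cons.
  + by move=> r _; exact: integral_ge0.
  + by rewrite lee_fin exprn_ge0// ltW.
- apply: (measurable_fun_fubini_tonelli_F (m2 := @lebesgue_rV R n)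
      (fun p => f (rV_cons p))) => //.
  by apply: measurableT_comp => //; exact: measurable_rV_cons.
- by move=> x; exact: integral_ge0.
Qed.

Lemma ge0_integral_rV_translate n (y : 'rV[R]_n) (f : 'rV[R]_n -> \bar R) :
  measurable_fun setT f -> (forall x, 0 <= f x)%E ->
  (\int[lebesgue_rV]_x f (x + y)%R = \int[lebesgue_rV]_x f x)%E.
Proof.
move=> mf f0; rewrite -[RHS](@ge0_integral_rV_affine _ 1 y)// expr1n mul1e.
by apply: eq_integral => x _; rewrite scale1r.
Qed.

Lemma integrable_rV_affine n (c : R) (y : 'rV[R]_n) (u : 'rV[R]_n -> R) :
  0 < c -> lebesgue_rV.-integrable setT (EFin \o u) ->
  lebesgue_rV.-integrable setT (EFin \o (fun x => u (c *: x + y))).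
Proof.
move=> c0 /integrableP[mu uoo]; apply/integrableP; split.
  by apply: (measurableT_comp mu); exact: measurable_affine.
have := @ge0_integral_rV_affine n c y (fun x => `|(u x)%:E|)%E c0.
move=> /(_ _ (fun=> abse_ge0 _)) E.
rewrite -E in uoo; last exact: measurableT_comp.
have cn : 0 < c ^+ n by rewrite exprn_gt0.
have := lte_pdivlMl.
move=> _; case: (ltP (\int[lebesgue_rV]_x `|(u (c *: x + y))%:E|)%E +oo%E) => //.
rewrite leye_eq => /eqP E2; move: uoo; rewrite E2 gt0_muley//.
Qed.

Lemma Rintegral_rV_affine n (c : R) (y : 'rV[R]_n) (u : 'rV[R]_n -> R) :
  0 < c -> lebesgue_rV.-integrable setT (EFin \o u) ->
  c ^+ n * \int[lebesgue_rV]_x u (c *: x + y) = \int[lebesgue_rV]_x u x.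
Proof.
move=> c0 iu; have iv := integrable_rV_affine y c0 iu.
have mu : measurable_fun setT (EFin \o u) by case/integrableP : iu.
rewrite -RintegralZl//.
rewrite /Rintegral; congr fine.
under eq_integral do rewrite EFinM.
rewrite integralZl// [in RHS]integralE [in LHS]integralE.
rewrite muleBr//; last first.
  exact: integrable_add_def.
rewrite -(@ge0_integral_rV_affine n c y _ c0 (measurable_funepos mu))//.
rewrite -(@ge0_integral_rV_affine n c y _ c0 (measurable_funeneg mu))//.
congr (_ * _ - _ * _)%E; apply: eq_integral => x _.
  by rewrite !funeposE.
by rewrite !funenegE.
Qed.

Lemma cintegrable_rV_affine n (c : R) (y : 'rV[R]_n) (f : 'rV[R]_n -> R[i]) :
  0 < c -> cintegrable lebesgue_rV f ->
  cintegrable lebesgue_rV (fun x => f (c *: x + y)).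
Proof.
move=> c0 fi.
apply: (le_cintegrable _ (integrable_rV_affine y c0 (cintegrable_cmod fi))) => //.
case: fi => -[f1 f2] _; split.
  by apply: (measurableT_comp f1); exact: measurable_affine.
by apply: (measurableT_comp f2); exact: measurable_affine.
Qed.

Lemma cint_rV_affine n (c : R) (y : 'rV[R]_n) (f : 'rV[R]_n -> R[i]) :
  0 < c -> cintegrable lebesgue_rV f ->
  (c ^+ n)%:C%C * cint lebesgue_rV (fun x => f (c *: x + y)) = cint lebesgue_rV f.
Proof.
move=> c0 fi; apply/eqP; rewrite eq_complex ReM ImM /= !mul0r subr0 addr0.
rewrite (@Rintegral_rV_affine n c y (fun x => Re (f x)))//; last exact: cintegrable_Re.
rewrite (@Rintegral_rV_affine n c y (fun x => Im (f x)))//; last exact: cintegrable_Im.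
by rewrite !eqxx.
Qed.

Lemma cint_rV_translate n (y : 'rV[R]_n) (f : 'rV[R]_n -> R[i]) :
  cintegrable lebesgue_rV f ->
  cint lebesgue_rV (fun x => f (x + y)) = cint lebesgue_rV f.
Proof.
move=> fi; rewrite -[RHS](@cint_rV_affine n 1 y f)// expr1n mul1r.
by apply: eq_cint => x; rewrite scale1r.
Qed.

Lemma cmeas_comp d1 d2 (T1 : measurableType d1) (T2 : measurableType d2)
    (f : T2 -> R[i]) (g : T1 -> T2) :
  cmeas f -> measurable_fun setT g -> cmeas (fun x => f (g x)).
Proof. by move=> [f1 f2] mg; split; [exact: (measurableT_comp f1)|exact: (measurableT_comp f2)]. Qed.

Lemma cintegrable_rV_cons n (f : 'rV[R]_n.+1 -> R[i]) :
  cintegrable lebesgue_rV f <->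
  cintegrable (leb \x @lebesgue_rV R n)%E (fun p => f (rV_cons p)).
Proof.
have P (g : 'rV[R]_n.+1 -> R[i]) : cmeas g ->
    (\int[lebesgue_rV]_x (cmod (g x))%:E =
    \int[(leb \x @lebesgue_rV R n)]_x (cmod (g (rV_cons x)))%:E)%E.
  move=> mg /=; rewrite (ge0_integral_pushforward (@measurable_rV_cons R n))//.
    by apply/measurable_EFinP; exact: measurable_cmod.
  by move=> x _; rewrite lee_fin cmod_ge0.
split=> -[mf foo].
  by split; [exact: (cmeas_comp mf (@measurable_rV_cons R n))|rewrite -P].
have mf' : cmeas f.
  have := cmeas_comp mf (@measurable_rV_uncons R n).
  by under eq_fun do rewrite rV_unconsK.
by split => //; rewrite P.
Qed.

Lemma cint_rV_cons n (f : 'rV[R]_n.+1 -> R[i]) : cintegrable lebesgue_rV f ->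
  cint lebesgue_rV f = cint (leb \x @lebesgue_rV R n)%E (fun p => f (rV_cons p)).
Proof.
move=> fi; have fi' := fi; move/cintegrable_rV_cons : fi' => fi'.
rewrite /cint /Rintegral /=; congr (Complex (fine _) (fine _)).
  rewrite (integral_pushforward (@measurable_rV_cons R n))//.
  - by case: fi => -[f1 _] _; exact/measurable_EFinP.
  - by rewrite preimage_setT; exact: cintegrable_Re fi'.
rewrite (integral_pushforward (@measurable_rV_cons R n))//.
- by case: fi => -[_ f1] _; exact/measurable_EFinP.
- by rewrite preimage_setT; exact: cintegrable_Im fi'.
Qed.

(** Integrability and value are proved together, because Fubini in dimension n + 1 needs the
    integrability in dimension n. *)
Lemma cintegrable_cint_prod n (F : 'I_n -> R -> R[i]) :
  (forall i, cintegrable leb (F i)) ->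
  cintegrable lebesgue_rV (fun x : 'rV[R]_n => \prod_(i < n) F i (x 0 i)) /\
  cint lebesgue_rV (fun x : 'rV[R]_n => \prod_(i < n) F i (x 0 i)) =
  \prod_(i < n) cint leb (F i).
Proof.
elim: n F => [|n IH] F iF.
  (* In dimension 0 the measure is a Dirac mass, so an empty product integrates to 1. *)
  have E : (fun x : 'rV[R]_0 => \prod_(i < 0) F i (x 0 i)) = cst 1.
    by apply/funext => x; rewrite big_ord0.
  rewrite E big_ord0; split.
    split; first exact: cmeas_cst.
    by rewrite /= integral_dirac// diracT mul1e ltry.
  rewrite /cint /Rintegral /= !integral_dirac// diracT !mul1e/=.
  by [].
have [iG cG] := IH (fun i => F (lift ord0 i)) (fun i => iF _).
set G := (fun x : 'rV[R]_n => _) in iG cG.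
pose H (p : measurableTypeR R * 'rV[R]_n) := F ord0 p.1 * G p.2.
have HE : (fun p => \prod_(i < n.+1) F i (rV_cons p 0 i)) = H.
  apply/funext => p; rewrite big_ord_recl rV_cons0; congr (_ * _).
  by apply: eq_bigr => i _; rewrite rV_consS.
have mH : cmeas H.
  apply: cmeasM; apply: cmeas_comp => //; [by case: (iF ord0)|by case: iG].
have iH : cintegrable (leb \x @lebesgue_rV R n)%E H.
  apply: cintegrable_prod => //.
  under eq_integral => x _.
    under eq_integral do rewrite cmodM EFinM /=.
    rewrite ge0_integralZl//; last 3 first.
    - by apply/measurable_EFinP; apply: measurable_cmod; case: iG.
    - by move=> y _; rewrite lee_fin cmod_ge0.
    - by rewrite lee_fin cmod_ge0.
    over.
  have foo : (\int[lebesgue_rV]_x (cmod (G x))%:E)%E \is a fin_num.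
    by apply: integrable_fin_num => //; exact: cintegrable_cmod.
  rewrite -(fineK foo) ge0_integralZr//; last 3 first.
  - by apply/measurable_EFinP; apply: measurable_cmod; case: (iF ord0).
  - by move=> y _; rewrite lee_fin cmod_ge0.
  - by rewrite fineK//; apply: integral_ge0 => x _; rewrite lee_fin cmod_ge0.
  have foo2 : (\int[leb]_x (cmod (F ord0 x))%:E)%E \is a fin_num.
    by apply: integrable_fin_num => //; exact: cintegrable_cmod.
  by rewrite -(fineK foo2) -EFinM ltry.
have iP : cintegrable lebesgue_rV (fun x : 'rV[R]_n.+1 => \prod_(i < n.+1) F i (x 0 i)).
  by apply/cintegrable_rV_cons; rewrite HE.
split=> //; rewrite cint_rV_cons// HE cint_fubini1//; last first.
  by move=> x; exact: (cintegrableZ (F ord0 x) iG).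
rewrite big_ord_recl -cG mulrC -cintZ//; apply: eq_cint => x.
by rewrite mulrC; exact: (cintZ (F ord0 x) iG).
Qed.

End lebesgue_rV_integration.

(** * The mean value theorem along a line *)

Section line_derivative.
Context {R : realType} {n : nat}.
Implicit Types (u : 'rV[R]_n -> R) (x v : 'rV[R]_n).

Lemma is_derive_line u x v (s : R) : derivable u (x + s *: v) v ->
  is_derive s 1 (fun r => u (x + r *: v)) ('D_v u (x + s *: v)).
Proof.
have E : (fun h : R => h^-1 *: (u (x + (h *: 1 + s) *: v) - u (x + s *: v))) =
    (fun h => h^-1 *: (u (h *: v + (x + s *: v)) - u (x + s *: v))).
  apply/funext => h; congr (_ *: (u _ - _)).
  have -> : h *: (1 : R) = h by exact: mulr1.
  by rewrite scalerDl addrCA.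
move=> du; split.
  by rewrite /derivable E.
by rewrite /derive E.
Qed.

Lemma line_MVT u x v (t : R) : 0 <= t ->
  (forall s, 0 <= s <= t -> derivable u (x + s *: v) v) ->
  exists2 s, 0 <= s <= t & u (x + t *: v) - u x = t * 'D_v u (x + s *: v).
Proof.
move=> t0 du.
have [|/=|s st E] := @MVT_segment R (fun r => u (x + r *: v))
  (fun r => 'D_v u (x + r *: v)) 0 t t0.
- by move=> s /itvP st; apply: is_derive_line; apply: du; rewrite !st.
- apply: derivable_within_continuous => s /itvP st.
  by have [] := @is_derive_line u x v s (du _ _); rewrite ?st.
- exists s; first by move: st; rewrite in_itv.
  by move: E; rewrite subr0 scale0r addr0 mulrC.
Qed.

End line_derivative.

(** * An integrable weight of product form *)

Section polynomial_weight.
Context {R : realType}.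

Lemma integrable_oneDsqrV :
  (@lebesgue_measure R).-integrable setT (EFin \o (fun x : R => (1 + x ^+ 2)^-1)).
Proof.
have c : continuous (fun x : R => (oneDsqr x)^-1) by exact: continuous_oneDsqrV.
have p x : 0 <= (oneDsqr x)^-1 :> R by rewrite invr_ge0 ltW// oneDsqr_gt0.
apply/integrableP; split.
  by apply/measurable_EFinP; apply: continuous_measurable_fun; exact: c.
under eq_integral => x _ do rewrite /= ger0_norm ?p//.
rewrite (@ge0_symfun_integralT _ (fun x => (oneDsqr x)^-1))//.
  rewrite (_ : [set x | _] = `[0, +oo[%classic); last first.
    by apply/seteqP; split => x/=; rewrite in_itv/= andbT.
  by rewrite integral0y_oneDsqr -EFinM ltry.
by move=> x /=; rewrite /oneDsqr sqrrN.
Qed.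

(** The common integrable majorant of rapidly decreasing functions; the product form reduces its
    integral to dimension one. *)
Definition pweight n (x : 'rV[R]_n) : R := \prod_(i < n) (1 + x 0 i ^+ 2)^-1.

Lemma oneDsqr_gt0' (x : R) : 0 < 1 + x ^+ 2.
Proof. by rewrite ltr_pwDl// sqr_ge0. Qed.

Lemma pweight_gt0 n (x : 'rV[R]_n) : 0 < pweight x.
Proof. by apply: prodr_gt0 => i _; rewrite invr_gt0 oneDsqr_gt0'. Qed.

Lemma integrable_prod n (F : 'I_n -> R -> R) :
  (forall i, (@lebesgue_measure R).-integrable setT (EFin \o F i)) ->
  lebesgue_rV.-integrable setT (EFin \o (fun x : 'rV[R]_n => \prod_(i < n) F i (x 0 i))) /\
  \int[lebesgue_rV]_x (\prod_(i < n) F i ((x : 'rV[R]_n) 0 i)) =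
  \prod_(i < n) \int[lebesgue_measure]_x F i x.
Proof.
move=> iF; have [iP cP] := @cintegrable_cint_prod R n (fun i x => (F i x)%:C%C)
  (fun i => cintegrable_real (iF i)).
have E : (fun x : 'rV[R]_n => \prod_(i < n) (F i (x 0 i))%:C%C) =
    (fun x => (\prod_(i < n) F i (x 0 i))%:C%C).
  by apply/funext => x; rewrite rmorph_prod.
rewrite E in iP cP; split; first exact: (cintegrable_Re iP).
move: cP; rewrite cint_real; under [X in _ = X -> _]eq_bigr do rewrite cint_real.
by rewrite -rmorph_prod => -[].
Qed.

Lemma integrable_pweight n :
  lebesgue_rV.-integrable setT (EFin \o @pweight n).
Proof.
by have [+ _] := @integrable_prod n (fun _ x => (1 + x ^+ 2)^-1)
  (fun=> integrable_oneDsqrV).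
Qed.

(** This dominates difference quotients with steps at most 1 by a multiple of the weight at the base
    point. *)
Lemma pweight_shift n (x : 'rV[R]_n) i (s : R) : `|s| <= 1 ->
  pweight (x + s *: delta_mx 0 i) <= 3 * pweight x.
Proof.
move=> s1; rewrite /pweight (bigD1 i)//= [in leRHS](bigD1 i)//= mulrA.
rewrite (eq_bigr (fun j => (1 + x 0 j ^+ 2)^-1)); last first.
  by move=> j ji; rewrite !mxE eqxx /= (negbTE ji) mulr0 addr0.
rewrite ler_wpM2r//.
  by apply: prodr_ge0 => j _; rewrite invr_ge0 ltW// oneDsqr_gt0'.
rewrite !mxE !eqxx mulr1 -[leRHS]invf_div lef_pV2 ?posrE ?divr_gt0 ?oneDsqr_gt0'//.
rewrite ler_pdivrMr//.
(* Writing x for the coordinate, the claim is that 2 + 2 x^2 + 6 x s + 3 s^2 = 2 (x + 3 s / 2)^2 + 2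
   - 3 s^2 / 2 is nonnegative. *)
have : s ^+ 2 <= 1 by rewrite -real_normK ?num_real// expr_le1.
have := sqr_ge0 (x 0 i + s + s); have := sqr_ge0 (x 0 i + 2 * s).
have := sqr_ge0 (x 0 i + 3 / 2 * s).
nra.
Qed.

End polynomial_weight.

(** * Bounds for Schwartz functions and their iterated derivatives *)

Section schwartz_functions.
Context {R : realType} {n : nat}.
Implicit Types (u g : 'rV[R]_n -> R) (i : 'I_n).

Definition rapid g :=
  forall alpha : 'I_n -> nat, exists C : R, forall x, `|mpower alpha x * g x| <= C.

Lemma mpower_add2 (alpha : 'I_n -> nat) i (x : 'rV[R]_n) :
  mpower (fun j => alpha j + (j == i).*2)%N x = x 0 i ^+ 2 * mpower alpha x.
Proof.
rewrite /mpower (bigD1 i)//= [in RHS](bigD1 i)//= eqxx/= exprD.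
rewrite [in RHS]mulrA [in RHS](mulrC (x 0 i ^+ 2)); congr (_ * _).
by apply: eq_bigr => j /negbTE ->; rewrite addn0.
Qed.

(** The product of the factors 1 + x_i^2 is expanded one coordinate at a time: each factor keeps the
    monomial or raises one exponent by 2, and every resulting term is bounded by hypothesis. *)
Lemma rapid_pweight g : rapid g -> exists2 C, 0 <= C & forall x, `|g x| <= C * pweight x.
Proof.
move=> rg.
have H (w : seq 'I_n) : forall alpha : 'I_n -> nat, exists C : R, forall x,
    `|mpower alpha x * (\prod_(i <- w) (1 + x 0 i ^+ 2) * g x)| <= C.
  elim: w => [|i w IH] alpha.
    by have [C hC] := rg alpha; exists C => x; rewrite big_nil mul1r.
  have [C1 h1] := IH alpha; have [C2 h2] := IH (fun j => alpha j + (j == i).*2)%N.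
  exists (C1 + C2) => x; rewrite big_cons mulrDl mul1r mulrDl mulrDr.
  rewrite (le_trans (ler_normD _ _))// lerD ?h1//.
  by have := h2 x; rewrite mpower_add2; congr (`|_| <= _); ring.
have [C hC] := H (index_enum 'I_n) (fun=> 0%N).
exists `|C| => // x; rewrite /pweight prodfV ler_pdivlMr; last first.
  by apply: prodr_gt0 => i _; exact: oneDsqr_gt0'.
have := hC x; rewrite [mpower _ _]big1// mul1r normrM mulrC => h.
apply: le_trans (le_trans h (ler_norm _)).
by rewrite ler_wpM2l// ler_norm.
Qed.

Lemma partials_nseq i k u : partials (nseq k i) u = iter k (partial i) u.
Proof. by elim: k => //= k ->. Qed.

Lemma mpartial_single i k u :
  mpartial (fun j => if j == i then k else 0%N) u = iter k (partial i) u.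
Proof.
rewrite /mpartial -partials_nseq; congr (partials _ u).
have : uniq (enum 'I_n) by exact: enum_uniq.
have : i \in enum 'I_n by rewrite mem_enum.
elim: (enum 'I_n) => // j s IH; rewrite inE => /predU1P[<-|js] /= /andP[jns us].
  rewrite eqxx; have -> : flatten [seq nseq (if j == i then k else 0%N) j | j <- s] = [::].
    elim: s jns {IH us} => // l s IH; rewrite inE negb_or => /andP[jl js] /=.
    by rewrite eq_sym (negbTE jl)/= IH.
  by rewrite cats0.
have -> : (j == i) = false by apply/negbTE; apply: contraNneq jns => ->.
exact: IH.
Qed.

Variable u : 'rV[R]_n -> R.
Hypothesis su : real_schwartz u.

Lemma schwartz_continuous i k : continuous (iter k (partial i) u).
Proof. by move=> x; rewrite -partials_nseq; exact: (su.1 _ x I).1. Qed.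

Lemma schwartz_derivable i k x : derivable (iter k (partial i) u) x (delta_mx 0 i).
Proof. by rewrite -partials_nseq; exact: (su.1 _ x I).2. Qed.

Lemma schwartz_bound i k :
  exists2 C, 0 <= C & forall x, `|iter k (partial i) u x| <= C * pweight x.
Proof.
by apply: rapid_pweight => alpha; rewrite -mpartial_single; exact: su.2.
Qed.

End schwartz_functions.

(** * Decay of the Fourier transform of a Schwartz function *)

Section fourier_decay.
Context {R : realType}.

Lemma cvg_unit_fraction_dnbhs : (fun k : nat => k.+1%:R^-1 : R) @ \oo --> (0 : R)^'.
Proof.
move=> P /= [e /= e0 eP].
suff : \forall k \near \oo, P (k.+1%:R^-1) by [].
near=> k; apply: eP => /=; last by rewrite gt_eqF// invr_gt0.
rewrite sub0r normrN ger0_norm ?invr_ge0//.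
by near: k; exact: near_infty_natSinv_lt (PosNum e0).
Unshelve. all: by end_near. Qed.

(** Derivatives are read along the steps 1/(k+1), since dominated convergence is used for
    sequences. *)
Lemma derivable_cvg_seq (V : normedModType R) (f : V -> R) (x v : V) :
  derivable f x v ->
  (k.+1%:R^-1)^-1 *: (f (k.+1%:R^-1 *: v + x) - f x) @[k --> \oo] --> 'D_v f x.
Proof. by move=> df; exact: (cvg_comp _ _ cvg_unit_fraction_dnbhs df). Qed.

Lemma cmod_cvg_unique (z : nat -> R[i]) (a b : R[i]) :
  cmod (z k - a) @[k --> \oo] --> (0 : R) ->
  cmod (z k - b) @[k --> \oo] --> (0 : R) -> a = b.
Proof.
move=> za zb; apply/eqP; rewrite -subr_eq0; apply/eqP/Normc.eq0_normc.
change (cmod (a - b) = 0); apply: le_anti; rewrite cmod_ge0 andbT.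
have h : cmod (z k - a) + cmod (z k - b) @[k --> \oo] --> (0 : R).
  by rewrite -[X in _ --> X]addr0; exact: cvgD.
apply: (cvgr_to_ge h); apply: nearW => k.
rewrite -(cmodN (z k - a)) (le_trans _ (le_cmodD _ _))//.
by rewrite opprB addrA subrK.
Qed.

Lemma cvg_cexpi_quotient (r : R) :
  cmod ((cexpi (k.+1%:R^-1 * r) - 1) * ((k.+1%:R^-1)^-1)%:C%C - Complex 0 r)
    @[k --> \oo] --> (0 : R).
Proof.
have dc : is_derive (0 : R) 1 (fun s => cos (s * r)) 0.
  by apply: is_derive_eq; rewrite mul0r sin0 oppr0 mul0r.
have ds : is_derive (0 : R) 1 (fun s => sin (s * r)) r.
  by apply: is_derive_eq; rewrite mul0r cos0 mul1r scaler0 add0r; exact: mulr1.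
have hc := derivable_cvg_seq (@ex_derive _ _ _ _ _ _ _ dc).
have hs := derivable_cvg_seq (@ex_derive _ _ _ _ _ _ _ ds).
rewrite derive_val in hc; rewrite derive_val in hs.
have h : (fun k : nat => `|(k.+1%:R^-1)^-1 * (cos (k.+1%:R^-1 * r) - 1)| +
    `|(k.+1%:R^-1)^-1 * sin (k.+1%:R^-1 * r) - r|) @ \oo --> (0 : R).
  rewrite -[X in _ --> X]addr0; apply: cvgD; apply/norm_cvg0P.
    apply: cvg_trans hc; apply: near_eq_cvg; apply: nearW => k /=.
    have -> : k.+1%:R^-1 *: (1 : R) = k.+1%:R^-1 by exact: mulr1.
    by rewrite addr0 mul0r cos0.
  apply/subr_cvg0.
  apply: cvg_trans hs; apply: near_eq_cvg; apply: nearW => k /=.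
  have -> : k.+1%:R^-1 *: (1 : R) = k.+1%:R^-1 by exact: mulr1.
  by rewrite addr0 mul0r sin0 subr0.
apply: (squeeze_cvgr _ (cvg_cst 0) h); apply: nearW => k.
rewrite cmod_ge0 /= (le_trans (cmod_le_ReIm _))//.
by apply: lerD; rewrite le_eqVlt; apply/orP; left; apply/eqP; congr (`|_|);
  rewrite /=; ring.
Qed.

Context {n : nat}.
Implicit Types (u v w : 'rV[R]_n -> R) (xi : 'rV[R]_n) (i : 'I_n).

Definition rfourier v xi : R[i] :=
  cint lebesgue_rV (fun x => cexpi (- rV_dot x xi) * (v x)%:C%C).

Lemma rV_dotDl (x y z : 'rV[R]_n) : rV_dot (x + y) z = rV_dot x z + rV_dot y z.
Proof. by rewrite -big_split/=; apply: eq_bigr => i _; rewrite mxE mulrDl. Qed.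

Lemma rV_dotZl (c : R) (x z : 'rV[R]_n) : rV_dot (c *: x) z = c * rV_dot x z.
Proof. by rewrite /rV_dot mulr_sumr; apply: eq_bigr => i _; rewrite mxE mulrA. Qed.

Lemma rV_dotC (x z : 'rV[R]_n) : rV_dot x z = rV_dot z x.
Proof. by apply: eq_bigr => i _; rewrite mulrC. Qed.

Lemma rV_dotDr (x y z : 'rV[R]_n) : rV_dot z (x + y) = rV_dot z x + rV_dot z y.
Proof. by rewrite ![rV_dot z _]rV_dotC rV_dotDl. Qed.

Lemma rV_dotZr (c : R) (x z : 'rV[R]_n) : rV_dot z (c *: x) = c * rV_dot z x.
Proof. by rewrite ![rV_dot z _]rV_dotC rV_dotZl. Qed.

Lemma rV_dotNr (x z : 'rV[R]_n) : rV_dot z (- x) = - rV_dot z x.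
Proof. by rewrite -scaleN1r rV_dotZr mulN1r. Qed.

Lemma rV_dot_delta i xi : rV_dot (delta_mx 0 i) xi = xi 0 i.
Proof.
rewrite /rV_dot (bigD1 i)//= mxE !eqxx mul1r big1 ?addr0// => j ji.
by rewrite mxE eqxx /= (negbTE ji) mul0r.
Qed.

Lemma cmeas_character (xi : 'rV[R]_n) :
  cmeas (fun x : 'rV[R]_n => cexpi (- rV_dot x xi)).
Proof.
apply: cmeas_cexpi; apply: measurableT_comp => //.
by apply: measurable_rV_dot => //; exact: measurable_cst.
Qed.

Lemma pweight_dominated v (C : R) : measurable_fun setT v ->
  (forall x, `|v x| <= C * pweight x) ->
  lebesgue_rV.-integrable setT (EFin \o v).
Proof.
move=> mv vC; apply: (@le_integrable _ _ _ _ _ _ _ (EFin \o (fun x => C * pweight x))) => //.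
- exact/measurable_EFinP.
- move=> x _; rewrite /= lee_fin (le_trans (vC x))// ler_norm//.
- exact: integrableZl_EFin (integrable_pweight n).
Qed.

Lemma cintegrable_character v xi : lebesgue_rV.-integrable setT (EFin \o v) ->
  cintegrable lebesgue_rV (fun x => cexpi (- rV_dot x xi) * (v x)%:C%C).
Proof.
move=> iv; apply: (@cintegrableMl _ _ _ _ _ _ 1).
- exact: cmeas_character.
- by move=> x; rewrite cmod_cexpi.
- exact: cintegrable_real.
Qed.

Lemma rfourier_bound v : lebesgue_rV.-integrable setT (EFin \o v) ->
  exists2 K, 0 <= K & forall xi, cmod (rfourier v xi) <= K.
Proof.
move=> iv; exists (\int[lebesgue_rV]_x `|v x|).
  by apply: Rintegral_ge0 => x _.
move=> xi; apply: (le_trans (cmod_cint_Rintegral (cintegrable_character xi iv))).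
by under eq_Rintegral do rewrite cmodM cmod_cexpi mul1r cmod_real.
Qed.

(** Integration by parts is avoided. By translation invariance the transform of a difference
    quotient with step h is (e^(i h xi_i) - 1)/h times that of [v]. The step tends to 0 on both
    sides: the multiplier tends to i xi_i, and dominated convergence gives the transform of the
    derivative. *)
Lemma rfourier_partial v i (C : R) xi : 0 <= C ->
  measurable_fun setT v -> measurable_fun setT (partial i v) ->
  (forall x, derivable v x (delta_mx 0 i)) ->
  (forall x, `|v x| <= C * pweight x) ->
  (forall x, `|partial i v x| <= C * pweight x) ->
  rfourier (partial i v) xi = Complex 0 (xi 0 i) * rfourier v xi.
Proof.
move=> C0 mv mw dv vC wC; set w := partial i v in mw wC *.
pose e : 'rV[R]_n := delta_mx 0 i.
pose t (k : nat) : R := k.+1%:R^-1.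
have t0 k : 0 < t k by rewrite invr_gt0.
pose D k x := (t k)^-1 * (v (x + t k *: e) - v x).
have iv := pweight_dominated mv vC.
have it k : lebesgue_rV.-integrable setT (EFin \o (fun x => v (x + t k *: e))).
  have := @integrable_rV_affine R n 1 (t k *: e) v ltr01 iv.
  by under [X in _.-integrable _ (_ \o X) -> _]eq_fun do rewrite scale1r.
have FD k : rfourier (D k) xi =
    (cexpi (t k * xi 0 i) - 1) * ((t k)^-1)%:C%C * rfourier v xi.
  have -> : rfourier (D k) xi = ((t k)^-1)%:C%C * (rfourier (fun x => v (x + t k *: e)) xi
      - rfourier v xi).
    rewrite -cintB; [|exact: cintegrable_character|exact: cintegrable_character].
    rewrite -cintZ; last by apply: cintegrableB; exact: cintegrable_character.
    by apply: eq_cint => x; rewrite rmorphM rmorphB /=; ring.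
  have -> : rfourier (fun x => v (x + t k *: e)) xi = cexpi (t k * xi 0 i) * rfourier v xi.
    rewrite -cintZ; last exact: cintegrable_character.
    rewrite -(@cint_rV_translate _ _ (t k *: e)).
      apply: eq_cint => x; rewrite mulrA -cexpiD rV_dotDl rV_dotZl rV_dot_delta.
      by congr (cexpi _ * _); ring.
    by apply: cintegrableZ; exact: cintegrable_character.
  by ring.
apply: (@cmod_cvg_unique (fun k => rfourier (D k) xi)); last first.
  have h : cmod ((cexpi (k.+1%:R^-1 * xi 0 i) - 1) * ((k.+1%:R^-1)^-1)%:C%C -
      Complex 0 (xi 0 i)) * cmod (rfourier v xi) @[k --> \oo] --> (0 : R).
    rewrite -[X in _ --> X](mul0r (cmod (rfourier v xi))).
    by apply: cvgM; [exact: cvg_cexpi_quotient|exact: cvg_cst].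
  apply: cvg_trans h; apply: near_eq_cvg; apply: nearW => k.
  by rewrite FD -mulrBl cmodM.
apply: (@cint_dominated _ _ _ _ _ _ (fun x => 3 * C * pweight x)).
- move=> k; apply: cmeasM; first exact: cmeas_character.
  apply: cmeas_real; apply: measurable_funM => //; apply: measurable_funB => //.
  by apply/measurable_EFinP; case/integrableP : (it k).
- apply: cmeasM; first exact: cmeas_character.
  exact: cmeas_real.
- exact: integrableZl_EFin (integrable_pweight n).
- move=> k x; rewrite cmodM cmod_cexpi mul1r cmod_real.
  (* The quotient is a value of the derivative at distance at most 1 from x, whence the factor 3 of
     [pweight_shift]. *)
  have [s /andP[s0 st] E] := line_MVT (ltW (t0 k)) (fun s _ => dv (x + s *: e)).
  rewrite /D E mulKf ?gt_eqF// (le_trans (wC _))//.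
  rewrite [3 * C]mulrC -mulrA ler_wpM2l//; apply: pweight_shift.
  rewrite ger0_norm// (le_trans st)// invf_le1//.
  by rewrite ler1n.
- move=> x; under eq_cvg do rewrite -mulrBr cmodM cmod_cexpi mul1r -rmorphB cmod_real.
  apply/norm_cvg0P/subr_cvg0.
  have h := derivable_cvg_seq (dv x).
  apply: cvg_trans h; apply: near_eq_cvg; apply: nearW => k.
  by rewrite /D [x + _]addrC.
Qed.

Variable u : 'rV[R]_n -> R.
Hypothesis su : real_schwartz u.

Lemma schwartz_measurable i k : measurable_fun setT (iter k (partial i) u).
Proof. by apply: continuous_measurable_rV; exact: schwartz_continuous. Qed.

Lemma rfourier_schwartz_partial i k xi :
  rfourier (iter k.+1 (partial i) u) xi =
  Complex 0 (xi 0 i) * rfourier (iter k (partial i) u) xi.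
Proof.
have [C C0 hC] := schwartz_bound su i k.
have [D D0 hD] := schwartz_bound su i k.+1.
apply: (@rfourier_partial _ _ (C + D)).
- exact: addr_ge0.
- exact: schwartz_measurable.
- exact: (schwartz_measurable i k.+1).
- by move=> x; exact: schwartz_derivable.
- by move=> x; rewrite (le_trans (hC x))// ler_wpM2r ?lerDl// ltW// pweight_gt0.
- by move=> x; rewrite (le_trans (hD x))// ler_wpM2r ?lerDr// ltW// pweight_gt0.
Qed.

(** Multiplying by xi_i^2 costs two more derivatives in direction i, so the induction on m needs k
    to vary. *)
Lemma rfourier_coord_decay i m k : exists2 K, 0 <= K & forall xi,
  (1 + xi 0 i ^+ 2) ^+ m * cmod (rfourier (iter k (partial i) u) xi) <= K.
Proof.
elim: m k => [|m IH] k.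
  have [C C0 hC] := schwartz_bound su i k.
  have [K K0 hK] := rfourier_bound (pweight_dominated (schwartz_measurable i k) hC).
  by exists K => // xi; rewrite mul1r.
have [K1 K10 h1] := IH k; have [K2 K20 h2] := IH k.+2.
exists (K1 + K2) => [|xi]; first exact: addr_ge0.
rewrite exprSr mulrDr mulr1 mulrDl; apply: lerD; first exact: h1.
apply: le_trans (h2 xi); rewrite !rfourier_schwartz_partial !cmodM.
have -> : cmod (Complex 0 (xi 0 i)) = `|xi 0 i|.
  by rewrite cmodE /= expr0n add0r sqrtr_sqr.
have E : xi 0 i ^+ 2 = `|xi 0 i| * `|xi 0 i| by rewrite -expr2 real_normK ?num_real.
by rewrite [X in _ * X * _ <= _]E !mulrA.
Qed.

Hypothesis n_gt0 : (0 < n)%N.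

(* The n-th power of the product of the coordinatewise bounds is used to
   avoid the mixed derivatives of u. *)
Lemma rfourier_decay :
  exists2 K, 0 <= K & forall xi, cmod (rfourier u xi) <= K * pweight xi.
Proof.
have /choice[K hK] : forall i, exists K, 0 <= K /\ forall xi,
    (1 + xi 0 i ^+ 2) ^+ n * cmod (rfourier u xi) <= K.
  by move=> i; have [K K0 h] := rfourier_coord_decay i n 0; exists K.
exists (1 + \sum_i K i) => [|xi].
  by rewrite addr_ge0// sumr_ge0// => i _; case: (hK i).
rewrite /pweight prodfV ler_pdivlMr; last first.
  by apply: prodr_gt0 => i _; exact: oneDsqr_gt0'.
have P0 : 0 <= \prod_(i < n) (1 + xi 0 i ^+ 2).
  by apply: prodr_ge0 => i _; exact/ltW/oneDsqr_gt0'.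
rewrite -(ler_pXn2r n_gt0) ?nnegrE ?mulr_ge0 ?cmod_ge0//; last first.
  by rewrite addr_ge0// sumr_ge0// => i _; case: (hK i).
rewrite exprMn -prodrXl mulrC -[X in _ * _ ^+ X](card_ord n) -prodr_const -big_split/=.
rewrite -[X in _ <= _ ^+ X](card_ord n) -prodr_const; apply: ler_prod => i _.
rewrite mulr_ge0 ?exprn_ge0 ?cmod_ge0//=; last exact/ltW/oneDsqr_gt0'.
apply: (le_trans ((hK i).2 xi)).
rewrite (bigD1 i)//= addrCA lerDl addr_ge0// sumr_ge0// => j _; by case: (hK j).
Qed.

End fourier_decay.

(** * The Fourier transform of a complex-valued Schwartz function *)

Section schwartz_fourier.
Context {R : realType} {n : nat}.
Variable f : 'rV[R]_n -> R[i].
Hypothesis sf : schwartz f.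

Hypothesis n_gt0 : (0 < n)%N.

Lemma schwartz_component_integrable (u : 'rV[R]_n -> R) : real_schwartz u ->
  lebesgue_rV.-integrable setT (EFin \o u).
Proof.
move=> su; pose i := Ordinal n_gt0.
have [C C0 hC] := schwartz_bound su i 0.
exact: (pweight_dominated (schwartz_measurable su i 0) hC).
Qed.

Lemma schwartz_cintegrable : cintegrable lebesgue_rV f.
Proof.
have [/schwartz_component_integrable i1 /schwartz_component_integrable i2] := sf.
have := cintegrableD (cintegrable_real i1)
  (cintegrableZ (Complex 0 1) (cintegrable_real i2)).
congr cintegrable; apply/funext => x; case: (f x) => a b.
by apply/eqP; rewrite eq_complex /= !(mul0r, mul1r, mulr0, addr0, add0r, subr0) !eqxx.
Qed.

Lemma fourierE xi : fourier f xi =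
  rfourier (fun x => Re (f x)) xi + Complex 0 1 * rfourier (fun x => Im (f x)) xi.
Proof.
have [/schwartz_component_integrable i1 /schwartz_component_integrable i2] := sf.
rewrite -cintZ; last exact: cintegrable_character.
rewrite -cintD; [|exact: cintegrable_character|
  by apply: cintegrableZ; exact: cintegrable_character].
apply: eq_cint => x; rewrite mulrCA -mulrDr; congr (_ * _).
case: (f x) => a b.
by apply/eqP; rewrite eq_complex /= !(mul0r, mul1r, mulr0, addr0, add0r, subr0) !eqxx.
Qed.

Lemma fourier_decay :
  exists2 K, 0 <= K & forall xi, cmod (fourier f xi) <= K * pweight xi.
Proof.
have [K1 K10 h1] := rfourier_decay sf.1 n_gt0.
have [K2 K20 h2] := rfourier_decay sf.2 n_gt0.
exists (K1 + K2) => [|xi]; first exact: addr_ge0.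
rewrite fourierE (le_trans (le_cmodD _ _))// mulrDl lerD// cmodM.
by rewrite cmodE /= expr0n expr1n add0r sqrtr1 mul1r.
Qed.

Lemma cmeas_fourier : cmeas (fourier f).
Proof.
have mf : cmeas f by case: schwartz_cintegrable.
apply: (@cmeas_cint2 _ _ _ _ _ lebesgue_rV
  (fun p : 'rV[R]_n * 'rV[R]_n => cexpi (- rV_dot p.2 p.1) * f p.2)).
apply: cmeasM; last exact: cmeas_comp mf measurable_snd.
apply: cmeas_cexpi; apply: measurableT_comp => //.
exact: measurable_rV_dot.
Qed.

Lemma cintegrable_fourier : cintegrable lebesgue_rV (fourier f).
Proof.
have [K K0 hK] := fourier_decay.
by apply: le_cintegrable cmeas_fourier _ hK;
  exact: integrableZl_EFin (integrable_pweight n).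
Qed.

End schwartz_fourier.

(** * Cosine transforms with a phase shift, and their derivatives *)

Section phase_integrals.
Context {R : realType} {n : nat}.
Implicit Types (x : 'rV[R]_n) (q u : 'rV[R]_n -> R) (i : 'I_n) (c : R).

Lemma is_derive_axis u x (v : 'rV[R]_n) (d : R) :
  is_derive (0 : R) 1 (fun h => u (x + h *: v)) d -> is_derive x v u d.
Proof.
have E : (fun h : R => h^-1 *: (u (x + (h *: 1 + 0) *: v) - u (x + 0 *: v))) =
    (fun h => h^-1 *: (u (h *: v + x) - u x)).
  apply/funext => h; congr (_ *: (u _ - u _)).
    have -> : h *: (1 : R) = h by exact: mulr1.
    by rewrite addr0 addrC.
  by rewrite scale0r addr0.
move=> [du <-]; split.
  by move: du; rewrite /derivable E.
by rewrite /derive E.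
Qed.

(** The values c = 0 and c = pi / 2 give the real part and minus the imaginary part of the inverse
    transform of q. The free shift c makes the family stable under differentiation, which adds pi /
    2 to c and a coordinate factor to q. *)
Definition phase c q x : R := \int[lebesgue_rV]_y (cos (rV_dot x y + c) * q y).

Lemma measurable_phase q x c : measurable_fun setT q ->
  measurable_fun setT (fun y => cos (rV_dot x y + c) * q y).
Proof.
move=> mq; apply: measurable_funM => //.
apply: (measurableT_comp measurable_cos); apply: measurable_funD => //.
by apply: measurable_rV_dot => //; exact: measurable_cst.
Qed.

Lemma integrable_phase c q x : lebesgue_rV.-integrable setT (EFin \o q) ->
  lebesgue_rV.-integrable setT (EFin \o (fun y => cos (rV_dot x y + c) * q y)).
Proof.
move=> iq; apply: (le_integrable _ _ _ iq) => //.
  apply/measurable_EFinP; apply: measurable_phase; apply/measurable_EFinP.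
  by case/integrableP : iq.
move=> y _; rewrite /= lee_fin normrM ler_piMl// ler_norml.
by rewrite cos_geN1 cos_le1.
Qed.

Lemma phase_bound c q x : lebesgue_rV.-integrable setT (EFin \o q) ->
  `|phase c q x| <= \int[lebesgue_rV]_y `|q y|.
Proof.
move=> iq; rewrite (le_trans (le_normr_Rintegral _ (integrable_phase c x iq)))//.
apply: le_Rintegral => //.
- exact: integrable_norm (integrable_phase c x iq).
- exact: integrable_norm iq.
- move=> y _; rewrite normrM ler_piMl// ler_norml.
  by rewrite cos_geN1 cos_le1.
Qed.

(** Differentiation under the integral with the majorant |y_i q(y)|, valid for every increment; the
    interval (-1, 1) is an arbitrary neighbourhood of 0. *)
Lemma is_derive_phase c q x i : lebesgue_rV.-integrable setT (EFin \o q) ->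
  lebesgue_rV.-integrable setT (EFin \o (fun y : 'rV[R]_n => y 0 i * q y)) ->
  is_derive x (delta_mx 0 i) (phase c q) (phase (c + pi / 2) (fun y : 'rV[R]_n => y 0 i * q y) x).
Proof.
move=> iq iyq; apply: is_derive_axis.
pose F (h : R) (y : 'rV[R]_n) := cos (rV_dot (x + h *: delta_mx 0 i) y + c) * q y.
have FE h y : F h y = cos (rV_dot x y + c + h * y 0 i) * q y.
  by rewrite /F rV_dotDl rV_dotZl rV_dot_delta addrAC.
have dF (h : R) (y : 'rV[R]_n) : is_derive h 1 (F ^~ y)
    (- sin (rV_dot x y + c + h * y 0 i) * (y 0 i * q y)).
  have -> : F ^~ y = (fun h => cos (rV_dot x y + c + h * y 0 i) * q y).
    by apply/funext => k; rewrite FE.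
  apply: is_derive_eq; rewrite !scaler0 !add0r.
  by rewrite /GRing.scale /=; ring.
have I0 : (`](-1), 1[%classic : set R) 0 by rewrite /= in_itv/= ltr01 ltrN10.
have iF h : lebesgue_rV.-integrable setT (EFin \o F h) by exact: integrable_phase.
have dF1 h y : derivable (F ^~ y) h 1 by exact: (@ex_derive _ _ _ _ _ _ _ (dF h y)).
have d1E h y : partial1of2 F h y = - sin (rV_dot x y + c + h * y 0 i) * (y 0 i * q y).
  by rewrite partial1of2E; exact: derive_val.
have bF h y : `|partial1of2 F h y| <= `|y 0 i * q y|.
  by rewrite d1E normrM ler_piMl// ler_norml lerNl opprK sin_le1 /= lerNl sin_geN1.
have D := @derivable_under_integral R _ _ lebesgue_rV F setT measurableT 0 (-1) 1 I0
  (fun h _ => iF h) (fun h y _ _ => dF1 h y) (fun y : 'rV[R]_n => `|y 0 i * q y|)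
  (fun y => normr_ge0 _) (integrable_norm iyq) (fun h y _ _ => bF h y).
have V := @differentiation_under_integral R _ _ lebesgue_rV F setT measurableT 0 (-1) 1 I0
  (fun h _ => iF h) (fun h y _ _ => dF1 h y) (fun y : 'rV[R]_n => `|y 0 i * q y|)
  (fun y => normr_ge0 _) (integrable_norm iyq) (fun h y _ _ => bF h y).
split; first exact: D.
move: V; rewrite derive1E => V; apply: (etrans V).
apply: eq_Rintegral => y _; rewrite d1E addrA cosDpihalf mul0r addr0.
by [].
Qed.

End phase_integrals.

(** * Gaussians and functions of Gaussian decay *)

Section gaussian.
Context {R : realType} {n : nat}.
Implicit Types (x : 'rV[R]_n) (i : 'I_n) (s : R) (g : 'rV[R]_n -> R).

Definition gaussian s x : R := expR (- (s * rV_dot x x)).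

Lemma is_derive_gaussian s x i :
  is_derive x (delta_mx 0 i) (gaussian s) (- (2 * s) * (x 0 i * gaussian s x)).
Proof.
apply: is_derive_axis; rewrite /gaussian.
have -> : (fun h : R => expR (- (s * rV_dot (x + h *: delta_mx 0 i) (x + h *: delta_mx 0 i)))) =
    (fun h => expR (- (s * (rV_dot x x + h * (2 * x 0 i) + h * h)))).
  apply/funext => h; congr (expR (- (s * _))).
  rewrite !(rV_dotDl, rV_dotDr, rV_dotZl, rV_dotZr) (rV_dotC x) !rV_dot_delta.
  by rewrite mxE !eqxx /=; ring.
apply: is_derive_eq; rewrite /GRing.scale /= !mul0r !addr0; ring.
Qed.

Lemma rV_dotxx_ge0 x : 0 <= rV_dot x x.
Proof. by apply: sumr_ge0 => i _; rewrite -expr2 sqr_ge0. Qed.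

Lemma rV_dotxx_coord x i : x 0 i ^+ 2 <= rV_dot x x.
Proof.
rewrite /rV_dot (bigD1 i)//= -expr2 lerDl.
by apply: sumr_ge0 => j _; rewrite -expr2 sqr_ge0.
Qed.

Lemma continuous_rV_coord i : continuous (fun x => x 0 i).
Proof. exact: coord_continuous. Qed.

Lemma continuous_rV_dotxx : continuous (fun x => rV_dot x x).
Proof.
rewrite /rV_dot; elim: (index_enum _) => [|i w IH] x.
  by under eq_fun do rewrite big_nil; exact: cst_continuous.
under eq_fun do rewrite big_cons.
by apply: (@continuousD _ _ _ (fun x => x 0 i * x 0 i)); [apply: continuousM; exact: continuous_rV_coord|exact: IH].
Qed.

Lemma continuous_gaussian s : continuous (gaussian s).
Proof.
move=> x; apply: (@continuous_comp _ _ _ (fun x => - (s * rV_dot x x)) expR).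
  apply: continuousN; apply: (@continuousM _ _ (cst s)).
    exact: cst_continuous.
  exact: continuous_rV_dotxx.
exact: continuous_expR.
Qed.

(** Asking for all s' < s instead of s itself makes the class stable under multiplication by
    polynomials; the case s' = 0 gives boundedness. *)
Definition gdominated s g := forall s', 0 <= s' < s ->
  exists C, forall x, `|g x| <= C * gaussian s' x.

(** Half of the gap s - s' is spent on the decay of [g], the other half, [del], on absorbing the
    coordinate: |x_i| <= (1 + 1/del) exp(del |x|^2). *)
Lemma gdominated_coord s g i : gdominated s g -> gdominated s (fun x => x 0 i * g x).
Proof.
move=> hg s' /andP[s'0 s's].
have [|C hC] := hg ((s' + s) / 2); first by apply/andP; split; lra.
pose del := (s - s') / 2.
have d0 : 0 < del by rewrite /del; lra.
have x_le x : `|x 0 i| <= (1 + del^-1) * expR (del * rV_dot x x).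
  have h1 : `|x 0 i| <= 1 + x 0 i ^+ 2.
    rewrite -(real_normK (num_real (x 0 i))); have := sqr_ge0 (`|x 0 i| - 1); nra.
  have h2 : 1 + x 0 i ^+ 2 <= (1 + del^-1) * (1 + del * rV_dot x x).
    have := rV_dotxx_coord x i; have := rV_dotxx_ge0 x => p1 p2.
    rewrite mulrDl mul1r !mulrDr mulr1 mulKf ?gt_eqF//.
    have : 0 <= del * rV_dot x x by rewrite mulr_ge0// ltW.
    have : 0 < del^-1 by rewrite invr_gt0.
    by lra.
  rewrite (le_trans h1)// (le_trans h2)// ler_wpM2l ?expR_ge1Dx//.
  by rewrite addr_ge0// invr_ge0 ltW.
exists ((1 + del^-1) * `|C|) => x.
have -> : gaussian s' x = expR (del * rV_dot x x) * gaussian ((s' + s) / 2) x.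
  by rewrite /gaussian -expRD; congr expR; rewrite /del; field.
rewrite normrM mulrACA; apply: ler_pM => //.
by rewrite (le_trans (hC x))// ler_wpM2r ?expR_ge0// ler_norm.
Qed.

Lemma gdominated_gaussian s : gdominated s (gaussian s).
Proof.
move=> s' /andP[_ s's]; exists 1 => x.
rewrite mul1r ger0_norm ?expR_ge0// ler_expR lerN2 ler_wpM2r ?rV_dotxx_ge0//.
exact: ltW.
Qed.

Lemma gdominated_mpower s g (alpha : 'I_n -> nat) : gdominated s g ->
  gdominated s (fun x => mpower alpha x * g x).
Proof.
move=> hg; rewrite /mpower; elim: (index_enum _) => [|i w IH].
  by under eq_fun do rewrite big_nil mul1r.
under eq_fun do rewrite big_cons -mulrA.
pose G k x := x 0 i ^+ k * (\prod_(j <- w) x 0 j ^+ alpha j * g x).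
have G0 : G 0%N = fun x => \prod_(j <- w) x 0 j ^+ alpha j * g x.
  by apply/funext => x; rewrite /G expr0 mul1r.
have GS k : G k.+1 = fun x => x 0 i * G k x.
  by apply/funext => x; rewrite /G exprS -mulrA.
suff H k : gdominated s (G k) by exact: H.
elim: k => [|k IHk]; first by rewrite G0; exact: IH.
by rewrite GS; exact: gdominated_coord.
Qed.

Lemma gdominated_rapid s g : 0 < s -> gdominated s g -> rapid g.
Proof.
move=> s0 hg alpha.
have [|C hC] := gdominated_mpower alpha hg (s' := 0); first by rewrite lexx.
by exists C => x; have := hC x; rewrite /gaussian mul0r oppr0 expR0 mulr1.
Qed.

End gaussian.

(** * The Fourier transform of a Gaussian *)

Section gaussian_fourier.
Context {R : realType}.

Lemma measurable_gaussian n (s : R) : measurable_fun setT (@gaussian R n s).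
Proof. by apply: continuous_measurable_rV; exact: continuous_gaussian. Qed.

Lemma partial_gaussian n (s : R) (i : 'I_n) :
  partial i (gaussian s) = fun x => - (2 * s) * (x 0 i * gaussian s x).
Proof.
apply/funext => x; rewrite /partial.
by have [_ ->] := is_derive_gaussian s x i.
Qed.

Lemma gaussian_bound n (s : R) : 0 < s ->
  exists2 C, 0 <= C & forall x : 'rV[R]_n, `|gaussian s x| <= C * pweight x.
Proof.
move=> s0; apply: rapid_pweight; apply: (gdominated_rapid s0).
exact: gdominated_gaussian.
Qed.

Lemma coord_gaussian_bound n (s : R) (i : 'I_n) : 0 < s ->
  exists2 C, 0 <= C & forall x : 'rV[R]_n, `|x 0 i * gaussian s x| <= C * pweight x.
Proof.
move=> s0; apply: rapid_pweight; apply: (gdominated_rapid s0).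
exact/gdominated_coord/gdominated_gaussian.
Qed.

Lemma measurable_coord_fun n (i : 'I_n) : measurable_fun setT (fun x : 'rV[R]_n => x 0 i).
Proof. exact: (@measurable_rV_coord R n i). Qed.

Lemma integrable_gaussian n (s : R) : 0 < s ->
  lebesgue_rV.-integrable setT (EFin \o @gaussian R n s).
Proof.
move=> /(gaussian_bound n)[C _ hC].
by apply: pweight_dominated hC; exact: measurable_gaussian.
Qed.

Lemma integrable_coord_gaussian n (s : R) (i : 'I_n) : 0 < s ->
  lebesgue_rV.-integrable setT (EFin \o (fun x : 'rV[R]_n => x 0 i * gaussian s x)).
Proof.
move=> /(coord_gaussian_bound i)[C _ hC].
apply: pweight_dominated hC; apply: measurable_funM; last exact: measurable_gaussian.
exact: measurable_coord_fun.
Qed.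

Lemma phaseE n (b : R) (v : 'rV[R]_n -> R) xi :
  lebesgue_rV.-integrable setT (EFin \o v) ->
  phase b v xi = Re (cexpi (- b) * rfourier v xi).
Proof.
move=> iv; rewrite -cintZ; last exact: cintegrable_character.
apply: eq_Rintegral => y _; rewrite mulrA -cexpiD -opprD ReM /= mulr0 subr0 cosN.
by rewrite [b + _]addrC rV_dotC.
Qed.

(** Up to the factor -2 s, y_i times the Gaussian is its derivative, which the transform turns into
    i xi_i; the extra quarter turn of the phase cancels that i. Together with [is_derive_phase] this
    is a linear differential equation in xi_i. *)
Lemma phase_gaussian_ode n (s c : R) (xi : 'rV[R]_n) i : 0 < s ->
  phase (c + pi / 2) (fun y : 'rV[R]_n => y 0 i * gaussian s y) xi =
  - (xi 0 i / (2 * s)) * phase c (gaussian s) xi.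
Proof.
move=> s0; have ig := integrable_gaussian n s0.
have iyg := integrable_coord_gaussian i s0.
have [C C0 hC] := gaussian_bound n s0.
have [D D0 hD] := coord_gaussian_bound i s0.
have s20 : 0 <= 2 * s by rewrite mulr_ge0// ltW.
have W0 (x : 'rV[R]_n) : 0 <= pweight x by exact/ltW/pweight_gt0.
have E : rfourier (partial i (gaussian s)) xi =
    Complex 0 (xi 0 i) * rfourier (gaussian s) xi.
  apply: (@rfourier_partial _ _ _ _ (C + 2 * s * D)).
  - by rewrite addr_ge0// mulr_ge0// mulr_ge0// ltW.
  - exact: measurable_gaussian.
  - rewrite partial_gaussian; apply: measurable_funM => //.
    by apply: measurable_funM; [exact: measurable_coord_fun|exact: measurable_gaussian].
  - by move=> x; have [] := is_derive_gaussian s x i.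
  - by move=> x; rewrite (le_trans (hC x))// ler_wpM2r// lerDl mulr_ge0// mulr_ge0// ltW.
  - move=> x; rewrite partial_gaussian normrM normrN (ger0_norm s20).
    apply: (@le_trans _ _ (2 * s * (D * pweight x))); first by rewrite ler_wpM2l.
    by rewrite mulrA ler_wpM2r// lerDr.
have -> : phase (c + pi / 2) (fun y : 'rV[R]_n => y 0 i * gaussian s y) xi =
    - (2 * s)^-1 * phase (c + pi / 2) (partial i (gaussian s)) xi.
  rewrite partial_gaussian -RintegralZl//.
    by apply: eq_Rintegral => y _; field; rewrite gt_eqF.
  by apply: integrable_phase; exact: integrableZl_EFin.
rewrite (phaseE _ _ ig) phaseE; last first.
  by rewrite partial_gaussian; exact: integrableZl_EFin.
rewrite E opprD cexpiD; case: (rfourier _ _) => a b /=.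
rewrite !(cosN, sinN) cos_pihalf sin_pihalf.
by field; rewrite gt_eqF.
Qed.

Lemma phase_gaussian1 (s c : R) (xi : 'rV[R]_1) : 0 < s ->
  phase c (gaussian s) xi =
  expR (- (xi 0 0 ^+ 2 / (4 * s))) * (cos c * \int[lebesgue_rV]_x gaussian s (x : 'rV[R]_1)).
Proof.
move=> s0; have ig := integrable_gaussian 1 s0.
(* As [k] is negative, [gaussian k] is the growing factor exp(x^2 / (4 s)) that solves the
   differential equation: [K] has derivative 0. *)
pose k := - (4 * s)^-1; pose K (x : 'rV[R]_1) := phase c (gaussian s) x * gaussian k x.
pose e : 'rV[R]_1 := delta_mx 0 0.
have dK (x : 'rV[R]_1) : is_derive x e K 0.
  have d1 : is_derive x e (phase c (gaussian s)) _ :=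
    is_derive_phase c x ig (integrable_coord_gaussian 0 s0).
  have d2 := is_derive_gaussian k x 0.
  have [dM1 dM2] := is_deriveM d1 d2; split; first exact: dM1.
  apply: (etrans dM2); rewrite phase_gaussian_ode// /GRing.scale /=.
  by rewrite /k; field; rewrite gt_eqF.
have Kc (x : 'rV[R]_1) (t : R) : 0 <= t -> K (x + t *: e) = K x.
  move=> t0; have [|r _] := @line_MVT R 1 K x e t t0.
    by move=> r _; have [] := dK (x + r *: e).
  have [_ ->] := dK (x + r *: e).
  by rewrite mulr0 => /eqP; rewrite subr_eq0 => /eqP.
have xiE : xi = 0 + xi 0 0 *: e.
  by apply/rowP => j; rewrite !mxE (ord1 j) !eqxx /= mulr1 add0r.
have K0 : K xi = K 0.
  (* [Kc] only moves forward, so a negative coordinate is treated by going from xi up to 0. *)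
  have [x0|x0] := leP 0 (xi 0 0); first by rewrite xiE Kc.
  rewrite -(Kc xi (- xi 0 0)) ?oppr_ge0 1?ltW//; congr K.
  by rewrite {1}xiE add0r -scalerDl subrr scale0r.
have -> : phase c (gaussian s) xi = K xi * gaussian (- k) xi.
  by rewrite /K -mulrA -expRD -opprD -mulrDl subrr mul0r oppr0 expR0 mulr1.
rewrite K0 /K mulrC /gaussian; congr (_ * _).
  by rewrite /rV_dot big_ord1 /k opprK -expr2 mulrC.
rewrite /rV_dot big_ord1 !mxE !mulr0 oppr0 expR0 mulr1.
rewrite -RintegralZl//; apply: eq_Rintegral => y _.
by rewrite /rV_dot big_ord1 !mxE mul0r add0r.
Qed.

Lemma rfourier_gaussian1 (s : R) (xi : 'rV[R]_1) : 0 < s ->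
  rfourier (gaussian s) xi =
  (expR (- (xi 0 0 ^+ 2 / (4 * s))) * \int[lebesgue_rV]_x gaussian s (x : 'rV[R]_1))%:C%C.
Proof.
move=> s0; have ig := integrable_gaussian 1 s0.
have h0 := phase_gaussian1 0 xi s0; have h1 := phase_gaussian1 (pi / 2) xi s0.
move: h0 h1; rewrite !phaseE//.
set F := rfourier _ _; set I1 := Rintegral _ _ _; case: F => u v.
rewrite oppr0 cexpi0 mul1r cos0 mul1r cos_pihalf mul0r mulr0 => /= ->.
by rewrite cosN sinN cos_pihalf sin_pihalf mul0r sub0r mulN1r opprK => ->.
Qed.

(** The Gaussian is parametrized so that its transform is a multiple of the normal density of
    deviation sigma. Of the multiple only the sign matters: it will be divided out. *)
Lemma gaussian_fourier1 (sigma : R) : 0 < sigma -> exists2 c, 0 < c & forall zeta : R,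
  cintegrable (@lebesgue_measure R)
    (fun x : R => cexpi (- (x * zeta)) * (expR (- (sigma ^+ 2 / 2 * x ^+ 2)))%:C%C) /\
  cint (@lebesgue_measure R)
    (fun x : R => cexpi (- (x * zeta)) * (expR (- (sigma ^+ 2 / 2 * x ^+ 2)))%:C%C) =
  (c * normal_pdf 0 sigma zeta)%:C%C.
Proof.
move=> sg0; pose s := sigma ^+ 2 / 2.
have s0 : 0 < s by rewrite divr_gt0// exprn_gt0.
have i1 : (@lebesgue_measure R).-integrable setT (EFin \o (fun x : R => expR (- (s * x ^+ 2)))).
  have sV : sigma^-1 != 0 by rewrite invr_eq0 gt_eqF.
  have := integrableZl_EFin (normal_peak sigma^-1)^-1 (@integrable_normal_pdf R 0 sigma^-1).
  congr (_.-integrable _ (_ \o _)); apply/funext => x.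
  rewrite normal_pdfE// mulKf ?gt_eqF ?normal_peak_gt0//.
  rewrite /normal_fun subr0; congr expR; rewrite /s; field.
  by rewrite gt_eqF.
have iF (zeta : R) : cintegrable (@lebesgue_measure R)
    (fun x : R => cexpi (- (x * zeta)) * (expR (- (s * x ^+ 2)))%:C%C).
  apply: (@cintegrableMl _ _ _ _ _ _ 1).
  - by apply: cmeas_cexpi; apply: measurableT_comp => //; exact: measurable_funM.
  - by move=> x; rewrite cmod_cexpi.
  - exact: cintegrable_real.
(* Up to its peak value, this Gaussian is the normal density of deviation 1/sigma, of total mass
   1. *)
have iS : 0 < \int[lebesgue_rV]_x gaussian s (x : 'rV[R]_1).
  have [_] := @integrable_prod R 1 (fun _ x => expR (- (s * x ^+ 2))) (fun=> i1).
  rewrite big_ord1.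
  under eq_Rintegral do rewrite big_ord1.
  under [X in _ < X]eq_Rintegral do rewrite /gaussian /rV_dot big_ord1 -expr2.
  move=> ->.
  have sV : sigma^-1 != 0 by rewrite invr_eq0 gt_eqF.
  have pk : 0 < normal_peak sigma^-1 by exact: normal_peak_gt0.
  have := @integral_normal_pdf R 0 sigma^-1.
  have -> : (fun x => (normal_pdf 0 sigma^-1 x)%:E) =
      (fun x => (normal_peak sigma^-1 * expR (- (s * x ^+ 2)))%:E).
    apply/funext => x; rewrite normal_pdfE//; congr (_ * _)%:E.
    rewrite /normal_fun subr0; congr expR; rewrite /s; field.
    by rewrite gt_eqF.
  move=> /(congr1 fine) /=; rewrite -/(Rintegral _ _ _) RintegralZl// => h.
  by rewrite -(pmulr_rgt0 _ pk) h.
exists ((\int[lebesgue_rV]_x gaussian s (x : 'rV[R]_1)) / normal_peak sigma).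
  by rewrite divr_gt0// normal_peak_gt0// gt_eqF.
move=> zeta; split; first exact: iF.
have [_] := cintegrable_cint_prod (fun _ : 'I_1 => iF zeta).
rewrite big_ord1 => <-.
have -> : cint lebesgue_rV (fun x : 'rV[R]_1 => \prod_(i < 1)
    (cexpi (- (x 0 i * zeta)) * (expR (- (s * x 0 i ^+ 2)))%:C%C)) =
    rfourier (gaussian s) (const_mx zeta : 'rV[R]_1).
  by apply: eq_cint => x; rewrite big_ord1 /gaussian /rV_dot !big_ord1 mxE -expr2.
rewrite rfourier_gaussian1// mxE normal_pdfE ?gt_eqF//; congr (_%:C%C).
have -> : normal_fun 0 sigma zeta = expR (- (zeta ^+ 2 / (4 * s))).
  by rewrite /normal_fun subr0; congr expR; rewrite /s; field; rewrite gt_eqF.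
have pk : normal_peak sigma != 0 by rewrite gt_eqF// normal_peak_gt0// gt_eqF.
by move: (Rintegral _ _ _) => I1; field.
Qed.

Definition npdf n (sigma : R) (z : 'rV[R]_n) : R := \prod_(i < n) normal_pdf 0 sigma (z 0 i).

Lemma cexpi_sum I (s : seq I) (F : I -> R) :
  cexpi (\sum_(i <- s) F i) = \prod_(i <- s) cexpi (F i).
Proof.
elim: s => [|i s IH]; first by rewrite !big_nil cexpi0.
by rewrite !big_cons cexpiD IH.
Qed.

Lemma rfourier_gaussian n (sigma : R) : 0 < sigma -> exists2 c, 0 < c &
  forall zeta : 'rV[R]_n,
  rfourier (gaussian (sigma ^+ 2 / 2)) zeta = (c * npdf sigma zeta)%:C%C.
Proof.
move=> /gaussian_fourier1[c c0 h]; exists (c ^+ n); first by rewrite exprn_gt0.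
move=> zeta; have [_ cP] := cintegrable_cint_prod (fun i : 'I_n => (h (zeta 0 i)).1).
have -> : c ^+ n = \prod_(i < n) c by rewrite prodr_const card_ord.
rewrite -big_split/= rmorph_prod /=.
rewrite -(eq_bigr _ (fun i _ => (h (zeta 0 i)).2)) -cP.
apply: eq_cint => x; rewrite big_split/= -cexpi_sum -rmorph_prod -expR_sum.
congr (cexpi _ * (expR _)%:C%C).
  by rewrite /rV_dot -sumrN.
by rewrite /rV_dot mulr_sumr -sumrN; apply: eq_bigr => i _; rewrite expr2.
Qed.

Lemma npdf_ge0 n (sigma : R) (z : 'rV[R]_n) : 0 <= npdf sigma z.
Proof. by apply: prodr_ge0 => i _; exact: normal_pdf_ge0. Qed.

Lemma integrable_npdf n (sigma : R) :
  lebesgue_rV.-integrable setT (EFin \o @npdf n sigma) /\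
  \int[lebesgue_rV]_z npdf sigma (z : 'rV[R]_n) = 1.
Proof.
have [i1 i2] := integrable_prod (fun i : 'I_n => @integrable_normal_pdf R 0 sigma).
split; first exact: i1.
rewrite [LHS]i2 big1// => i _.
by rewrite /Rintegral integral_normal_pdf.
Qed.

End gaussian_fourier.

(** * Functions with bounded support and all moments *)

Section bounded_support.
Context {R : realType} {n : nat}.
Implicit Types (q u : 'rV[R]_n -> R) (h : 'rV[R]_n -> R[i]) (r M : R).

Lemma lebesgue_box r : (lebesgue_rV (@box R n r) < +oo)%E.
Proof.
suff : lebesgue_rV (@box R n r) \is a fin_num by rewrite fin_numE ltey => /andP[].
rewrite boxE (@lebesgue_rV_box _ _ (fun=> `[- r, r]%classic)); last first.
  by move=> i; exact: measurable_itv.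
elim/big_ind: _ => [//|x y xf yf|i _]; first exact: fin_numM.
by rewrite lebesgue_measure_itv/=; case: ifP.
Qed.

Lemma integrable_box r : lebesgue_rV.-integrable setT (EFin \o (\1_(@box R n r) : _ -> R)).
Proof.
apply/integrableP; split.
  by apply/measurable_EFinP; apply: measurable_indic; exact: measurable_box.
under eq_integral do rewrite /= ger0_norm//.
by rewrite integral_indic ?setIT ?lebesgue_box//; exact: measurable_box.
Qed.

Lemma integrable_bounded_support u r M : measurable_fun setT u ->
  (forall x, `|u x| <= M) -> (forall x, ~ box r x -> u x = 0) ->
  lebesgue_rV.-integrable setT (EFin \o u).
Proof.
move=> mu uM u0; apply: (le_integrable _ _ _ (integrableZl_EFin M (integrable_box r))) => //.
  exact/measurable_EFinP.
move=> x _; rewrite /= lee_fin indicE.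
have [/set_mem xr|xr] := boolP (x \in box r).
  by rewrite mulr1 (le_trans (uM x))// ler_norm.
by rewrite u0 ?normr0// => /mem_set; rewrite (negbTE xr).
Qed.

(** Monomials are indexed by words of coordinates, so that multiplying by one more coordinate, as
    each derivative of a phase integral does, is adding a letter. *)
Definition all_moments q := forall w : seq 'I_n,
  lebesgue_rV.-integrable setT (EFin \o (fun y : 'rV[R]_n => \prod_(j <- w) y 0 j * q y)).

Lemma all_moments_integrable q : all_moments q ->
  lebesgue_rV.-integrable setT (EFin \o q).
Proof. by move=> /(_ [::]); under eq_fun do rewrite big_nil mul1r. Qed.

Lemma all_moments_coord q i : all_moments q ->
  all_moments (fun y : 'rV[R]_n => y 0 i * q y).
Proof.
move=> mq w; have := mq (i :: w); congr (_.-integrable _ (_ \o _)).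
by apply/funext => y; rewrite big_cons mulrCA mulrA.
Qed.

Lemma all_moments_bounded_support q r M : measurable_fun setT q ->
  (forall x, `|q x| <= M) -> (forall x, ~ box r x -> q x = 0) -> all_moments q.
Proof.
move=> mq qM q0 w; apply: (@integrable_bounded_support _ r (`|r| ^+ size w * M)).
- apply: measurable_funM => //; elim: w => [|i w IH].
    by under eq_fun do rewrite big_nil; exact: measurable_cst.
  under eq_fun do rewrite big_cons.
  by apply: measurable_funM => //; exact: measurable_coord_fun.
- move=> x; have [xr|xr] := pselect (box r x); last first.
    by rewrite q0// mulr0 normr0 mulr_ge0// (le_trans _ (qM x)).
  rewrite normrM; apply: ler_pM => //.
  elim: w => [|i w IH]; first by rewrite big_nil normr1.
  rewrite big_cons normrM exprS; apply: ler_pM => //.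
  by rewrite (le_trans (xr i))// ler_norm.
- by move=> x xr; rewrite q0// mulr0.
Qed.

Lemma cos_lipschitz (x y : R) : `|cos x - cos y| <= `|x - y|.
Proof.
wlog xy : x y / x <= y => [H|].
  have [/H//|/ltW/H] := leP x y.
  by rewrite distrC [X in _ <= X]distrC.
have [|t _ E] := @MVT_segment R cos (fun t => - sin t) x y xy.
  by apply: continuous_subspaceT; exact: continuous_cos.
rewrite distrC E normrM [X in _ <= X]distrC ler_piMl// normrN.
by rewrite ler_norml sin_geN1 sin_le1.
Qed.

(** The cosine is 1-Lipschitz, so in the sup norm the phase integral is Lipschitz with constant [K],
    the sum of the first moments of |q|. *)
Lemma continuous_phase c q : all_moments q -> continuous (phase c q).
Proof.
move=> mq x; have iq := all_moments_integrable mq.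
have iyq i := all_moments_integrable (all_moments_coord i mq).
pose K := \sum_(i < n) \int[lebesgue_rV]_y `|(y : 'rV[R]_n) 0 i * q y|.
have K0 : 0 <= K by apply: sumr_ge0 => i _; apply: Rintegral_ge0.
apply/(@cvgrPdist_lt _ _ _ (nbhs x) (nbhs_filter x)) => e e0; apply/rV_nearP.
(* Using 1 + K covers the case K = 0 and leaves room for a strict inequality. *)
have d0 : 0 < e / (1 + K) by rewrite divr_gt0// ltr_pwDl.
exists (e / (1 + K)) => // y xy.
rewrite -RintegralB//; [|exact: integrable_phase|exact: integrable_phase].
have id := integrableD_EFin (integrable_phase c x iq)
  (integrableZl_EFin (-1) (integrable_phase c y iq)).
have id' : lebesgue_rV.-integrable setT
    (EFin \o (fun z => cos (rV_dot x z + c) * q z - cos (rV_dot y z + c) * q z)).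
  by move: id; congr (_.-integrable _ (_ \o _)); apply/funext => z; rewrite mulN1r.
apply: (le_lt_trans (le_normr_Rintegral _ id')) => //.
apply: (@le_lt_trans _ _ (e / (1 + K) * K)); last first.
  by rewrite mulrAC ltr_pdivrMr ?ltr_pM2l// ?ltr_pwDl// ltrDr.
rewrite /K mulr_sumr.
have is_ : lebesgue_rV.-integrable setT
    (EFin \o (fun z : 'rV[R]_n => \sum_(i < n) e / (1 + K) * `|z 0 i * q z|)).
  have := @integrable_sum _ _ _ lebesgue_rV setT measurableT _ (index_enum 'I_n) xpredT
    (fun i (z : 'rV[R]_n) => (e / (1 + K) * `|z 0 i * q z|)%:E).
  move=> h; have /= := h (fun i _ => integrableZl_EFin _ (integrable_norm (iyq i))).
  by congr (_.-integrable _ _); apply/funext => z; rewrite sumEFin.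
apply: (@le_trans _ _ (\int[lebesgue_rV]_z
    (\sum_(i < n) e / (1 + K) * `|(z : 'rV[R]_n) 0 i * q z|))).
  apply: le_Rintegral => //; first exact: integrable_norm id'.
  move=> z _; rewrite -mulrBl normrM.
  apply: (@le_trans _ _ (`|\sum_(i < n) (x 0 i - y 0 i) * z 0 i| * `|q z|)).
    rewrite ler_wpM2r// (le_trans (cos_lipschitz _ _))//.
    rewrite opprD addrACA subrr addr0 /rV_dot -sumrB.
    by under eq_bigr do rewrite -mulrBl.
  rewrite -normrM mulr_suml (le_trans (ler_norm_sum _ _ _))//; apply: ler_sum => i _.
  by rewrite -(mulrA (x 0 i - y 0 i)) normrM ler_wpM2r// ltW// xy.
rewrite le_eqVlt; apply/orP; left; apply/eqP.
rewrite /Rintegral; under eq_integral do rewrite -sumEFin.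
rewrite integral_sum//; last first.
  by move=> i; exact: integrableZl_EFin (integrable_norm (iyq i)).
rewrite -sum_fine//; last first.
  move=> i _; apply: integrable_fin_num => //.
  exact: integrableZl_EFin (integrable_norm (iyq i)).
apply: eq_bigr => i _; rewrite -[RHS]RintegralZl//.
exact: integrable_norm (iyq i).
Qed.

End bounded_support.

(** * A class of Schwartz functions closed under differentiation *)

Section gaussian_class.
Context {R : realType} {n : nat}.
Variable s : R.
Hypothesis s_gt0 : 0 < s.

(** Gaussians times phase integrals, closed under the operations that the product rule generates.
    Since derivatives stay in the class, no formula for iterated derivatives is needed to obtain the
    Schwartz bounds. *)
Inductive gclass : ('rV[R]_n -> R) -> Prop :=
| gclass_phase c q : all_moments q -> gclass (fun x => gaussian s x * phase c q x)
| gclassD g1 g2 : gclass g1 -> gclass g2 -> gclass (fun x => g1 x + g2 x)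
| gclassM i g : gclass g -> gclass (fun x => x 0 i * g x)
| gclassZ k g : gclass g -> gclass (fun x => k * g x).

Lemma gclass_continuous g : gclass g -> continuous g.
Proof.
elim=> {g} [c q mq|g1 g2 _ c1 _ c2|i g _ cg|k g _ cg] x.
- by apply: (@continuousM _ _ (gaussian s) (phase c q));
    [exact: continuous_gaussian|exact: continuous_phase].
- by apply: (@continuousD _ _ _ g1 g2); [exact: c1|exact: c2].
- by apply: (@continuousM _ _ (fun y : 'rV[R]_n => y 0 i) g); [exact: continuous_rV_coord|exact: cg].
- by apply: (@continuousM _ _ (cst k) g); [exact: cst_continuous|exact: cg].
Qed.

Lemma gclass_derive g (i : 'I_n) : gclass g ->
  exists2 g', gclass g' & forall x, is_derive x (delta_mx 0 i) g (g' x).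
Proof.
elim=> {g} [c q mq|g1 g2 h1 [g1' k1 d1] h2 [g2' k2 d2]|j g hg [g' kg dg]|k g hg [g' kg dg]].
- exists (fun x : 'rV[R]_n => - (2 * s) * (x 0 i * (gaussian s x * phase c q x)) +
      gaussian s x * phase (c + pi / 2) (fun y : 'rV[R]_n => y 0 i * q y) x).
    apply: gclassD; first by apply: gclassZ; apply: gclassM; exact: gclass_phase.
    by apply: gclass_phase; exact: all_moments_coord.
  move=> x; have d1 := is_derive_gaussian s x i.
  have d2 := is_derive_phase c x (all_moments_integrable mq)
    (all_moments_integrable (all_moments_coord i mq)).
  have [dM1 dM2] := is_deriveM d1 d2; split; first exact: dM1.
  by apply: (etrans dM2); rewrite /GRing.scale /=; ring.
- exists (fun x => g1' x + g2' x); first exact: gclassD.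
  by move=> x; exact: is_deriveD (d1 x) (d2 x).
- exists (fun x : 'rV[R]_n => (i == j)%:R * g x + x 0 j * g' x).
    by apply: gclassD; [exact: gclassZ|exact: gclassM].
  move=> x; have d1 : is_derive x (delta_mx 0 i) (fun x : 'rV[R]_n => x 0 j) (i == j)%:R.
    apply: is_derive_axis.
    have -> : (fun h : R => (x + h *: delta_mx 0 i) 0 j) = (fun h => x 0 j + h * (i == j)%:R).
      by apply/funext => h; rewrite !mxE eqxx /= eq_sym.
    by apply: is_derive_eq; rewrite /GRing.scale /=; ring.
  have [dM1 dM2] := is_deriveM d1 (dg x); split; first exact: dM1.
  by apply: (etrans dM2); rewrite /GRing.scale /=; ring.
- exists (fun x => k * g' x); first exact: gclassZ.
  by move=> x; exact: (is_deriveZ k (dg x)).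
Qed.

Lemma gclass_gdominated g : gclass g -> gdominated s g.
Proof.
elim=> {g} [c q mq|g1 g2 _ h1 _ h2|i g _ hg|k g _ hg].
- move=> s' hs'; have [C hC] := @gdominated_gaussian R n s s' hs'.
  have iq := all_moments_integrable mq.
  exists (C * \int[lebesgue_rV]_y `|q y|) => x.
  rewrite normrM mulrAC; apply: ler_pM => //; exact: phase_bound.
- move=> s' hs'; have [C hC] := h1 _ hs'; have [D hD] := h2 _ hs'.
  by exists (C + D) => x; rewrite mulrDl (le_trans (ler_normD _ _))// lerD.
- exact: gdominated_coord.
- move=> s' hs'; have [C hC] := hg _ hs'; exists (`|k| * C) => x.
  by rewrite normrM -mulrA ler_wpM2l.
Qed.

Lemma gclass_partials g w : gclass g -> gclass (partials w g).
Proof.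
move=> hg; elim: w => //= i w /(gclass_derive i)[g' hg' dg].
suff -> : partial i (partials w g) = g' by [].
by apply/funext => x; have [_ <-] := dg x.
Qed.

Lemma gclass_schwartz g : gclass g -> real_schwartz g.
Proof.
move=> hg; split.
  move=> w x _; split.
    by apply: gclass_continuous; exact: gclass_partials.
  move=> i; have [g' _ dg] := gclass_derive i (gclass_partials w hg).
  by have [] := dg x.
move=> alpha beta; apply: (gdominated_rapid s_gt0).
by apply: gclass_gdominated; exact: gclass_partials.
Qed.

End gaussian_class.

(** * The evolution of a datum given on the Fourier side, and its maximal function *)

Section evolution.
Context {R : realType} {n : nat}.
Implicit Types (phi : 'rV[R]_n -> R) (h g : 'rV[R]_n -> R[i]) (x : 'rV[R]_n) (t : R).

Definition evolution phi t h x : R[i] :=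
  cint lebesgue_rV (fun xi => cexpi (rV_dot x xi + t * phi xi) * h xi).

(* The square of the maximal function of the datum with Fourier transform h. *)
Definition msq phi h x : \bar R :=
  ereal_sup [set ((cmod (evolution phi t h x)) ^+ 2)%:E | t in [set t : R | 0 < t < 1]].

Definition L2sq h : \bar R := (\int[lebesgue_rV]_xi ((cmod (h xi)) ^+ 2)%:E)%E.

Lemma L2sq_ge0 h : (0 <= L2sq h)%E.
Proof. by apply: integral_ge0 => x _; rewrite lee_fin sqr_ge0. Qed.

Lemma msq_ge phi h x t : 0 < t < 1 ->
  (((cmod (evolution phi t h x)) ^+ 2)%:E <= msq phi h x)%E.
Proof. by move=> t01; apply: ereal_sup_ubound; exists t. Qed.

Lemma msq_le phi h x (c : \bar R) :
  (forall t, 0 < t < 1 -> (((cmod (evolution phi t h x)) ^+ 2)%:E <= c)%E) ->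
  (msq phi h x <= c)%E.
Proof. by move=> H; apply: ge_ereal_sup => _ [t t01 <-]; exact: H. Qed.

Lemma msq_ge0 phi h x : (0 <= msq phi h x)%E.
Proof.
apply: le_trans (@msq_ge phi h x (1 / 2) _); first by rewrite lee_fin sqr_ge0.
by apply/andP; split; lra.
Qed.

(** The admissible data on the Fourier side: unlike transforms of Schwartz functions, they are
    stable under sharp cut-offs. *)
Definition bounded_supp (r : R) h := [/\ cmeas h,
  exists M, forall x, cmod (h x) <= M & forall x, ~ box r x -> h x = 0].

Lemma bounded_supp_cintegrable r h : bounded_supp r h -> cintegrable lebesgue_rV h.
Proof.
move=> [mh [M hM] h0].
have i1 : lebesgue_rV.-integrable setT (EFin \o (fun x => cmod (h x))).
  apply: (@integrable_bounded_support _ _ _ r M).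
  - exact: measurable_cmod.
  - by move=> x; rewrite ger0_norm ?cmod_ge0.
  - by move=> x xr; rewrite h0// cmod0.
by apply: le_cintegrable mh i1 _ => x.
Qed.

Lemma bounded_supp_sqr r h : bounded_supp r h ->
  lebesgue_rV.-integrable setT (EFin \o (fun x => cmod (h x) ^+ 2)).
Proof.
move=> [mh [M hM] h0].
apply: (@integrable_bounded_support _ _ _ r (M ^+ 2)).
- by apply: measurable_funX; exact: measurable_cmod.
- move=> x; rewrite ger0_norm ?sqr_ge0//.
  by rewrite ler_pXn2r// nnegrE ?cmod_ge0// (le_trans _ (hM x))// cmod_ge0.
- by move=> x xr; rewrite h0// cmod0 expr0n.
Qed.

Lemma cmeas_evolution_kernel phi t x : measurable_fun setT phi ->
  cmeas (fun xi => cexpi (rV_dot x xi + t * phi xi)).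
Proof.
move=> mphi; apply: cmeas_cexpi; apply: measurable_funD.
  by apply: measurable_rV_dot => //; exact: measurable_cst.
exact: measurable_funM.
Qed.

Lemma cintegrable_evolution phi t h x : measurable_fun setT phi ->
  cintegrable lebesgue_rV h ->
  cintegrable lebesgue_rV (fun xi => cexpi (rV_dot x xi + t * phi xi) * h xi).
Proof.
move=> mphi ih; apply: (@cintegrableMl _ _ _ _ _ _ 1) => //.
  exact: cmeas_evolution_kernel.
by move=> y; rewrite cmod_cexpi.
Qed.

Lemma cmeas_evolution phi t h : measurable_fun setT phi -> cmeas h ->
  cmeas (evolution phi t h).
Proof.
move=> mphi mh; apply: (@cmeas_cint2 _ _ _ _ _ lebesgue_rV
  (fun p : 'rV[R]_n * 'rV[R]_n => cexpi (rV_dot p.1 p.2 + t * phi p.2) * h p.2)).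
apply: cmeasM; last exact: cmeas_comp mh measurable_snd.
apply: cmeas_cexpi; apply: measurable_funD; first exact: measurable_rV_dot.
by apply: measurable_funM => //; exact: measurableT_comp.
Qed.

Lemma cvg_cexpi (u : nat -> R) (l : R) : u @ \oo --> l ->
  cmod (cexpi (u k) - cexpi l) @[k --> \oo] --> (0 : R).
Proof.
move=> ul.
have h : `|cos (u k) - cos l| + `|sin (u k) - sin l| @[k --> \oo] --> (0 : R).
  rewrite -[X in _ --> X]addr0; apply: cvgD; apply/norm_cvg0P/subr_cvg0.
    exact: (cvg_comp _ _ ul (@continuous_cos R l)).
  exact: (cvg_comp _ _ ul (@continuous_sin R l)).
apply: (squeeze_cvgr _ (cvg_cst 0) h); apply: nearW => k.
by rewrite cmod_ge0 /= cmod_le_ReIm.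
Qed.

Lemma cvg_cmod_scale (z : nat -> R[i]) (w v : R[i]) :
  cmod (z k - w) @[k --> \oo] --> (0 : R) ->
  cmod (z k * v - w * v) @[k --> \oo] --> (0 : R).
Proof.
move=> h; have : cmod (z k - w) * cmod v @[k --> \oo] --> (0 : R).
  by rewrite -[X in _ --> X](mul0r (cmod v)); apply: cvgM => //; exact: cvg_cst.
apply: cvg_trans; apply: near_eq_cvg; apply: nearW => k.
by rewrite -mulrBl cmodM.
Qed.

Lemma cvg_cmod (z : nat -> R[i]) (w : R[i]) :
  cmod (z k - w) @[k --> \oo] --> (0 : R) -> cmod (z k) @[k --> \oo] --> cmod w.
Proof.
move=> h; apply/subr_cvg0/norm_cvg0P.
apply: (squeeze_cvgr _ (cvg_cst 0) h); apply: nearW => k; rewrite normr_ge0 /=.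
by rewrite ler_norml lerNl opprB cmod_le_dist andbT cmodB cmod_le_dist.
Qed.

Lemma evolution_cvg phi h x (t_ : nat -> R) t : measurable_fun setT phi ->
  cintegrable lebesgue_rV h -> t_ @ \oo --> t ->
  cmod (evolution phi (t_ k) h x - evolution phi t h x) @[k --> \oo] --> (0 : R).
Proof.
move=> mphi ih tt.
apply: (@cint_dominated _ _ _ _ _ _ (fun xi => cmod (h xi))).
- by move=> k; apply: cmeasM; [exact: cmeas_evolution_kernel|case: ih].
- by apply: cmeasM; [exact: cmeas_evolution_kernel|case: ih].
- exact: cintegrable_cmod.
- by move=> k xi; rewrite cmodM cmod_cexpi mul1r.
- move=> xi; apply: (@cvg_cmod_scale (fun k => cexpi _)); apply: cvg_cexpi.
  apply: cvgD; first exact: cvg_cst.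
  by apply: cvgM => //; exact: cvg_cst.
Qed.

Lemma cvg_sqr (u : nat -> R) (l : R) : u @ \oo --> l -> (u k) ^+ 2 @[k --> \oo] --> l ^+ 2.
Proof. by move=> ul; rewrite expr2; under eq_cvg do rewrite expr2; exact: cvgM. Qed.

Lemma EFin_lim_le (u : nat -> R) (l : R) (c : \bar R) : u @ \oo --> l ->
  (forall k, ((u k)%:E <= c)%E) -> (l%:E <= c)%E.
Proof.
move=> ul; case: c => [c uc|_|/(_ 0%N)//]; last exact: leey.
by rewrite lee_fin; apply: (cvgr_to_le ul); apply: nearW => k; rewrite -lee_fin.
Qed.

Lemma rat_approx (t : R) : 0 < t < 1 -> exists q : nat -> rat,
  (forall k, 0 < (ratr (q k) : R) < 1) /\ (fun k => ratr (q k) : R) @ \oo --> t.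
Proof.
move=> /andP[t0 t1].
have H (k : nat) : exists q : rat, [/\ 0 < ratr q :> R, ratr q < 1 :> R,
    t - k.+1%:R^-1 < ratr q :> R & ratr q < t + k.+1%:R^-1 :> R].
  have k0 : 0 < k.+1%:R^-1 :> R by rewrite invr_gt0.
  have [|q] := @rat_in_itvoo R (Num.max 0 (t - k.+1%:R^-1)) t.
    by rewrite gt_max t0 ltrBlDr ltrDl.
  rewrite in_itv/= gt_max => /andP[/andP[q0 q1] q2].
  by exists q; split => //; [exact: lt_trans q2 t1|rewrite (lt_trans q2)// ltrDl].
have [q hq] := choice H; exists q; split.
  by move=> k; have [-> ->] := hq k.
apply/cvgrPdist_lt => e e0; near=> k.
have [_ _ h1 h2] := hq k.
have hk : k.+1%:R^-1 < e by near: k; exact: near_infty_natSinv_lt (PosNum e0).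
by apply: lt_trans hk; rewrite ltr_distlC h1 h2.
Unshelve. all: by end_near. Qed.

(** By continuity in t the supremum over (0, 1) is attained along rational times, and a countable
    supremum of measurable functions is measurable. *)
Lemma measurable_msq phi h : measurable_fun setT phi ->
  cintegrable lebesgue_rV h -> measurable_fun setT (msq phi h).
Proof.
move=> mphi ih.
(* Indices that code no rational of (0, 1) contribute 0, which does not affect a supremum of
   nonnegative quantities. *)
pose a (k : nat) x : \bar R := if unpickle k is Some q then
  if 0 < (ratr q : R) < 1 then ((cmod (evolution phi (ratr q) h x)) ^+ 2)%:E else 0%E else 0%E.
have ma k : measurable_fun setT (a k).
  rewrite /a; case: (unpickle k : option rat) => [q|]; last exact: measurable_cst.
  case: (0 < (ratr q : R) < 1); last exact: measurable_cst.
  apply/measurable_EFinP; apply: measurable_funX; apply: measurable_cmod.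
  by apply: cmeas_evolution => //; case: ih.
suff -> : msq phi h = fun x => esups (a ^~ x) 0 by exact: measurable_fun_esups.
apply/funext => x; apply/le_anti/andP; split.
  apply: msq_le => t t01; have [q [q01 qt]] := rat_approx t01.
  apply: (EFin_lim_le (cvg_sqr (cvg_cmod (evolution_cvg x mphi ih qt)))) => k.
  apply: ereal_sup_ubound; exists (pickle (q k)) => //=.
  by rewrite /a pickleK q01.
apply: ge_ereal_sup => _ [k _ <-]; rewrite /a.
case: (unpickle k : option rat) => [q|]; last exact: msq_ge0.
by case: ifPn => q01; [exact: msq_ge|exact: msq_ge0].
Qed.

End evolution.

Lemma cintegrable_prod_le (R : realType) d1 d2 (T1 : measurableType d1) (T2 : measurableType d2)
    (m1 : {sigma_finite_measure set T1 -> \bar R})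
    (m2 : {sigma_finite_measure set T2 -> \bar R}) (F : T1 * T2 -> R[i])
    (u : T1 -> R) (v : T2 -> R) : cmeas F ->
  m1.-integrable setT (EFin \o u) -> m2.-integrable setT (EFin \o v) ->
  (forall x, 0 <= u x) -> (forall y, 0 <= v y) ->
  (forall x y, cmod (F (x, y)) <= u x * v y) -> cintegrable (m1 \x m2)%E F.
Proof.
move=> mF iu iv u0 v0 Fuv; apply: cintegrable_prod => //.
apply: (@le_lt_trans _ _ (\int[m1]_x ((u x)%:E * (\int[m2]_y v y)%:E))%E); last first.
  under eq_integral do rewrite -EFinM mulrC.
  exact: (integrable_lty measurableT (integrableZl_EFin (\int[m2]_y v y) iu)).
have mc : measurable_fun setT (fun p => (cmod (F p))%:E).
  by apply/measurable_EFinP; exact: measurable_cmod.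
apply: ge0_le_integral => //.
- by move=> x _; apply: integral_ge0 => y _; rewrite lee_fin cmod_ge0.
- apply: (measurable_fun_fubini_tonelli_F (m2 := m2) (fun p => (cmod (F p))%:E)) => //.
  by move=> p; rewrite lee_fin cmod_ge0.
- under eq_fun do rewrite -EFinM mulrC.
  by have /integrableP[] := integrableZl_EFin (\int[m2]_y v y) iu.
- move=> x _; rewrite -EFinM -RintegralZl// /Rintegral fineK; last first.
    apply: integrable_fin_num => //; exact: integrableZl_EFin.
  apply: ge0_le_integral => //.
  + by move=> y _; rewrite lee_fin cmod_ge0.
  + by apply/measurable_EFinP; apply: measurable_cmod;
      case: mF => a b; split; [exact: (measurableT_comp a)|exact: (measurableT_comp b)].
  + by have /integrableP[] := integrableZl_EFin (u x) iv.
  + by move=> y _; rewrite lee_fin.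
Qed.

(** * Convolution of a datum with Gaussian densities *)

Section mollification.
Context {R : realType} {n : nat}.
Implicit Types (h : 'rV[R]_n -> R[i]) (x z xi eta : 'rV[R]_n).

Lemma normal_peak_scale (sigma : R) : 0 < sigma ->
  normal_peak sigma = sigma^-1 * normal_peak 1.
Proof.
move=> s0; rewrite /normal_peak expr1n mul1r -mulrnAr sqrtrM ?sqr_ge0//.
by rewrite sqrtr_sqr ger0_norm ?ltW// invfM.
Qed.

Lemma npdf_scale (sigma : R) z : 0 < sigma ->
  sigma ^+ n * npdf sigma (sigma *: z) = npdf 1 z.
Proof.
move=> s0; have -> : sigma ^+ n = \prod_(i < n) sigma by rewrite prodr_const card_ord.
rewrite /npdf -big_split/=; apply: eq_bigr => i _.
rewrite !normal_pdfE ?oner_eq0 ?gt_eqF// normal_peak_scale// mulrA mulrA divff ?gt_eqF//.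
rewrite mul1r; congr (_ * _); rewrite /normal_fun !subr0 mxE; congr expR.
by field; rewrite gt_eqF.
Qed.

Lemma npdf_gaussian z : npdf 1 z = normal_peak 1 ^+ n * gaussian (1 / 2) z.
Proof.
have -> : normal_peak 1 ^+ n = \prod_(i < n) (normal_peak 1 : R).
  by rewrite prodr_const card_ord.
rewrite /gaussian /rV_dot mulr_sumr -sumrN expR_sum -big_split/=.
apply: eq_bigr => i _; rewrite normal_pdfE ?oner_eq0//; congr (_ * _).
by rewrite /normal_fun subr0; congr expR; field.
Qed.

Lemma measurable_npdf (sigma : R) : measurable_fun setT (@npdf R n sigma).
Proof.
have [/integrableP[/measurable_EFinP + _] _] := @integrable_npdf R n sigma.
by [].
Qed.

Lemma npdf_ub (sigma : R) z : 0 < sigma -> npdf sigma z <= normal_peak sigma ^+ n.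
Proof.
move=> s0; have -> : normal_peak sigma ^+ n = \prod_(i < n) normal_peak sigma.
  by rewrite prodr_const card_ord.
by apply: ler_prod => i _; rewrite normal_pdf_ge0 normal_pdf_ub// gt_eqF.
Qed.

Lemma measurable_npdf_sub (sigma : R) eta :
  measurable_fun setT (fun xi => npdf sigma (xi - eta)).
Proof.
apply: (measurableT_comp (measurable_npdf sigma)).
by apply: measurable_rVB => //; exact: measurable_cst.
Qed.

(** The substitution xi = sigma z + eta moves the dependence on sigma and eta from the density to
    the integrand, where limits and weights can be handled. *)
Lemma ge0_integral_npdf (sigma : R) eta (g : 'rV[R]_n -> \bar R) : 0 < sigma ->
  measurable_fun setT g -> (forall xi, 0 <= g xi)%E ->
  (\int[lebesgue_rV]_xi (g xi * (npdf sigma (xi - eta))%:E) =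
   \int[lebesgue_rV]_z (g (sigma *: z + eta)%R * (npdf 1 z)%:E))%E.
Proof.
move=> s0 mg g0; rewrite -[LHS](@ge0_integral_rV_affine _ _ sigma eta)//.
- rewrite -ge0_integralZl//.
  + apply: eq_integral => z _; rewrite addrK muleCA -EFinM npdf_scale//.
  + apply: emeasurable_funM.
      by apply: (measurableT_comp mg); exact: measurable_affine.
    apply/measurable_EFinP; apply: (measurableT_comp (measurable_npdf_sub sigma eta)).
    exact: measurable_affine.
  + by move=> z _; rewrite mule_ge0// lee_fin npdf_ge0.
  + by rewrite lee_fin exprn_ge0// ltW.
- apply: emeasurable_funM => //; apply/measurable_EFinP; exact: measurable_npdf_sub.
- by move=> xi; rewrite mule_ge0// lee_fin npdf_ge0.
Qed.

Lemma ge0_integral_npdf1 : (\int[lebesgue_rV]_z (npdf 1 (z : 'rV[R]_n))%:E = 1)%E.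
Proof.
have [i1 i2] := @integrable_npdf R n 1.
have := congr1 EFin i2; rewrite /Rintegral fineK//.
exact: (integrable_fin_num measurableT i1).
Qed.

Lemma ge0_integral_npdf_sub (sigma : R) eta : 0 < sigma ->
  (\int[lebesgue_rV]_xi (npdf sigma (xi - eta))%:E = 1)%E.
Proof.
move=> s0.
have := @ge0_integral_npdf sigma eta (cst 1%E) s0 (measurable_cst _) (fun=> lee01).
under eq_integral do rewrite mul1e.
under [X in _ = X -> _]eq_integral do rewrite mul1e.
by rewrite ge0_integral_npdf1.
Qed.

Lemma integrable_npdf_sub (sigma : R) eta : 0 < sigma ->
  lebesgue_rV.-integrable setT (EFin \o (fun xi => npdf sigma (xi - eta))).
Proof.
move=> s0; apply/integrableP; split.
  by apply/measurable_EFinP; exact: measurable_npdf_sub.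
under eq_integral do rewrite /= ger0_norm ?npdf_ge0//.
by rewrite ge0_integral_npdf_sub// ltry.
Qed.

Lemma cint_npdf (sigma : R) eta (g : 'rV[R]_n -> R[i]) : 0 < sigma ->
  cmeas g -> (forall xi, cmod (g xi) <= 1) ->
  cint lebesgue_rV (fun xi => g xi * (npdf sigma (xi - eta))%:C%C) =
  cint lebesgue_rV (fun z => g (sigma *: z + eta) * (npdf 1 z)%:C%C).
Proof.
move=> s0 mg g1; rewrite -[LHS](@cint_rV_affine _ _ sigma eta)//; last first.
  apply: cintegrableMl g1 _ => //; apply: cintegrable_real.
  exact: integrable_npdf_sub.
rewrite -cintZ.
  by apply: eq_cint => z; rewrite addrK mulrCA -rmorphM npdf_scale.
have := @cintegrable_rV_affine _ _ sigma eta
  (fun xi => g xi * (npdf sigma (xi - eta))%:C%C) s0; apply.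
apply: cintegrableMl g1 _ => //; apply: cintegrable_real.
exact: integrable_npdf_sub.
Qed.

Definition mollify (sigma : R) h xi : R[i] :=
  cint lebesgue_rV (fun eta => (npdf sigma (xi - eta))%:C%C * h eta).

Lemma cmeas_mollify_kernel (sigma : R) h : cmeas h ->
  cmeas (fun p : 'rV[R]_n * 'rV[R]_n => (npdf sigma (p.1 - p.2))%:C%C * h p.2).
Proof.
move=> mh; apply: cmeasM; last exact: cmeas_comp mh measurable_snd.
apply: cmeas_real; apply: (measurableT_comp (measurable_npdf sigma)).
exact: measurable_rVB.
Qed.

Lemma cmeas_mollify (sigma : R) h : cmeas h -> cmeas (mollify sigma h).
Proof.
move=> mh; apply: (@cmeas_cint2 _ _ _ _ _ lebesgue_rV
  (fun p : 'rV[R]_n * 'rV[R]_n => (npdf sigma (p.1 - p.2))%:C%C * h p.2)).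
exact: cmeas_mollify_kernel.
Qed.

Lemma cintegrable_mollify (sigma : R) h xi : 0 < sigma -> cintegrable lebesgue_rV h ->
  cintegrable lebesgue_rV (fun eta => (npdf sigma (xi - eta))%:C%C * h eta).
Proof.
move=> s0 ih; apply: (@cintegrableMl _ _ _ _ _ _ (normal_peak sigma ^+ n)) => //.
- apply: cmeas_real; apply: (measurableT_comp (measurable_npdf sigma)).
  by apply: measurable_rVB => //; exact: measurable_cst.
- by move=> eta; rewrite cmod_real ger0_norm ?npdf_ge0// npdf_ub.
Qed.

Variables (r : R) (h : 'rV[R]_n -> R[i]).
Hypothesis hh : bounded_supp r h.

Lemma bounded_supp_moments :
  all_moments (fun y => Re (h y)) /\ all_moments (fun y => Im (h y)).
Proof.
have [[m1 m2] [M hM] h0] := hh; split;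
    apply: (@all_moments_bounded_support _ _ _ r M) => //.
- by move=> x; rewrite (le_trans (normr_Re_le _)).
- by move=> x xr; rewrite h0.
- by move=> x; rewrite (le_trans (normr_Im_le _)).
- by move=> x xr; rewrite h0.
Qed.

(* The function is a Gaussian times the inverse Fourier transform of h. *)
Lemma mollify_fourier_schwartz (sigma : R) : 0 < sigma ->
  exists2 f, schwartz f & fourier f = mollify sigma h.
Proof.
move=> s0; have [c c0 hc] := rfourier_gaussian n s0.
pose s := sigma ^+ 2 / 2; have sg0 : 0 < s by rewrite divr_gt0// exprn_gt0.
have [m1 m2] := bounded_supp_moments.
have [i1 i2] := (all_moments_integrable m1, all_moments_integrable m2).
have ih := bounded_supp_cintegrable hh.
pose f x : R[i] := (c^-1 * gaussian s x)%:C%C *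
  cint lebesgue_rV (fun eta => cexpi (rV_dot x eta) * h eta).
exists f.
  split; apply: (gclass_schwartz sg0).
    have -> : (fun x => Re (f x)) = (fun x =>
        c^-1 * (gaussian s x * phase 0 (fun y => Re (h y)) x) +
        c^-1 * (gaussian s x * phase (pi / 2) (fun y => Im (h y)) x)).
      apply/funext => x; rewrite /f ReM /= mul0r subr0 -!mulrA -!mulrDr.
      rewrite -RintegralD//; [|exact: integrable_phase|exact: integrable_phase].
      congr (_ * (_ * _)); apply: eq_Rintegral => y _.
      by rewrite ReM /= addr0 cosDpihalf mulNr.
    by apply: gclassD; apply: gclassZ; exact: gclass_phase.
  have -> : (fun x => Im (f x)) = (fun x =>
      c^-1 * (gaussian s x * phase 0 (fun y => Im (h y)) x) +
      - c^-1 * (gaussian s x * phase (pi / 2) (fun y => Re (h y)) x)).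
    apply/funext => x; rewrite /f ImM /= mul0r addr0 mulNr -!mulrA -!mulrBr.
    rewrite -RintegralB//; [|exact: integrable_phase|exact: integrable_phase].
    congr (_ * (_ * _)); apply: eq_Rintegral => y _.
    by rewrite ImM /= addr0 cosDpihalf mulNr opprK.
  by apply: gclassD; apply: gclassZ; exact: gclass_phase.
apply/funext => xi.
pose F (p : 'rV[R]_n * 'rV[R]_n) : R[i] :=
  (c^-1)%:C%C * (cexpi (- rV_dot p.1 (xi - p.2)) * (gaussian s p.1)%:C%C * h p.2).
have mF : cmeas F.
  apply: cmeasM; first exact: cmeas_cst.
  apply: cmeasM; last exact: cmeas_comp (bounded_supp_cintegrable hh).1 measurable_snd.
  apply: cmeasM.
    apply: cmeas_cexpi; apply: measurableT_comp => //; apply: measurable_rV_dot => //.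
    by apply: measurable_rVB => //; exact: measurable_cst.
  by apply: cmeas_real; exact: measurableT_comp (measurable_gaussian s) measurable_fst.
have F1 x : (fun eta => F (x, eta)) = (fun eta =>
    (cexpi (- rV_dot x xi) * (c^-1 * gaussian s x)%:C%C) * (cexpi (rV_dot x eta) * h eta)).
  apply/funext => eta; rewrite /F /= rV_dotDr rV_dotNr opprD opprK cexpiD rmorphM /=.
  by ring.
have F2 eta : (fun x => F (x, eta)) = (fun x =>
    ((c^-1)%:C%C * h eta) * (cexpi (- rV_dot x (xi - eta)) * (gaussian s x)%:C%C)).
  by apply/funext => x; rewrite /F /=; ring.
have ie x : cintegrable lebesgue_rV (fun eta => cexpi (rV_dot x eta) * h eta).
  apply: (@cintegrableMl _ _ _ _ _ _ 1) => //; last by move=> y; rewrite cmod_cexpi.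
  by apply: cmeas_cexpi; apply: measurable_rV_dot => //; exact: measurable_cst.
transitivity (cint lebesgue_rV (fun x => cint lebesgue_rV (fun eta => F (x, eta)))).
  by apply: eq_cint => x; rewrite F1 cintZ// /f mulrA.
rewrite cint_fubini.
- apply: eq_cint => eta; rewrite F2 cintZ; last first.
    by apply: cintegrable_character; exact: integrable_gaussian.
  rewrite -/(rfourier _ _) hc rmorphM mulrACA -rmorphM mulVf ?gt_eqF// mul1r.
  by rewrite mulrC.
- apply: (cintegrable_prod_le (u := fun x => c^-1 * gaussian s x) (v := fun y => cmod (h y))) => //.
  + exact: integrableZl_EFin (integrable_gaussian n sg0).
  + exact: cintegrable_cmod.
  + by move=> x; rewrite mulr_ge0 ?expR_ge0// invr_ge0 ltW.
  + by move=> x; exact: cmod_ge0.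
  + move=> x y; rewrite /F /= !cmodM cmod_cexpi mul1r !cmod_real mulrA.
    by rewrite !ger0_norm ?expR_ge0// invr_ge0 ltW.
- by move=> x; rewrite F1; exact: cintegrableZ.
- move=> eta; rewrite F2; apply: cintegrableZ; apply: cintegrable_character.
  exact: integrable_gaussian.
Qed.

End mollification.

(** * Jensen's inequality for the square *)

Section jensen.
Context d (T : measurableType d) {R : realType} (mu : {measure set T -> \bar R}).

(** Expand the integral of w (v - m)^2, which is nonnegative, with m the mean of v. *)
Lemma Rintegral_jensen_sqr (w v : T -> R) :
  (forall x, 0 <= w x) -> mu.-integrable setT (EFin \o w) ->
  mu.-integrable setT (EFin \o (fun x => w x * v x)) ->
  mu.-integrable setT (EFin \o (fun x => w x * v x ^+ 2)) ->
  \int[mu]_x w x = 1 ->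
  (\int[mu]_x (w x * v x)) ^+ 2 <= \int[mu]_x (w x * v x ^+ 2).
Proof.
move=> w0 iw iwv iwv2 w1; set m := \int[mu]_x (w x * v x).
have : 0 <= \int[mu]_x (w x * v x ^+ 2 + (- (2 * m) * (w x * v x) + m ^+ 2 * w x)).
  apply: Rintegral_ge0 => x _.
  have -> : w x * v x ^+ 2 + (- (2 * m) * (w x * v x) + m ^+ 2 * w x) =
    w x * (v x - m) ^+ 2 by ring.
  by rewrite mulr_ge0// sqr_ge0.
rewrite RintegralD//; last first.
  by apply: integrableD_EFin; exact: integrableZl_EFin.
rewrite RintegralD//; [|exact: integrableZl_EFin|exact: integrableZl_EFin].
rewrite !RintegralZl// w1 -/m; lra.
Qed.

End jensen.

(** * Convergence of the evolutions of mollified data *)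

Section extended_estimate.
Context {R : realType} {n : nat}.
Implicit Types (h : 'rV[R]_n -> R[i]) (x z xi eta : 'rV[R]_n).
Variable phi : 'rV[R]_n -> R.
Hypothesis phi_cont : continuous phi.

Let mphi : measurable_fun setT phi.
Proof. exact: continuous_measurable_rV. Qed.

Definition phase_fun x t xi : R := rV_dot x xi + t * phi xi.

Lemma continuous_rV_dot x : continuous (fun xi => rV_dot x xi).
Proof.
rewrite /rV_dot; elim: (index_enum _) => [|i w IH] xi.
  by under eq_fun do rewrite big_nil; exact: cst_continuous.
under eq_fun do rewrite big_cons.
apply: (@continuousD _ _ _ (fun y : 'rV[R]_n => x 0 i * y 0 i)); last exact: IH.
apply: (@continuousM _ _ (cst (x 0 i)) (fun y : 'rV[R]_n => y 0 i)).
  exact: cst_continuous.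
exact: continuous_rV_coord.
Qed.

Lemma continuous_phase_fun x t : continuous (phase_fun x t).
Proof.
move=> xi; apply: (@continuousD _ _ _ (fun xi => rV_dot x xi) (fun xi => t * phi xi)).
  exact: continuous_rV_dot.
apply: (@continuousM _ _ (cst t) phi); first exact: cst_continuous.
exact: phi_cont.
Qed.

Lemma measurable_phase_fun x t : measurable_fun setT (phase_fun x t).
Proof. by apply: continuous_measurable_rV; exact: continuous_phase_fun. Qed.

Variables (r : R) (h : 'rV[R]_n -> R[i]).
Hypothesis hh : bounded_supp r h.

(** The exponential averaged around eta: Fubini moves the mollification from the datum to the
    kernel, where continuity of the phase can be used. *)
Definition averaged_kernel (sigma : R) x t eta : R[i] :=
  cint lebesgue_rV (fun z => cexpi (phase_fun x t (sigma *: z + eta)) * (npdf 1 z)%:C%C).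

Lemma cmeas_averaged_kernel sigma x t : cmeas (averaged_kernel sigma x t).
Proof.
apply: (@cmeas_cint2 _ _ _ _ _ lebesgue_rV (fun p : 'rV[R]_n * 'rV[R]_n =>
  cexpi (phase_fun x t (sigma *: p.2 + p.1)) * (npdf 1 p.2)%:C%C)).
apply: cmeasM.
  apply: cmeas_cexpi; apply: (measurableT_comp (measurable_phase_fun x t)).
  have := @measurable_rV_affine R n _ _ sigma 1 snd fst measurable_snd measurable_fst.
  by apply: eq_measurable_fun => p _; rewrite scale1r.
by apply: cmeas_real; exact: measurableT_comp (measurable_npdf 1) measurable_snd.
Qed.

Lemma evolution_mollify sigma t x : 0 < sigma ->
  evolution phi t (mollify sigma h) x =
  cint lebesgue_rV (fun eta => averaged_kernel sigma x t eta * h eta).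
Proof.
move=> s0; have ih := bounded_supp_cintegrable hh.
have mE : cmeas (fun xi => cexpi (phase_fun x t xi)).
  by apply: cmeas_cexpi; exact: measurable_phase_fun.
pose F (p : 'rV[R]_n * 'rV[R]_n) : R[i] :=
  cexpi (phase_fun x t p.1) * ((npdf sigma (p.1 - p.2))%:C%C * h p.2).
have mF : cmeas F.
  by apply: cmeasM; [exact: cmeas_comp mE measurable_fst|exact: cmeas_mollify_kernel ih.1].
have F1 xi : (fun eta => F (xi, eta)) = (fun eta =>
    cexpi (phase_fun x t xi) * ((npdf sigma (xi - eta))%:C%C * h eta)) by [].
have F2 eta : (fun xi => F (xi, eta)) = (fun xi =>
    h eta * (cexpi (phase_fun x t xi) * (npdf sigma (xi - eta))%:C%C)).
  by apply/funext => xi; rewrite /F /=; ring.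
have iE eta : cintegrable lebesgue_rV
    (fun xi => cexpi (phase_fun x t xi) * (npdf sigma (xi - eta))%:C%C).
  apply: (@cintegrableMl _ _ _ _ _ _ 1) => //; last first.
    by apply: cintegrable_real; exact: integrable_npdf_sub.
  by move=> y; rewrite cmod_cexpi.
transitivity (cint lebesgue_rV (fun xi => cint lebesgue_rV (fun eta => F (xi, eta)))).
  by apply: eq_cint => xi; rewrite F1 cintZ//; exact: cintegrable_mollify.
rewrite cint_fubini.
- apply: eq_cint => eta; rewrite F2 cintZ// mulrC; congr (_ * _).
  by rewrite cint_npdf// => y; rewrite cmod_cexpi.
- have mc : measurable_fun setT (fun p => (cmod (F p))%:E).
    by apply/measurable_EFinP; exact: measurable_cmod.
  apply: cintegrable_prod => //.
  (* Integrating in xi first: the density has mass 1, and the integral of |h| is what remains. *)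
  rewrite (@fubini_tonelli _ _ _ _ _ _ _ (fun p => (cmod (F p))%:E))//; last first.
    by move=> p; rewrite lee_fin cmod_ge0.
  under eq_integral => eta _.
    have E : (fun xi => (cmod (F (xi, eta)))%:E) =
        (fun xi => ((cmod (h eta))%:E * (npdf sigma (xi - eta))%:E)%E).
      apply/funext => xi; rewrite -EFinM /F /= !cmodM cmod_cexpi mul1r cmod_real.
      by rewrite ger0_norm ?npdf_ge0// mulrC.
    rewrite E (@ge0_integral_npdf _ _ sigma eta (cst (cmod (h eta))%:E))//; last first.
      by move=> xi; rewrite lee_fin cmod_ge0.
    rewrite ge0_integralZl//; last 3 first.
    - by apply/measurable_EFinP; exact: measurable_npdf.
    - by move=> z _; rewrite lee_fin npdf_ge0.
    - by rewrite lee_fin cmod_ge0.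
    rewrite ge0_integral_npdf1 mule1.
    over.
  by case: ih.
- move=> xi; rewrite F1; apply: cintegrableZ; exact: cintegrable_mollify.
- by move=> eta; rewrite F2; exact: cintegrableZ.
Qed.

Lemma averaged_kernel_cvg x t eta :
  cmod (averaged_kernel k.+1%:R^-1 x t eta - cexpi (phase_fun x t eta))
    @[k --> \oo] --> (0 : R).
Proof.
have [i1 i2] := @integrable_npdf R n 1.
have -> : cexpi (phase_fun x t eta) = cint lebesgue_rV
    (fun z : 'rV[R]_n => cexpi (phase_fun x t eta) * (npdf 1 z)%:C%C).
  by rewrite cintZ ?cint_real ?i2 ?mulr1//; exact: cintegrable_real.
apply: (@cint_dominated _ _ _ _ _ _ (npdf 1)).
- move=> k; apply: cmeasM.
    apply: cmeas_cexpi; apply: (measurableT_comp (measurable_phase_fun x t)).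
    exact: measurable_affine.
  by apply: cmeas_real; exact: measurable_npdf.
- by apply: cmeasM; [exact: cmeas_cst|apply: cmeas_real; exact: measurable_npdf].
- exact: i1.
- by move=> k z; rewrite cmodM cmod_cexpi mul1r cmod_real ger0_norm// npdf_ge0.
- move=> z; apply: (@cvg_cmod_scale _ (fun k => cexpi _)); apply: cvg_cexpi.
  have hz : (k.+1%:R^-1 : R) *: z @[k --> \oo] --> (0 : 'rV[R]_n).
    by rewrite -[X in _ --> X](scale0r z); apply: cvgZr_tmp; exact: cvg_harmonic.
  have he : (k.+1%:R^-1 : R) *: z + eta @[k --> \oo] --> eta.
    by rewrite -[X in _ --> X]add0r; apply: cvgD => //; exact: cvg_cst.
  exact: (cvg_comp _ _ he (@continuous_phase_fun x t eta)).
Qed.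

Lemma averaged_kernel_le1 sigma x t eta : cmod (averaged_kernel sigma x t eta) <= 1.
Proof.
have [i1 i2] := @integrable_npdf R n 1.
rewrite (le_trans (cmod_cint_Rintegral _))//; last first.
  rewrite -[X in _ <= X]i2; under eq_Rintegral do
    rewrite cmodM cmod_cexpi mul1r cmod_real ger0_norm ?npdf_ge0//.
  exact: lexx.
apply: (@cintegrableMl _ _ _ _ _ _ 1); [|by move=> z; rewrite cmod_cexpi|].
  apply: cmeas_cexpi; apply: (measurableT_comp (measurable_phase_fun x t)).
  exact: measurable_affine.
exact: cintegrable_real.
Qed.

Lemma evolution_mollify_cvg t x :
  cmod (evolution phi t (mollify k.+1%:R^-1 h) x - evolution phi t h x)
    @[k --> \oo] --> (0 : R).
Proof.
have ih := bounded_supp_cintegrable hh.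
under eq_cvg do rewrite evolution_mollify ?invr_gt0//.
apply: (@cint_dominated _ _ _ _ _ _ (fun xi => cmod (h xi))).
- by move=> k; apply: cmeasM ih.1; exact: cmeas_averaged_kernel.
- by apply: cmeasM ih.1; exact: cmeas_evolution_kernel.
- exact: cintegrable_cmod.
- by move=> k xi; rewrite cmodM ler_piMl ?cmod_ge0// averaged_kernel_le1.
- by move=> eta; apply: cvg_cmod_scale; exact: averaged_kernel_cvg.
Qed.

End extended_estimate.

(** * Weighted norms of mollified data *)

Section weighted_norm.
Context {R : realType} {n : nat}.
Implicit Types (h g : 'rV[R]_n -> R[i]) (x z xi eta : 'rV[R]_n).

(** For g the Fourier transform of f this is the square of the H^s norm of f. *)
Definition weightsq (s : R) g : \bar R :=
  (\int[lebesgue_rV]_xi ((japanese xi `^ s * cmod (g xi)) ^+ 2)%:E)%E.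

Lemma japanese_sqr xi : japanese xi ^+ 2 = 1 + rV_dot xi xi.
Proof.
rewrite /japanese sqr_sqrtr ?addr_ge0 ?sqr_ge0// /enorm sqr_sqrtr//.
exact: rV_dotxx_ge0.
Qed.

Lemma japanese_ge0 xi : 0 <= japanese xi. Proof. exact: sqrtr_ge0. Qed.

Lemma japanese_powR_sqr (s : R) xi : (japanese xi `^ s) ^+ 2 = (1 + rV_dot xi xi) `^ s.
Proof.
rewrite -japanese_sqr -(powR_mulrn _ (powR_ge0 _ _)) -(powR_mulrn _ (japanese_ge0 _)).
by rewrite -!powRrM mulrC.
Qed.

Lemma rV_dot_sqrD x z : rV_dot (x + z) (x + z) <= 2 * rV_dot x x + 2 * rV_dot z z.
Proof.
rewrite /rV_dot !mulr_sumr -big_split/=; apply: ler_sum => i _; rewrite mxE.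
by have := sqr_ge0 (x 0 i - z 0 i); nra.
Qed.

Lemma rV_dot_box (r : R) x : box r x -> rV_dot x x <= n%:R * r ^+ 2.
Proof.
move=> xr; rewrite /rV_dot (le_trans (y := \sum_(i < n) r ^+ 2))//; last first.
  by rewrite sumr_const card_ord mulr_natl.
apply: ler_sum => i _; rewrite -expr2 -(real_normK (num_real (x 0 i))).
by rewrite ler_pXn2r// ?nnegrE// (le_trans _ (xr i)).
Qed.

(** The weight of a mollified datum splits into r^(2 s), from the frequency box, and a factor in z
    that does not involve sigma. The exponent of the latter is rounded up to an integer so that
    polynomial moments of the Gaussian suffice. *)
Lemma japanese_shift (s r sigma : R) z eta : 0 <= s -> 1 <= r -> 0 <= sigma <= 1 ->
  box r eta ->
  (japanese (sigma *: z + eta) `^ s) ^+ 2 <=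
  (2 * n.+1%:R) `^ s * (r `^ s) ^+ 2 * (1 + rV_dot z z) ^+ (Num.truncn s).+1.
Proof.
move=> s0 r1 /andP[sg0 sg1] er; rewrite japanese_powR_sqr.
have h1 : 1 + rV_dot (sigma *: z + eta) (sigma *: z + eta) <=
    2 * n.+1%:R * r ^+ 2 * (1 + rV_dot z z).
  have h2 := rV_dot_sqrD (sigma *: z) eta.
  have h3 : rV_dot (sigma *: z) (sigma *: z) <= rV_dot z z.
    rewrite rV_dotZl rV_dotZr mulrA -expr2.
    by apply: ler_piMl; [exact: rV_dotxx_ge0|exact: exprn_ile1].
  have h4 := rV_dot_box er.
  have r2 : 1 <= r ^+ 2 by rewrite expr_ge1// (le_trans ler01).
  have n0 : 0 <= n%:R :> R by [].
  have dz := rV_dotxx_ge0 z.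
  rewrite -natr1; set N : R := n%:R in n0 h4 *; set P := r ^+ 2 in r2 h4 *.
  set D := rV_dot z z in h3 dz *.
  have : 0 <= N * P * D by rewrite !mulr_ge0// (le_trans ler01).
  have : 0 <= (P - 1) * D by rewrite mulr_ge0// subr_ge0.
  by lra.
have a0 : 0 <= 1 + rV_dot (sigma *: z + eta) (sigma *: z + eta).
  by rewrite addr_ge0// rV_dotxx_ge0.
apply: (@le_trans _ _ ((2 * n.+1%:R * r ^+ 2 * (1 + rV_dot z z)) `^ s)).
  by apply: ge0_ler_powR => //; rewrite nnegrE (le_trans a0).
have r0 : 0 <= r by exact: le_trans ler01 r1.
have z1 : 1 <= 1 + rV_dot z z by rewrite lerDl rV_dotxx_ge0.
rewrite (@powRM _ (2 * n.+1%:R * r ^+ 2)) ?mulr_ge0 ?sqr_ge0 ?(le_trans ler01 z1)//.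
rewrite (@powRM _ (2 * n.+1%:R)) ?sqr_ge0//.
rewrite -(powR_mulrn _ (powR_ge0 _ _)) -(powR_mulrn _ (le_trans ler01 r1)).
rewrite -!powRrM (mulrC s) ler_wpM2l// ?mulr_ge0 ?powR_ge0//.
rewrite -(@powR_mulrn _ (1 + rV_dot z z)) ?(le_trans ler01 z1)//.
apply: ler_powR => //.
by have /andP[_ /ltW] := truncn_itv s0.
Qed.

Lemma gdominatedD (s : R) (u v : 'rV[R]_n -> R) : gdominated s u -> gdominated s v ->
  gdominated s (fun x => u x + v x).
Proof.
move=> hu hv s' hs'; have [C hC] := hu _ hs'; have [D hD] := hv _ hs'.
by exists (C + D) => x; rewrite mulrDl (le_trans (ler_normD _ _))// lerD.
Qed.

Lemma gdominated_dot (s : R) (u : 'rV[R]_n -> R) m : gdominated s u ->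
  gdominated s (fun x => (1 + rV_dot x x) ^+ m * u x).
Proof.
move=> hu; pose G k x := (1 + rV_dot x x) ^+ k * u x.
have G0 : G 0%N = u by apply/funext => x; rewrite /G mul1r.
have GS k : G k.+1 = fun x => G k x + rV_dot x x * G k x.
  by apply/funext => x; rewrite /G exprS; ring.
suff H k : gdominated s (G k) by exact: H.
elim: k => [|k IH]; first by rewrite G0.
rewrite GS; apply: gdominatedD => //.
have -> : (fun x => rV_dot x x * G k x) = (fun x => \sum_(i < n) x 0 i * (x 0 i * G k x)).
  by apply/funext => x; rewrite /rV_dot mulr_suml; apply: eq_bigr => i _; rewrite mulrA.
elim: (index_enum _) => [|i w IHw].
  have -> : (fun x => \sum_(i <- [::]) x 0 i * (x 0 i * G k x)) = (fun=> 0).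
    by apply/funext => x; rewrite big_nil.
  by move=> s' _; exists 0 => x; rewrite normr0 mul0r.
have -> : (fun x => \sum_(j <- i :: w) x 0 j * (x 0 j * G k x)) =
    (fun x => x 0 i * (x 0 i * G k x) + \sum_(j <- w) x 0 j * (x 0 j * G k x)).
  by apply/funext => x; rewrite big_cons.
by apply: gdominatedD => //; do 2 apply: gdominated_coord.
Qed.

Lemma npdf_moment m : exists2 A : R, 0 <= A &
  (\int[lebesgue_rV]_z ((1 + rV_dot z z) ^+ m * npdf 1 (z : 'rV[R]_n))%:E = A%:E)%E.
Proof.
have mf : measurable_fun setT (fun z : 'rV[R]_n => (1 + rV_dot z z) ^+ m * npdf 1 z).
  apply: measurable_funM; last exact: measurable_npdf.
  by apply: measurable_funX; apply: measurable_funD => //; exact: measurable_rV_dot.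
have [|C _ hC] := @rapid_pweight R n (fun z => (1 + rV_dot z z) ^+ m * gaussian (1 / 2) z).
  apply: (@gdominated_rapid R n (1 / 2)); first by rewrite divr_gt0.
  apply: gdominated_dot; exact: gdominated_gaussian.
have i1 : lebesgue_rV.-integrable setT
    (EFin \o (fun z : 'rV[R]_n => (1 + rV_dot z z) ^+ m * npdf 1 z)).
  apply: (@pweight_dominated _ _ _ (normal_peak 1 ^+ n * C)) => // x.
  rewrite npdf_gaussian mulrCA normrM ger0_norm ?exprn_ge0 ?normal_peak_ge0//.
  by rewrite -mulrA ler_wpM2l// exprn_ge0// normal_peak_ge0.
exists (\int[lebesgue_rV]_z ((1 + rV_dot z z) ^+ m * npdf 1 (z : 'rV[R]_n))).
  by apply: Rintegral_ge0 => z _; rewrite mulr_ge0 ?npdf_ge0// exprn_ge0// addr_ge0// rV_dotxx_ge0.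
by rewrite /Rintegral fineK//; exact: (integrable_fin_num measurableT i1).
Qed.

Lemma npdf_subC (sigma : R) x z : sigma != 0 -> npdf sigma (x - z) = npdf sigma (z - x).
Proof.
move=> s0; apply: eq_bigr => i _; rewrite -[x - z]opprB mxE !normal_pdfE//.
by congr (_ * _); rewrite /normal_fun !subr0 sqrrN.
Qed.

Lemma le_limn_einf (u v : nat -> \bar R) : (forall k, u k <= v k)%E ->
  (limn_einf u <= limn_einf v)%E.
Proof.
move=> uv; rewrite !limn_einf_lim; apply: lee_lim; [exact: is_cvg_einfs..|].
apply: nearW => k; apply: le_ereal_inf_tmp => _ [m km <-].
by apply: le_trans (uv m); apply: ereal_inf_lbound; exists m.
Qed.

Variables (r : R) (h : 'rV[R]_n -> R[i]).
Hypothesis hh : bounded_supp r h.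

(** Jensen for the probability density eta -> [npdf sigma (xi - eta)]. *)
Lemma sqr_mollify_le (sigma : R) xi : 0 < sigma ->
  (((cmod (mollify sigma h xi)) ^+ 2)%:E <=
   \int[lebesgue_rV]_eta ((cmod (h eta)) ^+ 2 * npdf sigma (xi - eta))%:E)%E.
Proof.
move=> s0; have ih := bounded_supp_cintegrable hh.
have i2 := bounded_supp_sqr hh.
pose w eta := npdf sigma (xi - eta).
have wE : w = fun eta => npdf sigma (eta - xi).
  by apply/funext => eta; rewrite /w npdf_subC// gt_eqF.
have iw : lebesgue_rV.-integrable setT (EFin \o w).
  by rewrite wE; exact: integrable_npdf_sub.
have w0 eta : 0 <= w eta by exact: npdf_ge0.
have wub eta : w eta <= normal_peak sigma ^+ n by exact: npdf_ub.
have mw : measurable_fun setT w by case/integrableP : iw => /measurable_EFinP.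
have bw (v : 'rV[R]_n -> R) : lebesgue_rV.-integrable setT (EFin \o v) ->
    lebesgue_rV.-integrable setT (EFin \o (fun eta => w eta * v eta)).
  move=> iv; apply: (@le_integrable _ _ _ _ _ _ _
    (EFin \o (fun eta => normal_peak sigma ^+ n * v eta))) => //.
  - apply/measurable_EFinP; apply: measurable_funM => //.
    by apply/measurable_EFinP; case/integrableP : iv.
  - move=> eta _; rewrite /= lee_fin !normrM ler_wpM2r// ger0_norm//.
    by rewrite (le_trans (wub _))// ler_norm.
  - exact: integrableZl_EFin.
have w1 : \int[lebesgue_rV]_eta w eta = 1.
  by rewrite wE /Rintegral ge0_integral_npdf_sub.
have i3 := bw _ (cintegrable_cmod ih).
have i4 := bw _ i2.
have J := Rintegral_jensen_sqr w0 iw i3 i4 w1.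
apply: (@le_trans _ _ (\int[lebesgue_rV]_eta (w eta * cmod (h eta) ^+ 2))%:E).
  rewrite lee_fin; apply: le_trans J.
  rewrite ler_pXn2r// ?nnegrE ?cmod_ge0//; last first.
    by apply: Rintegral_ge0 => eta _; rewrite mulr_ge0// cmod_ge0.
  apply: (le_trans (cmod_cint_Rintegral (cintegrable_mollify xi s0 ih))).
  rewrite le_eqVlt; apply/orP; left; apply/eqP; apply: eq_Rintegral => eta _.
  by rewrite cmodM cmod_real ger0_norm// npdf_ge0.
rewrite /Rintegral fineK; last exact: (integrable_fin_num measurableT i4).
by rewrite le_eqVlt; apply/orP; left; apply/eqP; apply: eq_integral => eta _; rewrite mulrC.
Qed.

(** Mollification spreads frequencies beyond the box of size r, but with Gaussian tails: the H^s
    norm stays bounded by r^s times the L^2 norm of [h], uniformly in sigma <= 1. *)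
Lemma weightsq_mollify (s A sigma : R) : 0 <= s -> 1 <= r -> 0 < sigma <= 1 ->
  0 <= A ->
  (\int[lebesgue_rV]_z ((1 + rV_dot z z) ^+ (Num.truncn s).+1 * npdf 1 (z : 'rV[R]_n))%:E
    = A%:E)%E ->
  (weightsq s (mollify sigma h) <=
   ((2 * n.+1%:R) `^ s * A * (r `^ s) ^+ 2)%:E * L2sq h)%E.
Proof.
move=> s0 r1 /andP[sg0 sg1] A0 hA.
have ih := bounded_supp_cintegrable hh; have mh := ih.1.
pose J xi := (japanese xi `^ s) ^+ 2.
have mJ : measurable_fun setT J.
  apply: measurable_funX; apply: (measurableT_comp (measurable_powR _)).
  exact: measurable_japanese.
have J0 xi : 0 <= J xi by exact: sqr_ge0.
have mc : measurable_fun setT (fun eta => (cmod (h eta)) ^+ 2).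
  by apply: measurable_funX; exact: measurable_cmod.
pose G (p : 'rV[R]_n * 'rV[R]_n) : \bar R :=
  (J p.1 * ((cmod (h p.2)) ^+ 2 * npdf sigma (p.1 - p.2)))%:E.
have mG : measurable_fun setT G.
  apply/measurable_EFinP; apply: measurable_funM.
    exact: (measurableT_comp mJ measurable_fst).
  apply: measurable_funM; first exact: (measurableT_comp mc measurable_snd).
  by apply: (measurableT_comp (measurable_npdf sigma)); exact: measurable_rVB.
have G0 p : (0 <= G p)%E.
  by rewrite lee_fin mulr_ge0// mulr_ge0 ?sqr_ge0 ?npdf_ge0.
have mw xi : measurable_fun setT (fun eta => (cmod (h eta)) ^+ 2 * npdf sigma (xi - eta)).
  apply: measurable_funM => //; apply: (measurableT_comp (measurable_npdf sigma)).
  by apply: measurable_rVB => //; exact: measurable_cst.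
apply: (@le_trans _ _ (\int[lebesgue_rV]_xi \int[lebesgue_rV]_eta G (xi, eta))%E).
  apply: ge0_le_integral => //.
  - by move=> xi _; rewrite lee_fin sqr_ge0.
  - apply/measurable_EFinP; apply: measurable_funX; apply: measurable_funM.
      by apply: (measurableT_comp (measurable_powR _)); exact: measurable_japanese.
    by apply: measurable_cmod; exact: cmeas_mollify.
  - exact: (measurable_fun_fubini_tonelli_F G).
  - move=> xi _; under eq_integral do rewrite /G /= EFinM.
    rewrite ge0_integralZl//.
    + rewrite exprMn EFinM; apply: lee_wpmul2l; first by rewrite lee_fin sqr_ge0.
      exact: sqr_mollify_le.
    + exact/measurable_EFinP.
    + by move=> eta _; rewrite lee_fin mulr_ge0 ?sqr_ge0 ?npdf_ge0.
    + by rewrite lee_fin.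
rewrite (fubini_tonelli G)// /L2sq -ge0_integralZl//; last 3 first.
- exact/measurable_EFinP.
- by move=> x _; rewrite lee_fin sqr_ge0.
- by rewrite lee_fin !mulr_ge0 ?powR_ge0// sqr_ge0.
apply: ge0_le_integral => //.
- by move=> eta _; exact: integral_ge0.
- exact: (measurable_fun_fubini_tonelli_G G).
- by apply/measurable_EFinP; exact: measurable_funM.
(* The shift estimate needs eta in the box; elsewhere both sides vanish with h eta. *)
move=> eta _; have [er|er] := pselect (box r eta); last first.
  have [_ _ h0] := hh; rewrite /G /=.
  under eq_integral do rewrite h0// cmod0 expr0n mul0r mulr0.
  by rewrite integral0 h0// cmod0 expr0n mule0.
have -> : (\int[lebesgue_rV]_xi G (xi, eta) = ((cmod (h eta)) ^+ 2)%:E *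
    \int[lebesgue_rV]_xi ((J xi)%:E * (npdf sigma (xi - eta))%:E))%E.
  rewrite -ge0_integralZl//.
  - by apply: eq_integral => xi _; rewrite /G /= -!EFinM mulrCA.
  - apply: emeasurable_funM; apply/measurable_EFinP => //.
    exact: measurable_npdf_sub.
  - by move=> xi _; rewrite mule_ge0// lee_fin ?J0 ?npdf_ge0.
  - by rewrite lee_fin sqr_ge0.
rewrite muleC lee_wpmul2r ?lee_fin ?sqr_ge0//.
rewrite (@ge0_integral_npdf _ _ sigma eta (fun xi => (J xi)%:E))//; last first.
  exact/measurable_EFinP.
have -> : ((2 * n.+1%:R) `^ s * A * (r `^ s) ^+ 2)%:E =
    (((2 * n.+1%:R) `^ s * (r `^ s) ^+ 2)%:E * A%:E)%E.
  by rewrite -EFinM mulrAC.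
have mz : measurable_fun setT
    (fun z : 'rV[R]_n => (1 + rV_dot z z) ^+ (Num.truncn s).+1 * npdf 1 z).
  apply: measurable_funM; last exact: measurable_npdf.
  by apply: measurable_funX; apply: measurable_funD => //; exact: measurable_rV_dot.
rewrite -hA -ge0_integralZl//; last 3 first.
- exact/measurable_EFinP.
- by move=> z _; rewrite lee_fin mulr_ge0 ?npdf_ge0// exprn_ge0// addr_ge0// rV_dotxx_ge0.
- by rewrite lee_fin mulr_ge0 ?powR_ge0 ?sqr_ge0.
apply: ge0_le_integral => //.
- by move=> z _; rewrite mule_ge0// lee_fin ?J0 ?npdf_ge0.
- apply: emeasurable_funM; apply/measurable_EFinP; last exact: measurable_npdf.
  by apply: (measurableT_comp mJ); exact: measurable_affine.
- by apply/measurable_EFinP; exact: measurable_funM.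
move=> z _; rewrite -!EFinM lee_fin mulrA ler_wpM2r ?npdf_ge0//.
by apply: japanese_shift => //; rewrite (ltW sg0).
Qed.

End weighted_norm.

(** * The local estimate for bounded data, on balls of any radius at least 1 *)

Section extension_and_scaling.
Context {R : realType} {n : nat}.
Implicit Types (h g : 'rV[R]_n -> R[i]) (x y z xi eta : 'rV[R]_n).
Hypothesis n_gt0 : (0 < n)%N.
Variable phi : 'rV[R]_n -> R.
Hypothesis phi_cont : continuous phi.

Let mphi : measurable_fun setT phi.
Proof. exact: continuous_measurable_rV. Qed.

Lemma measurable_unit_ball : measurable (@unit_ball R n).
Proof.
rewrite /unit_ball (_ : [set x | _] = @enorm R n @^-1` `]-oo, 1[%classic).
  by rewrite -[X in measurable X]setTI; exact: measurable_enorm.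
by apply/seteqP; split => x /=; rewrite in_itv.
Qed.

Lemma measurable_limn_einf (f : nat -> 'rV[R]_n -> \bar R) :
  (forall k, measurable_fun setT (f k)) ->
  measurable_fun setT (fun x => limn_einf (f ^~ x)).
Proof.
move=> mf; apply: (emeasurable_fun_cvg (fun k x => einfs (f ^~ x) k)).
  by move=> k; exact: measurable_fun_einfs.
by move=> x _; rewrite limn_einf_lim; exact: is_cvg_einfs.
Qed.

Lemma extended_local_estimate (s C : R) : 0 <= s -> 0 <= C ->
  (forall f : 'rV[R]_n -> R[i], schwartz f ->
    (\int[lebesgue_rV]_(x in unit_ball) msq phi (fourier f) x <=
     C%:E * weightsq s (fourier f))%E) ->
  exists2 K, 0 <= K & forall r h, 1 <= r -> bounded_supp r h ->
    (\int[lebesgue_rV]_(x in unit_ball) msq phi h x <=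
     (K * (r `^ s) ^+ 2)%:E * L2sq h)%E.
Proof.
move=> s0 C0 loc; have [A A0 hA] := @npdf_moment R n (Num.truncn s).+1.
exists (C * ((2 * n.+1%:R) `^ s * A)).
  by rewrite !mulr_ge0// powR_ge0.
move=> r h r1 hh; have ih := bounded_supp_cintegrable hh.
pose sigma (k : nat) : R := k.+1%:R^-1.
have sg k : 0 < sigma k <= 1.
  by rewrite invr_gt0 ltr0n /= invf_le1 ?ltr0n// ler1n.
have sg0 k : 0 < sigma k by have /andP[] := sg k.
have im k : cintegrable lebesgue_rV (mollify (sigma k) h).
  have [f sf <-] := mollify_fourier_schwartz hh (sg0 k).
  exact: cintegrable_fourier.
have mm k : measurable_fun setT (msq phi (mollify (sigma k) h)) by exact: measurable_msq.
have mu := measurable_unit_ball.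
have bnd k : (\int[lebesgue_rV]_(x in unit_ball) msq phi (mollify (sigma k) h) x <=
    (C * ((2 * n.+1%:R) `^ s * A) * (r `^ s) ^+ 2)%:E * L2sq h)%E.
  have [f sf fE] := mollify_fourier_schwartz hh (sg0 k).
  rewrite -fE; apply: (le_trans (loc f sf)); rewrite fE -mulrA EFinM -muleA.
  by apply: lee_wpmul2l; [rewrite lee_fin|exact: weightsq_mollify].
(* Lower semicontinuity of a supremum: each evolution at a fixed t is the limit of the mollified
   ones, each below its maximal function. *)
apply: (@le_trans _ _ (\int[lebesgue_rV]_(x in unit_ball)
    limn_einf (fun k => msq phi (mollify (sigma k) h) x))%E).
  apply: ge0_le_integral => //.
  - by move=> x _; exact: msq_ge0.
  - by apply: measurable_funTS; exact: measurable_msq.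
  - by apply: measurable_funTS; exact: measurable_limn_einf.
  - move=> x _; apply: msq_le => t t01.
    have c1 := cvg_sqr (cvg_cmod (evolution_mollify_cvg phi_cont hh t x)).
    have c2 : ((cmod (evolution phi t (mollify (sigma k) h) x)) ^+ 2)%:E @[k --> \oo] -->
        ((cmod (evolution phi t h x)) ^+ 2)%:E.
      by apply: cvg_EFin; [exact: nearW|exact: c1].
    have [<- _] := cvg_limn_einf_sup c2.
    by apply: le_limn_einf => k; exact: msq_ge.
apply: (le_trans (fatou _ mu _ _)).
- by move=> k; apply: measurable_funTS.
- by move=> k x _; exact: msq_ge0.
set c := (_ * L2sq h)%E in bnd *.
have [<- _] := @cvg_limn_einf_sup _ (cst c) c (cvg_cst _).
exact: le_limn_einf.
Qed.

Variable a : R.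
Hypothesis a_ge0 : 0 <= a.
Hypothesis phi_hom : forall (c : R) xi, 0 < c -> phi (c *: xi) = c `^ a * phi xi.

(** The datum whose evolution at x is, up to l^(-n) and a change of time, that of [h] at l x + y. *)
Definition modulate_dilate (l : R) y h eta : R[i] :=
  cexpi (rV_dot y (l^-1 *: eta)) * h (l^-1 *: eta).

Lemma bounded_supp_modulate_dilate (l r : R) y h : 0 < l -> bounded_supp r h ->
  bounded_supp (l * r) (modulate_dilate l y h).
Proof.
move=> l0 [mh [M hM] h0]; split.
- have md : measurable_fun setT (fun eta : 'rV[R]_n => l^-1 *: eta).
    have := @measurable_affine R n l^-1 0.
    by apply: eq_measurable_fun => x _; rewrite addr0.
  apply: cmeasM; last exact: cmeas_comp mh md.
  by apply: cmeas_cexpi; apply: measurable_rV_dot => //; exact: measurable_cst.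
- by exists M => x; rewrite cmodM cmod_cexpi mul1r.
- move=> x xr; rewrite /modulate_dilate h0 ?mulr0// => bx; apply: xr => i.
  have := bx i; rewrite mxE normrM gtr0_norm ?invr_gt0//.
  by rewrite mulrC ler_pdivrMr// mulrC.
Qed.

Lemma evolution_scale (l t r : R) x y h : 0 < l -> bounded_supp r h ->
  evolution phi t h (l *: x + y) =
  ((l^-1) ^+ n)%:C%C * evolution phi (t * (l^-1) `^ a) (modulate_dilate l y h) x.
Proof.
move=> l0 hh; have ih := bounded_supp_cintegrable hh.
have il : 0 < l^-1 by rewrite invr_gt0.
rewrite /evolution -[LHS](@cint_rV_affine _ _ l^-1 0)//; last exact: cintegrable_evolution.
congr (_ * _); apply: eq_cint => eta; rewrite addr0 /modulate_dilate mulrA -cexpiD.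
congr (cexpi _ * _); rewrite phi_hom// rV_dotDl rV_dotZl !rV_dotZr mulVKf ?gt_eqF//.
by ring.
Qed.

(** Homogeneity turns the time t into t l^(-a), which stays in (0, 1) because l >= 1 and a >= 0. It
    may fill only part of that interval, hence an inequality. *)
Lemma msq_scale (l r : R) x y h : 1 <= l -> bounded_supp r h ->
  (msq phi h (l *: x + y) <=
   (((l^-1) ^+ n) ^+ 2)%:E * msq phi (modulate_dilate l y h) x)%E.
Proof.
move=> l1 hh; have l0 : 0 < l by exact: lt_le_trans l1.
apply: msq_le => t /andP[t0 t1].
rewrite (evolution_scale _ _ _ l0 hh) cmodM cmod_real exprMn EFinM.
rewrite ger0_norm ?exprn_ge0 ?invr_ge0 ?(ltW l0)//.
apply: lee_wpmul2l; first by rewrite lee_fin sqr_ge0.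
apply: msq_ge; apply/andP; split.
  by rewrite mulr_gt0// powR_gt0// invr_gt0.
apply: le_lt_trans t1; rewrite ler_piMr ?(ltW t0)//.
suff : l^-1 `^ a <= 1 `^ a by rewrite powR1.
apply: ge0_ler_powR => //.
- by rewrite nnegrE invr_ge0 ltW.
- by rewrite nnegrE.
- by rewrite invf_le1.
Qed.

Lemma L2sq_modulate_dilate (l r : R) y h : 0 < l -> bounded_supp r h ->
  L2sq (modulate_dilate l y h) = ((l ^+ n)%:E * L2sq h)%E.
Proof.
move=> l0 [mh _ _]; have il : 0 < l^-1 by rewrite invr_gt0.
have E : L2sq (modulate_dilate l y h) =
    (\int[lebesgue_rV]_x ((cmod (h (l^-1 *: x + 0)%R)) ^+ 2)%:E)%E.
  apply: eq_integral => x _.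
  by rewrite /modulate_dilate cmodM cmod_cexpi mul1r addr0.
rewrite {2}/L2sq -(@ge0_integral_rV_affine _ _ l^-1 0)//.
- by rewrite muleA -EFinM -exprMn divff ?gt_eqF// expr1n mul1e.
- by apply/measurable_EFinP; apply: measurable_funX; exact: measurable_cmod.
- by move=> x; rewrite lee_fin sqr_ge0.
Qed.

Definition eball y (l : R) : set 'rV[R]_n := [set x | enorm (x - y) < l].

Lemma measurable_eball y (l : R) : measurable (eball y l).
Proof.
rewrite (_ : eball y l = (fun x => enorm (x - y)) @^-1` `]-oo, l[%classic).
  rewrite -[X in measurable X]setTI.
  apply: (measurableT_comp (@measurable_enorm R n)) => //.
  by apply: measurable_rVB => //; exact: measurable_cst.
by apply/seteqP; split => x /=; rewrite in_itv.
Qed.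

(** The powers of l cancel: l^n from the change of variables on the ball, l^(-2 n) from the squared
    evolution, l^n from the L^2 norm of the dilated datum. What remains is the larger frequency box,
    of size l r. *)
Lemma scaled_local_estimate (s K : R) : 0 <= K ->
  (forall r h, 1 <= r -> bounded_supp r h ->
    (\int[lebesgue_rV]_(x in unit_ball) msq phi h x <=
     (K * (r `^ s) ^+ 2)%:E * L2sq h)%E) ->
  forall (l r : R) y h, 1 <= l -> 1 <= l * r -> bounded_supp r h ->
    (\int[lebesgue_rV]_(x in eball y l) msq phi h x <=
     (K * ((l * r) `^ s) ^+ 2)%:E * L2sq h)%E.
Proof.
move=> K0 loc l r y h l1 lr1 hh; have l0 : 0 < l by exact: lt_le_trans l1.
have mh := bounded_supp_cintegrable hh.
have mD := measurable_eball y l.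
have mm := measurable_msq mphi mh.
have hd := bounded_supp_modulate_dilate y l0 hh.
have md := measurable_msq mphi (bounded_supp_cintegrable hd).
rewrite integral_mkcond -(@ge0_integral_rV_affine _ _ l y)//; last 2 first.
- by apply/(measurable_restrictT _ mD); exact: measurable_funTS.
- by move=> x; rewrite patchE; case: ifP => // _; exact: msq_ge0.
apply: (@le_trans _ _ ((l ^+ n)%:E * ((((l^-1) ^+ n) ^+ 2)%:E *
    \int[lebesgue_rV]_(x in unit_ball) msq phi (modulate_dilate l y h) x))%E).
  apply: lee_wpmul2l; first by rewrite lee_fin exprn_ge0// ltW.
  rewrite [in leRHS]integral_mkcond -ge0_integralZl//; last 3 first.
  - by apply/(measurable_restrictT _ measurable_unit_ball); exact: measurable_funTS.
  - by move=> x _; rewrite patchE; case: ifP => // _; exact: msq_ge0.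
  - by rewrite lee_fin sqr_ge0.
  apply: ge0_le_integral => //.
  - by move=> x _; rewrite patchE; case: ifP => // _; exact: msq_ge0.
  - apply: (@measurableT_comp _ _ _ _ _ _ (msq phi h \_ _)); last exact: measurable_affine.
    by apply/(measurable_restrictT _ mD); exact: measurable_funTS.
  - apply: measurable_funeM.
    by apply/(measurable_restrictT _ measurable_unit_ball); exact: measurable_funTS.
  - move=> x _; rewrite !patchE.
    have -> : (l *: x + y \in eball y l) = (x \in unit_ball).
      apply/idP/idP => /set_mem /= xl; apply/mem_set => /=; move: xl; rewrite /unit_ball /eball /=
        addrK /enorm rV_dotZl rV_dotZr mulrA -expr2 sqrtrM ?sqr_ge0// sqrtr_sqr gtr0_norm//.
        by rewrite gtr_pMr.
      by rewrite gtr_pMr.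
    case: ifPn => xu; first exact: (msq_scale _ _ l1 hh).
    by rewrite mule0.
apply: (@le_trans _ _ ((l ^+ n)%:E * ((((l^-1) ^+ n) ^+ 2)%:E *
    ((K * ((l * r) `^ s) ^+ 2)%:E * ((l ^+ n)%:E * L2sq h))))%E).
  apply: lee_wpmul2l; first by rewrite lee_fin exprn_ge0// ltW.
  apply: lee_wpmul2l; first by rewrite lee_fin sqr_ge0.
  by rewrite -(L2sq_modulate_dilate y l0 hh); exact: loc.
rewrite !muleA -!EFinM; apply: lee_wpmul2r; first exact: L2sq_ge0.
rewrite lee_fin le_eqVlt; apply/orP; left; apply/eqP.
rewrite exprVn; set L := l ^+ n; have L0 : L != 0 by rewrite expf_neq0// gt_eqF.
by field.
Qed.

End extension_and_scaling.

(** * Bessel's inequality for exponentials on a box *)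

Section bessel.
Context {R : realType}.

Lemma sin_intpi (m : int) : sin (m%:~R * pi) = 0 :> R.
Proof.
have H (k : nat) : sin (k%:R * pi) = 0 :> R.
  elim: k => [|k IH]; first by rewrite mul0r sin0.
  by rewrite -natr1 mulrDl mul1r sinDpi IH oppr0.
case: m => k; first exact: H.
by rewrite NegzE rmorphN mulNr sinN H oppr0.
Qed.

Definition cindic d (T : measurableType d) (A : set T) (x : T) : R[i] := (\1_A x : R)%:C%C.

Lemma cmeas_cindic d (T : measurableType d) (A : set T) : measurable A ->
  cmeas (cindic A).
Proof. by move=> mA; apply: cmeas_real; exact: measurable_indic. Qed.

Lemma cmod_cindic_le1 d (T : measurableType d) (A : set T) x : cmod (cindic A x) <= 1.
Proof. by rewrite cmod_real ger0_norm// indicE; case: (_ \in _). Qed.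

Notation leb := (@lebesgue_measure R).

Lemma Rintegral_indic_itv (q : R) (f : R -> R) :
  \int[leb]_v (\1_(`[- q, q]%classic : set R) v * f v) = \int[leb]_(v in `[- q, q]) f v.
Proof.
rewrite [RHS]Rintegral_mkcond; apply: eq_Rintegral => v _.
by rewrite patchE indicE; case: (_ \in _); rewrite ?mul1r ?mul0r.
Qed.

Lemma Rintegral_FTC (q : R) (f F : R -> R) : 0 < q -> continuous f ->
  (forall v : R, is_derive v 1 F (f v)) ->
  \int[leb]_(v in `[- q, q]) f v = F q - F (- q).
Proof.
move=> q0 cf dF.
have cF : continuous F.
  by move=> v; apply: differentiable_continuous; apply/derivable1_diffP; have [] := dF v.
rewrite /Rintegral (@continuous_FTC2 _ _ F)//.
- by rewrite ltrNl (lt_trans _ q0)// oppr_lt0.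
- exact: continuous_subspaceT.
- split.
  + by move=> v _; have [] := dF v.
  + by apply: cvg_at_right_filter; exact: cF.
  + by apply: cvg_at_left_filter; exact: cF.
- by move=> v _; rewrite derive1E; have [_ ->] := dF v.
Qed.

(** The primitives sin(b v)/b and -cos(b v)/b take equal values at both ends of [-q, q]. *)
Lemma cint_cexpi_itv (q b : R) : 0 < q -> b != 0 -> sin (b * q) = 0 ->
  cint leb (fun v => cindic (`[- q, q]%classic : set R) v * cexpi (b * v)) = 0.
Proof.
move=> q0 b0 sbq.
have cb (v : R) : {for v, continuous (fun v => b * v)}.
  by apply: continuousM => //; exact: cst_continuous.
have ccos : continuous (fun v => cos (b * v)).
  by move=> v; apply: continuous_comp; [exact: cb|exact: continuous_cos].
have csin : continuous (fun v => sin (b * v)).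
  by move=> v; apply: continuous_comp; [exact: cb|exact: continuous_sin].
have d1 (v : R) : is_derive v 1 (fun v => b^-1 * sin (b * v)) (cos (b * v)).
  by apply: is_derive_eq; rewrite /GRing.scale /=; field.
have d2 (v : R) : is_derive v 1 (fun v => - b^-1 * cos (b * v)) (sin (b * v)).
  by apply: is_derive_eq; rewrite /GRing.scale /=; field.
apply/eqP; rewrite eq_complex /=; apply/andP; split; apply/eqP.
  under eq_Rintegral do rewrite mul0r subr0.
  by rewrite Rintegral_indic_itv (Rintegral_FTC q0 ccos d1) mulrN sinN sbq oppr0 subrr.
under eq_Rintegral do rewrite mul0r addr0.
by rewrite Rintegral_indic_itv (Rintegral_FTC q0 csin d2) [b * - q]mulrN cosN subrr.
Qed.

Lemma cintegrable_cindic_cexpi (q b : R) :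
  cintegrable leb (fun v => cindic (`[- q, q]%classic : set R) v * cexpi (b * v)).
Proof.
under eq_fun do rewrite mulrC; apply: (@cintegrableMl _ _ _ _ _ _ 1).
- by apply: cmeas_cexpi; exact: measurable_funM.
- by move=> v; rewrite cmod_cexpi.
- by apply: cintegrable_real; exact: integrable_indic_itv.
Qed.

Context {n : nat}.
Variable q : R.
Hypothesis q_gt0 : 0 < q.

(** The dual lattice of the torus of period 2 q: its exponentials are orthogonal on the box of half
    side q. *)
Definition lattice (j : 'rV[int]_n) : 'rV[R]_n := \row_i (pi / q * (j 0 i)%:~R).

Definition character (j : 'rV[int]_n) (v : 'rV[R]_n) : R[i] := cexpi (- rV_dot (lattice j) v).

Definition bmode (j : 'rV[int]_n) (v : 'rV[R]_n) : R[i] :=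
  cindic (@box R n q) v * cexpi (rV_dot (lattice j) v).

Lemma cindic_boxE v : cindic (@box R n q) v =
  \prod_(i < n) cindic (`[- q, q]%classic : set R) (v 0 i).
Proof.
rewrite /cindic -rmorph_prod; congr (_%:C%C); rewrite indicE.
have [/set_mem bv|bv] := boolP (v \in box q).
  rewrite big1// => i _; rewrite indicE mem_set//=.
  by rewrite in_itv/= -ler_norml; exact: bv.
have [i bi] : exists i, ~ `|v 0 i| <= q.
  by apply/existsNP => h; move/negP: bv; apply; exact/mem_set.
rewrite (bigD1 i)//= indicE memNset ?mul0r//=.
by rewrite in_itv/= -ler_norml.
Qed.

Lemma character_bmodeE j k v : character k v * bmode j v =
  \prod_(i < n) (cindic (`[- q, q]%classic : set R) (v 0 i) *
    cexpi (pi / q * (j 0 i - k 0 i)%:~R * v 0 i)).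
Proof.
rewrite big_split/= -cexpi_sum -cindic_boxE /character /bmode mulrCA -cexpiD.
congr (_ * cexpi _); rewrite addrC /rV_dot -sumrB; apply: eq_bigr => i _.
by rewrite !mxE rmorphB /=; ring.
Qed.

Lemma cint_character_bmode j k : j != k ->
  cint lebesgue_rV (fun v => character k v * bmode j v) = 0.
Proof.
move=> jk; under eq_cint do rewrite character_bmodeE.
have [_ ->] := cintegrable_cint_prod (fun i : 'I_n =>
  cintegrable_cindic_cexpi q (pi / q * (j 0 i - k 0 i)%:~R)).
have [i ji] : exists i, j 0 i != k 0 i.
  apply/existsP; apply: contraR jk => /existsPn h; apply/eqP/rowP => i.
  by have := h i; rewrite negbK => /eqP.
rewrite (bigD1 i)//= cint_cexpi_itv ?mul0r//.
  apply: mulf_neq0; first by rewrite mulf_neq0 ?invr_eq0 ?gt_eqF ?pi_gt0.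
  by rewrite intr_eq0 subr_eq0.
rewrite (_ : _ * q = (j 0 i - k 0 i)%:~R * pi) ?sin_intpi//.
by field; rewrite gt_eqF.
Qed.

Lemma cmeas_character_lattice j : cmeas (character j).
Proof.
apply: cmeas_cexpi; apply: measurableT_comp => //.
by apply: measurable_rV_dot => //; exact: measurable_cst.
Qed.

Lemma cmeas_bmode j : cmeas (bmode j).
Proof.
apply: cmeasM; first by apply: cmeas_cindic; exact: measurable_box.
by apply: cmeas_cexpi; apply: measurable_rV_dot => //; exact: measurable_cst.
Qed.

Lemma bounded_supp_bmode j : bounded_supp q (bmode j).
Proof.
split; first exact: cmeas_bmode.
  by exists 1 => v; rewrite cmodM cmod_cexpi mulr1 cmod_cindic_le1.
by move=> v bv; rewrite /bmode /cindic indicE memNset// mul0r.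
Qed.

Definition Rsq (u : 'rV[R]_n -> R[i]) : R := \int[lebesgue_rV]_v (cmod (u v) ^+ 2).

Definition boxvol : R := (2 * q) ^+ n.

Lemma boxvol_gt0 : 0 < boxvol. Proof. by rewrite exprn_gt0// mulr_gt0. Qed.

Lemma lebesgue_boxE : lebesgue_rV (@box R n q) = boxvol%:E.
Proof.
rewrite boxE (@lebesgue_rV_box _ _ (fun=> `[- q, q]%classic)); last first.
  by move=> i; exact: measurable_itv.
rewrite (eq_bigr (fun=> (2 * q)%:E)); last first.
  move=> i _; rewrite lebesgue_measure_itv/= lte_fin ifT; last first.
    by rewrite ltrNl (lt_trans _ q_gt0)// oppr_lt0.
  by rewrite -EFinD; congr EFin; ring.
by rewrite prodEFin prodr_const card_ord.
Qed.

Lemma Rsq_bmode j : Rsq (bmode j) = boxvol.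
Proof.
rewrite /Rsq (_ : (fun _ => _) = (\1_(@box R n q) : _ -> R)); last first.
  apply/funext => v; rewrite cmodM cmod_cexpi mulr1 cmod_real ger0_norm// indicE.
  by case: (_ \in _); rewrite ?expr1n ?expr0n.
rewrite /Rintegral integral_indic//; last exact: measurable_box.
by rewrite setIT; exact: (congr1 fine lebesgue_boxE).
Qed.

Lemma cmod_sqrB (z b c : R[i]) : cmod (z - c * b) ^+ 2 =
  cmod z ^+ 2 - 2 * Re (conjc c * (conjc b * z)) + cmod c ^+ 2 * cmod b ^+ 2.
Proof. by case: z => z1 z2; case: b => b1 b2; case: c => c1 c2; rewrite !sqr_cmod /=; ring. Qed.

Lemma conjc_cexpi (t : R) : conjc (cexpi t) = cexpi (- t) :> R[i].
Proof. by rewrite /cexpi cosN sinN. Qed.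

Lemma conjcM (z w : R[i]) : conjc (z * w) = conjc z * conjc w.
Proof.
case: z => a b; case: w => c e; apply/eqP; rewrite eq_complex /=.
by apply/andP; split; apply/eqP; ring.
Qed.

Lemma conj_bmode j u v : bounded_supp q u -> conjc (bmode j v) * u v = character j v * u v.
Proof.
move=> [_ _ u0]; rewrite /bmode conjcM conjc_cexpi.
have [bv|bv] := pselect (box q v); last by rewrite u0// !mulr0.
by rewrite /cindic indicE mem_set// conjc_real rmorph1 mul1r.
Qed.

Definition coefficient (u : 'rV[R]_n -> R[i]) j : R[i] :=
  cint lebesgue_rV (fun v => character j v * u v).

Lemma cintegrable_coefficient u j : bounded_supp q u ->
  cintegrable lebesgue_rV (fun v => character j v * u v).
Proof.
move=> hu; apply: (@cintegrableMl _ _ _ _ _ _ 1).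
- exact: cmeas_character_lattice.
- by move=> v; rewrite cmod_cexpi.
- exact: bounded_supp_cintegrable hu.
Qed.

Definition remove_mode u j v : R[i] := u v - coefficient u j / boxvol%:C%C * bmode j v.

Lemma bounded_supp_remove_mode u j : bounded_supp q u -> bounded_supp q (remove_mode u j).
Proof.
move=> [mu [M hM] u0]; have [mb [B hB] b0] := bounded_supp_bmode j; split.
- by apply: cmeasB => //; apply: cmeasM => //; exact: cmeas_cst.
- exists (M + cmod (coefficient u j / boxvol%:C%C) * B) => v.
  rewrite (le_trans (le_cmodD _ _))// cmodN lerD// cmodM.
  by rewrite ler_wpM2l ?cmod_ge0.
- by move=> v bv; rewrite /remove_mode u0// b0// mulr0 subr0.
Qed.

Lemma coefficient_remove_mode u j k : bounded_supp q u -> j != k ->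
  coefficient (remove_mode u j) k = coefficient u k.
Proof.
move=> hu jk; have iu := cintegrable_coefficient k hu.
have ib := cintegrable_coefficient k (bounded_supp_bmode j).
transitivity (cint lebesgue_rV (fun v => character k v * u v -
    coefficient u j / boxvol%:C%C * (character k v * bmode j v))).
  by apply: eq_cint => v; rewrite /remove_mode; ring.
rewrite cintB//; last exact: cintegrableZ.
by rewrite cintZ// cint_character_bmode// mulr0 subr0.
Qed.

(** Pythagoras for the orthogonal projection onto one mode. *)
Lemma Rsq_remove_mode u j : bounded_supp q u ->
  Rsq (remove_mode u j) = Rsq u - cmod (coefficient u j) ^+ 2 / boxvol.
Proof.
move=> hu; set c := coefficient u j; pose a := c / boxvol%:C%C.
have V0 := boxvol_gt0.
have iu := cintegrable_coefficient j hu.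
have i1 := bounded_supp_sqr hu; have i2 := bounded_supp_sqr (bounded_supp_bmode j).
have i3 := cintegrable_Re (cintegrableZ (conjc a) iu).
have -> : Rsq (remove_mode u j) = \int[lebesgue_rV]_v ((cmod (u v) ^+ 2 +
    - 2 * Re (conjc a * (character j v * u v))) + cmod a ^+ 2 * cmod (bmode j v) ^+ 2).
  by apply: eq_Rintegral => v _; rewrite cmod_sqrB conj_bmode// mulNr.
rewrite RintegralD//; last 2 first.
- by apply: integrableD_EFin => //; exact: integrableZl_EFin.
- exact: integrableZl_EFin.
rewrite RintegralD//; last exact: integrableZl_EFin.
rewrite !RintegralZl// -/(Rsq u) -/(Rsq (bmode j)) Rsq_bmode.
have -> : \int[lebesgue_rV]_v Re (conjc a * (character j v * u v)) =
    cmod c ^+ 2 / boxvol.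
  transitivity (Re (cint lebesgue_rV (fun v => conjc a * (character j v * u v)))) => //.
  rewrite cintZ// -/(coefficient u j) -/c /a sqr_cmod.
  rewrite -(fmorphV (real_complex R)) /=.
  by case: (c) => c1 c2 /=; ring.
rewrite /a cmodM -(fmorphV (real_complex R)) cmod_real ger0_norm ?invr_ge0 1?ltW//.
by field; rewrite gt_eqF.
Qed.

(** Induction on the list: removing one mode lowers the squared norm by its share and, by
    orthogonality, leaves the other coefficients unchanged. *)
Lemma bessel u (J : seq 'rV[int]_n) : uniq J -> bounded_supp q u ->
  \sum_(j <- J) cmod (coefficient u j) ^+ 2 <= boxvol * Rsq u.
Proof.
elim: J u => [|j J IH] u.
  move=> _ _; rewrite big_nil mulr_ge0 ?(ltW boxvol_gt0)//.
  by apply: Rintegral_ge0 => v _; rewrite sqr_ge0.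
move=> /= /andP[jJ uJ] hu; rewrite big_cons.
have := IH _ uJ (bounded_supp_remove_mode j hu).
rewrite Rsq_remove_mode// mulrBr mulrCA divff ?gt_eqF ?boxvol_gt0// mulr1.
rewrite lerBrDl; congr (_ + _ <= _); rewrite !big_seq; apply: eq_bigr => k kJ.
rewrite coefficient_remove_mode//.
by apply: contraNneq jJ => ->.
Qed.

End bessel.

(** * Partial sums of the exponential series, and a weighted Cauchy-Schwarz inequality *)

Section truncated_exponential.
Context {R : realType}.

Definition texp (L : nat) (r : R) : R[i] :=
  \sum_(l < L) ((l`!)%:R^-1)%:C%C * Complex 0 r ^+ l.

Lemma Complex_expr (r : R) (l : nat) :
  ((l`!)%:R^-1)%:C%C * Complex 0 r ^+ l = Complex (cos_coeff r l) (sin_coeff r l).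
Proof.
have H m : Complex 0 r ^+ m.*2 = ((-1) ^+ m * r ^+ m.*2)%:C%C /\
    Complex 0 r ^+ m.*2.+1 = Complex 0 ((-1) ^+ m * r ^+ m.*2.+1).
  elim: m => [|m [IH1 IH2]]; first by rewrite !mul1r !expr0 !expr1.
  have E : Complex 0 r ^+ m.+1.*2 = ((-1) ^+ m.+1 * r ^+ m.+1.*2)%:C%C.
    rewrite doubleS [LHS]exprSr IH2; apply/eqP; rewrite eq_complex /=.
    by apply/andP; split; apply/eqP; rewrite ?exprSr; ring.
  split=> //; rewrite [LHS]exprSr E; apply/eqP; rewrite eq_complex /=.
  by apply/andP; split; apply/eqP; rewrite ?exprSr; ring.
have [E1 E2] := H l./2; rewrite /cos_coeff /sin_coeff /=.
apply/eqP; rewrite eq_complex; rewrite -[in X in Re X](odd_double_half l).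
rewrite -[in X in _ && (Im X == _)](odd_double_half l).
case: (boolP (odd l)) => ol.
  have lE : l = (l./2.*2).+1 by rewrite -{1}(odd_double_half l) ol.
  rewrite add1n E2 /= -lE.
  have -> : l.-1./2 = l./2 by rewrite {1}lE /= doubleK.
  by apply/andP; split; apply/eqP; ring.
have lE : l = l./2.*2 by rewrite -{1}(odd_double_half l) (negbTE ol).
rewrite add0n E1 /= -lE -exprnP.
by apply/andP; split; apply/eqP; ring.
Qed.

Lemma texpE L r : texp L r = Complex (series (cos_coeff r) L) (series (sin_coeff r) L).
Proof.
rewrite /texp /series /= !big_mkord; elim: L => [|L IH]; first by rewrite !big_ord0.
by rewrite !big_ord_recr /= IH Complex_expr.
Qed.

Lemma texp_cvg r : cmod (texp L r - cexpi r) @[L --> \oo] --> (0 : R).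
Proof.
have hc : series (cos_coeff r) @ \oo --> cos r.
  by rewrite unlock; exact: is_cvg_series_cos_coeff.
have hs : series (sin_coeff r) @ \oo --> sin r.
  by rewrite unlock; exact: is_cvg_series_sin_coeff.
have h : `|series (cos_coeff r) L - cos r| + `|series (sin_coeff r) L - sin r|
    @[L --> \oo] --> (0 : R).
  by rewrite -[X in _ --> X]addr0; apply: cvgD; apply/norm_cvg0P/subr_cvg0.
apply: (squeeze_cvgr _ (cvg_cst 0) h); apply: nearW => L.
by rewrite cmod_ge0 /= texpE cmod_le_ReIm.
Qed.

Lemma exp_series_le L (r : R) : 0 <= r -> \sum_(l < L) (l`!)%:R^-1 * r ^+ l <= expR r.
Proof.
move=> r0; have hc : series (exp_coeff r) @ \oo --> expR r.
  exact: (is_cvg_series_exp_coeff r).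
apply: (cvgr_to_ge hc); near=> K.
have LK : (L <= K)%N by near: K; exact: nbhs_infty_ge.
rewrite /series /= (big_cat_nat (leq0n L) LK)/= big_mkord.
rewrite (eq_bigr (fun l : 'I_L => exp_coeff r l)); last by move=> l _; rewrite /exp_coeff /= mulrC.
by rewrite lerDl sumr_ge0// => l _; exact: exp_coeff_ge0.
Unshelve. all: by end_near. Qed.

Lemma cmod_texp_le L (r B : R) : `|r| <= B -> cmod (texp L r) <= expR B.
Proof.
move=> rB; have B0 : 0 <= B by exact: le_trans rB.
apply: le_trans (exp_series_le L B0); rewrite /texp (le_trans (cmod_sum _ _ _))//.
apply: ler_sum => l _; rewrite cmodM cmod_real cmodX ger0_norm//.
have -> : cmod (Complex 0 r) = `|r| by rewrite cmodE /= expr0n add0r sqrtr_sqr.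
by rewrite ler_wpM2l// lerXn2r// nnegrE.
Qed.

(** The total weight enters through a bound [W], so that the constant need not depend on L when L
    tends to infinity. *)
Lemma cauchy_schwarz_sum (L : nat) (w b : nat -> R) (W : R) : (forall l, 0 <= w l) ->
  \sum_(l < L) w l <= W ->
  (\sum_(l < L) w l * b l) ^+ 2 <= W * \sum_(l < L) w l * b l ^+ 2.
Proof.
move=> w0 wW; apply: (@le_trans _ _ ((\sum_(l < L) w l) * \sum_(l < L) w l * b l ^+ 2)).
  elim: L {wW} => [|L IH]; first by rewrite !big_ord0 expr0n mul0r.
  rewrite !big_ord_recr /=.
  set S0 := \sum_(l < L) w l in IH *; set S1 := \sum_(l < L) w l * b l in IH *.
  set S2 := \sum_(l < L) w l * b l ^+ 2 in IH *.
  (* The cross terms created by the new index are controlled by the nonnegative sum of w_l (b_l -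
     b_L)^2. *)
  have h : 2 * S1 * b L <= S2 + S0 * b L ^+ 2.
    have : 0 <= \sum_(l < L) w l * (b l - b L) ^+ 2.
      by apply: sumr_ge0 => l _; rewrite mulr_ge0// sqr_ge0.
    have -> : \sum_(l < L) w l * (b l - b L) ^+ 2 = S2 - 2 * S1 * b L + S0 * b L ^+ 2.
      rewrite /S0 /S1 /S2 mulr_suml mulr_sumr mulr_suml -sumrB -big_split/=.
      by apply: eq_bigr => l _; ring.
    by lra.
  have := ler_wpM2l (w0 L) h; nra.
rewrite ler_wpM2r// sumr_ge0// => l _; by rewrite mulr_ge0// sqr_ge0.
Qed.

End truncated_exponential.

Lemma cmeas_section d1 d2 (T1 : measurableType d1) (T2 : measurableType d2) (R : realType)
    (F : T1 * T2 -> R[i]) x : cmeas F -> cmeas (fun y => F (x, y)).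
Proof. by move=> mF; apply: (cmeas_comp mF); exact: pair1_measurable. Qed.

(** * Localization near a lattice point as an average of frequency shifts *)

Section localization.
Context {R : realType} {n : nat}.
Implicit Types (x y xi v : 'rV[R]_n) (e : R -> R[i]) (j : 'rV[int]_n).
Variable phi : 'rV[R]_n -> R.
Hypothesis phi_cont : continuous phi.

Let mphi : measurable_fun setT phi.
Proof. exact: continuous_measurable_rV. Qed.

(* N bounds the frequencies of h, p the size of the frequency shifts, q the
   half period of the characters, B the oscillation of phi under the shifts,
   and M the size of h. *)
Variables (N p q B M : R) (h : 'rV[R]_n -> R[i]).
Hypotheses (p_gt0 : 0 < p) (pq : p <= q) (pN : p <= N).
Hypothesis mh : cmeas h.
Hypothesis hM : forall x, cmod (h x) <= M.
Hypothesis h0 : forall x, ~ box N x -> h x = 0.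
Hypothesis osc : forall xi v, box p v -> box N (xi - v) -> `|phi (xi - v) - phi xi| <= B.

(** The functions of the phase increment in use are e^(i t r), its truncated series and (i r)^l. By
    [osc], the increments that matter lie in [-B, B]. *)
Definition good e (K : R) := cmeas e /\ forall r, `|r| <= B -> cmod (e r) <= K.

Definition shifted e xi v : R[i] :=
  cindic (@box R n p) v * (e (phi (xi - v) - phi xi) * h (xi - v)).

(** For fixed xi the values over all lattice points j are Fourier coefficients of one function of v;
    this is what makes Bessel applicable. *)
Definition localized e j xi : R[i] := coefficient q (shifted e xi) j.

Let box_sub (r s : R) v : r <= s -> box r v -> box s v.
Proof. by move=> rs bv i; rewrite (le_trans (bv i)). Qed.

Lemma box_shift xi v : box p v -> box N (xi - v) -> box (N + p) xi.
Proof.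
move=> bv bx i; have := bx i; have := bv i; rewrite !mxE => h1 h2.
by rewrite -(subrK (v 0 i) (xi 0 i)) (le_trans (ler_normD _ _))// lerD.
Qed.

Lemma cmod_shifted e K xi v : good e K -> 0 <= K ->
  cmod (shifted e xi v) <= K * cmod (cindic (@box R n p) v * h (xi - v)).
Proof.
move=> [_ eK] K0; rewrite /shifted !cmodM.
have [bv|bv] := pselect (box p v); last first.
  by rewrite /cindic indicE memNset// cmod_real normr0 !mul0r mulr0.
have [bx|bx] := pselect (box N (xi - v)); last by rewrite h0// cmod0 !mulr0.
by rewrite mulrCA ler_wpM2r ?mulr_ge0 ?cmod_ge0// eK// osc.
Qed.

Let M0 : 0 <= M. Proof. exact: le_trans (cmod_ge0 (h 0)) (hM 0). Qed.

Lemma cmod_cindic_shift xi v : cmod (cindic (@box R n p) v * h (xi - v)) <=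
  M * \1_(@box R n (N + p)) xi * \1_(@box R n p) v.
Proof.
rewrite cmodM cmod_real ger0_norm// [leRHS]mulrC.
rewrite [\1_(@box R n p) v]indicE; case: (boolP (v \in box p)) => [/set_mem bv|_]; last by rewrite !mul0r.
rewrite !mul1r; have [bx|bx] := pselect (box N (xi - v)).
  by rewrite indicE mem_set ?mulr1//; exact: box_shift bx.
by rewrite h0// cmod0 mulr_ge0.
Qed.

Lemma cmeas_shifted2 e : cmeas e ->
  cmeas (fun z : 'rV[R]_n * 'rV[R]_n => shifted e z.1 z.2).
Proof.
move=> me; have m1 : measurable_fun setT (fun z : 'rV[R]_n * 'rV[R]_n => z.1 - z.2).
  exact: measurable_rVB.
apply: cmeasM.
  by apply: (cmeas_comp _ measurable_snd); apply: cmeas_cindic; exact: measurable_box.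
apply: cmeasM; last exact: cmeas_comp mh m1.
apply: (cmeas_comp me); apply: measurable_funB; first exact: (measurableT_comp mphi m1).
exact: (measurableT_comp mphi measurable_fst).
Qed.

Lemma cmeas_shifted e xi : cmeas e -> cmeas (shifted e xi).
Proof. by move=> me; exact: (cmeas_section xi (cmeas_shifted2 me)). Qed.

Lemma cmod_shifted_le e K xi v : good e K -> 0 <= K ->
  cmod (shifted e xi v) <= K * (M * \1_(@box R n (N + p)) xi * \1_(@box R n p) v).
Proof.
move=> ge K0; apply: (le_trans (cmod_shifted _ _ ge K0)).
by rewrite ler_wpM2l// cmod_cindic_shift.
Qed.

Lemma bounded_supp_shifted e K xi : good e K -> 0 <= K -> bounded_supp q (shifted e xi).
Proof.
move=> ge K0; split.
- by apply: cmeas_shifted; case: ge.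
- exists (K * M) => w; apply: (le_trans (cmod_shifted_le _ _ ge K0)).
  by rewrite ler_wpM2l// -mulrA ler_piMr// mulr_ile1.
- move=> v bv; rewrite /shifted /cindic indicE memNset ?mul0r//.
  by move=> bp; apply: bv; exact: box_sub bp.
Qed.

Lemma cmod_localized e K j xi : good e K -> 0 <= K ->
  cmod (localized e j xi) <=
  K * M * (\int[lebesgue_rV]_v \1_(@box R n p) v) * \1_(@box R n (N + p)) xi.
Proof.
move=> ge K0; have hs := bounded_supp_shifted xi ge K0.
have ic := cintegrable_coefficient j hs.
apply: (le_trans (cmod_cint_Rintegral ic)).
rewrite [leRHS]mulrAC -RintegralZl//; last exact: integrable_box.
apply: le_Rintegral => //.
- exact: cintegrable_cmod.
- exact: integrableZl_EFin (integrable_box p).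
- move=> v _; rewrite cmodM cmod_cexpi mul1r.
  by apply: (le_trans (cmod_shifted_le _ _ ge K0)); rewrite !mulrA.
Qed.

Lemma cmeas_localized e j : cmeas e -> cmeas (localized e j).
Proof.
move=> me; apply: (@cmeas_cint2 _ _ _ _ _ lebesgue_rV
  (fun z : 'rV[R]_n * 'rV[R]_n => character q j z.2 * shifted e z.1 z.2)).
apply: cmeasM (cmeas_shifted2 me).
by apply: (cmeas_comp _ measurable_snd); exact: cmeas_character_lattice.
Qed.

Lemma bounded_supp_localized e K j : good e K -> 0 <= K ->
  bounded_supp (N + p) (localized e j).
Proof.
move=> ge K0; have I0 : 0 <= \int[lebesgue_rV]_v \1_(@box R n p) v.
  by apply: Rintegral_ge0.
split.
- by apply: cmeas_localized; case: ge.
- exists (K * M * \int[lebesgue_rV]_v \1_(@box R n p) v) => xi.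
  by apply: (le_trans (cmod_localized _ _ ge K0)); rewrite ler_piMr ?mulr_ge0.
- move=> xi bx; apply: Normc.eq0_normc; apply/eqP; rewrite eq_le (cmod_ge0 (localized e j xi)) andbT.
  by apply: (le_trans (cmod_localized _ _ ge K0)); rewrite indicE memNset// mulr0.
Qed.

(** Dominated convergence twice, in v and then in xi; the common bound [K] of the [e_ L] provides
    both majorants. *)
Lemma evolution_localized_cvg (e_ : nat -> R -> R[i]) e K j t x : 0 <= K ->
  (forall L, good (e_ L) K) -> good e K ->
  (forall r, cmod (e_ L r - e r) @[L --> \oo] --> (0 : R)) ->
  cmod (evolution phi t (localized (e_ L) j) x - evolution phi t (localized e j) x)
    @[L --> \oo] --> (0 : R).
Proof.
move=> K0 ge_ ge ee.
pose I1 := \int[lebesgue_rV]_v (\1_(@box R n p) v : R).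
apply: (@cint_dominated _ _ _ _ _ _ (fun xi => K * M * I1 * \1_(@box R n (N + p)) xi)).
- move=> L; apply: cmeasM; first exact: cmeas_evolution_kernel.
  by apply: cmeas_localized; case: (ge_ L).
- apply: cmeasM; first exact: cmeas_evolution_kernel.
  by apply: cmeas_localized; case: ge.
- exact: integrableZl_EFin (integrable_box _).
- by move=> L xi; rewrite cmodM cmod_cexpi mul1r; exact: cmod_localized.
move=> xi.
have : cmod (localized (e_ L) j xi - localized e j xi) @[L --> \oo] --> (0 : R).
  apply: (@cint_dominated _ _ _ _ _ _
    (fun v => K * M * \1_(@box R n (N + p)) xi * \1_(@box R n p) v)).
  - move=> L; apply: cmeasM; first exact: cmeas_character_lattice.
    by apply: cmeas_shifted; case: (ge_ L).
  - apply: cmeasM; first exact: cmeas_character_lattice.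
    by apply: cmeas_shifted; case: ge.
  - exact: integrableZl_EFin (integrable_box _).
  - move=> L v; rewrite cmodM cmod_cexpi mul1r.
    by apply: (le_trans (cmod_shifted_le _ _ (ge_ L) K0)); rewrite !mulrA.
  - move=> v.
    have h1 := cvg_cmod_scale (character q j v * cindic (@box R n p) v * h (xi - v))
      (ee (phi (xi - v) - phi xi)).
    apply: cvg_trans h1; apply: near_eq_cvg; apply: nearW => L.
    by congr cmod; rewrite /shifted; ring.
move=> h1; have h2 := cvg_cmod_scale (cexpi (rV_dot x xi + t * phi xi)) h1.
apply: cvg_trans h2; apply: near_eq_cvg; apply: nearW => L.
by congr cmod; ring.
Qed.

(** The product of the functions 2 sin(p z_i)/z_i. *)
Definition dirichlet (z : 'rV[R]_n) : R[i] :=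
  cint lebesgue_rV (fun v => cindic (@box R n p) v * cexpi (rV_dot z v)).

Lemma good_cexpi t : good (fun r => cexpi (t * r)) 1.
Proof.
split; last by move=> r _; rewrite cmod_cexpi.
by apply: cmeas_cexpi; exact: measurable_funM.
Qed.

(* Multiplying the evolution by a function whose Fourier transform lives on
   the box of size p amounts to averaging frequency shifts of the datum. *)
Lemma dirichlet_evolution j t x :
  dirichlet (x - lattice q j) * evolution phi t h x =
  evolution phi t (localized (fun r => cexpi (t * r)) j) x.
Proof.
have ih : cintegrable lebesgue_rV h.
  by apply: (@bounded_supp_cintegrable _ _ N); split => //; exists M.
have ge := good_cexpi t.
pose G (z : 'rV[R]_n * 'rV[R]_n) : R[i] := cexpi (rV_dot x z.1 + t * phi z.1) *
  (character q j z.2 * shifted (fun r => cexpi (t * r)) z.1 z.2).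
have mG : cmeas G.
  apply: cmeasM; first exact: (cmeas_comp (cmeas_evolution_kernel t x mphi) measurable_fst).
  apply: cmeasM; last by apply: cmeas_shifted2; case: ge.
  by apply: (cmeas_comp _ measurable_snd); exact: cmeas_character_lattice.
pose A v := cindic (@box R n p) v * cexpi (rV_dot (x - lattice q j) v).
have mA : cmeas A.
  apply: cmeasM; first by apply: cmeas_cindic; exact: measurable_box.
  by apply: cmeas_cexpi; apply: measurable_rV_dot => //; exact: measurable_cst.
have iA : cintegrable lebesgue_rV A.
  apply: (le_cintegrable mA (integrable_box p)) => v.
  by rewrite cmodM cmod_cexpi mulr1 cmod_real ger0_norm.
have iU := cintegrable_evolution t x mphi ih.
have AG v xi : A v * (cexpi (rV_dot x (xi + - v) + t * phi (xi + - v)) * h (xi + - v)) = G (xi, v).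
  rewrite /G /A /shifted /character /=.
  have -> : cexpi (rV_dot x (xi - v) + t * phi (xi - v)) =
      cexpi (rV_dot x xi + t * phi xi) * cexpi (- rV_dot x v) *
      cexpi (t * (phi (xi - v) - phi xi)).
    by rewrite -!cexpiD rV_dotDr rV_dotNr; congr cexpi; ring.
  have -> : cexpi (rV_dot (x - lattice q j) v) =
      cexpi (rV_dot x v) * cexpi (- rV_dot (lattice q j) v).
    by rewrite -cexpiD rV_dotDl; congr (cexpi (_ + _)); rewrite -scaleN1r rV_dotZl mulN1r.
  have E : cexpi (rV_dot x v) * cexpi (- rV_dot x v) = 1 :> R[i].
    by rewrite -cexpiD subrr cexpi0.
  rewrite -[RHS]mul1r -E; ring.
have iG2 v : cintegrable lebesgue_rV (fun xi => G (xi, v)).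
  have := @cintegrable_rV_affine _ _ 1 (- v) _ ltr01 iU.
  move=> /(cintegrableZ (A v)); congr cintegrable; apply/funext => xi.
  by rewrite scale1r AG.
transitivity (cint lebesgue_rV (fun v => cint lebesgue_rV (fun xi => G (xi, v)))).
  rewrite mulrC -cintZ//; apply: eq_cint => v; rewrite mulrC -cintZ//.
  rewrite -(@cint_rV_translate _ _ (- v)); last exact: cintegrableZ.
  by apply: eq_cint => xi; rewrite AG.
have iG1 xi : cintegrable lebesgue_rV (fun v => G (xi, v)).
  exact: (cintegrableZ (cexpi (rV_dot x xi + t * phi xi))
    (cintegrable_coefficient j (bounded_supp_shifted xi ge ler01))).
rewrite -cint_fubini//.
  apply: eq_cint => xi.
  exact: (cintZ (cexpi (rV_dot x xi + t * phi xi))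
    (cintegrable_coefficient j (bounded_supp_shifted xi ge ler01))).
apply: (cintegrable_prod_le (u := fun xi => M * \1_(@box R n (N + p)) xi)
    (v := (\1_(@box R n p) : _ -> R))) => //.
- exact: integrableZl_EFin (integrable_box _).
- exact: integrable_box.
- by move=> xi; rewrite mulr_ge0.
- move=> xi v; rewrite /G 2!(cmodM (cexpi _)) !cmod_cexpi !mul1r.
  by have := cmod_shifted_le xi v ge ler01; rewrite mul1r.
Qed.

(** The real part suffices: on the box the cosine is taken in [-1, 1], where it is at least cos 1 >
    0. *)
Lemma dirichlet_lower (z : 'rV[R]_n) : (forall v, box p v -> `|rV_dot z v| <= 1) ->
  (2 * p) ^+ n * cos 1 <= cmod (dirichlet z).
Proof.
move=> zp; apply: (@le_trans _ _ (Re (dirichlet z))); last first.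
  by rewrite (le_trans (ler_norm _))// normr_Re_le.
have -> : (2 * p) ^+ n * cos 1 = \int[lebesgue_rV]_v (cos 1 * \1_(@box R n p) v).
  rewrite RintegralZl//; last exact: integrable_box.
  rewrite /Rintegral integral_indic//; last exact: measurable_box.
  by rewrite setIT mulrC; congr (_ * _); exact: (esym (congr1 fine (lebesgue_boxE p_gt0))).
have mA : cmeas (fun v => cindic (@box R n p) v * cexpi (rV_dot z v)).
  apply: cmeasM; first by apply: cmeas_cindic; exact: measurable_box.
  by apply: cmeas_cexpi; apply: measurable_rV_dot => //; exact: measurable_cst.
have iA : cintegrable lebesgue_rV (fun v => cindic (@box R n p) v * cexpi (rV_dot z v)).
  apply: (le_cintegrable mA (integrable_box p)) => v.
  by rewrite cmodM cmod_cexpi mulr1 cmod_real ger0_norm.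
apply: le_Rintegral => //.
- exact: integrableZl_EFin (integrable_box _).
- exact: cintegrable_Re.
move=> v _; rewrite ReM /= mul0r subr0 indicE.
have [/set_mem bv|_] := boolP (v \in box p); last by rewrite mulr0 mul0r.
rewrite mulr1 mul1r -(cos_norm (rV_dot z v)).
have pi1 : 1 <= pi :> R by rewrite (le_trans _ (pi_ge2 R))// ler1n.
have z1 := zp v bv.
rewrite leNgt ltr_cos ?in_itv/= ?ler01 ?normr_ge0 ?(le_trans z1 pi1)//.
by rewrite -leNgt.
Qed.

End localization.

(** * Bounds for the localized pieces, pointwise in x and summed over the lattice *)

Section localized_bounds.
Context {R : realType} {n : nat}.
Implicit Types (x y xi v : 'rV[R]_n) (j : 'rV[int]_n).
Variable phi : 'rV[R]_n -> R.
Hypothesis phi_cont : continuous phi.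

Let mphi : measurable_fun setT phi.
Proof. exact: continuous_measurable_rV. Qed.

Variables (N p q B M : R) (h : 'rV[R]_n -> R[i]).
Hypotheses (p_gt0 : 0 < p) (pq : p <= q) (B_ge0 : 0 <= B).
Hypothesis mh : cmeas h.
Hypothesis hM : forall x, cmod (h x) <= M.
Hypothesis h0 : forall x, ~ box N x -> h x = 0.
Hypothesis osc : forall xi v, box p v -> box N (xi - v) -> `|phi (xi - v) - phi xi| <= B.

Let supp_shifted (e : R -> R[i]) (K : R) xi (ge : good B e K) (K0 : 0 <= K) :=
  bounded_supp_shifted phi_cont pq mh hM h0 osc xi ge K0.

Let supp_localized (e : R -> R[i]) (K : R) j (ge : good B e K) (K0 : 0 <= K) :=
  bounded_supp_localized phi_cont pq mh hM h0 osc j ge K0.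

Definition ipow (l : nat) (r : R) : R[i] := Complex 0 r ^+ l.

Lemma cmod_Complex0 (r : R) : cmod (Complex 0 r) = `|r|.
Proof. by rewrite cmodE /= expr0n add0r sqrtr_sqr. Qed.

Lemma cmeas_ipow l : cmeas (ipow l).
Proof. by apply: cmeasX; split => /=; [exact: measurable_cst|exact: measurable_id]. Qed.

Lemma good_ipow l : good B (ipow l) (B ^+ l).
Proof.
split=> [|r rB]; first exact: cmeas_ipow.
by rewrite cmodX cmod_Complex0 lerXn2r// nnegrE.
Qed.

Lemma texp_ipow L (t r : R) : texp L (t * r) =
  \sum_(l < L) ((l`!)%:R^-1 * t ^+ l)%:C%C * ipow l r.
Proof.
apply: eq_bigr => l _; rewrite /ipow -(_ : t%:C%C * Complex 0 r = Complex 0 (t * r)); last first.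
  by apply/eqP; rewrite eq_complex /= !mul0r mulr0 subrr addr0 !eqxx.
by rewrite exprMn rmorphM rmorphXn /= mulrA.
Qed.

Lemma good_texp L (t : R) : `|t| <= 1 -> good B (fun r => texp L (t * r)) (expR B).
Proof.
move=> t1; split=> [|r rB]; last first.
  by apply: cmod_texp_le; rewrite normrM (le_trans _ rB)// ler_piMl.
under eq_fun do rewrite texp_ipow.
apply: cmeas_sum => l; apply: cmeasM; first exact: cmeas_cst.
exact: cmeas_ipow.
Qed.

Notation piece l j := (localized phi p q h (ipow l) j).

Lemma localized_texp L j (t : R) xi :
  localized phi p q h (fun r => texp L (t * r)) j xi =
  \sum_(l < L) ((l`!)%:R^-1 * t ^+ l)%:C%C * piece l j xi.
Proof.
have ic (l : 'I_L) := cintegrable_coefficient j (supp_shifted xi (good_ipow l) (exprn_ge0 l B_ge0)).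
transitivity (cint lebesgue_rV (fun v => \sum_(l < L)
    ((l`!)%:R^-1 * t ^+ l)%:C%C * (character q j v * shifted phi p h (ipow l) xi v))).
  apply: eq_cint => v; rewrite /shifted texp_ipow.
  by rewrite mulr_suml !mulr_sumr; apply: eq_bigr => l _; ring.
rewrite cint_sum; first by apply: eq_bigr => l _; rewrite cintZ//; exact: ic.
by move=> l; apply: cintegrableZ; exact: ic.
Qed.

Lemma cintegrable_piece l j : cintegrable lebesgue_rV (piece l j).
Proof.
exact: bounded_supp_cintegrable (supp_localized j (good_ipow l) (exprn_ge0 l B_ge0)).
Qed.

Lemma evolution_localized_texp L j (t : R) x :
  evolution phi t (localized phi p q h (fun r => texp L (t * r)) j) x =
  \sum_(l < L) ((l`!)%:R^-1 * t ^+ l)%:C%C * evolution phi t (piece l j) x.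
Proof.
have ic (l : 'I_L) := cintegrable_evolution t x mphi (cintegrable_piece l j).
transitivity (cint lebesgue_rV (fun xi => \sum_(l < L) ((l`!)%:R^-1 * t ^+ l)%:C%C *
    (cexpi (rV_dot x xi + t * phi xi) * piece l j xi))).
  apply: eq_cint => xi; rewrite localized_texp mulr_sumr.
  by apply: eq_bigr => l _; rewrite mulrCA.
rewrite cint_sum; first by apply: eq_bigr => l _; rewrite cintZ//; exact: ic.
by move=> l; apply: cintegrableZ; exact: ic.
Qed.

(** Near the lattice point the localizing function can be divided out. The power series then
    replaces the datum depending on t by the data [piece l j], and Cauchy-Schwarz with weights 1/l!,
    of total at most e, lets the square and the supremum enter the sum. *)
Lemma localized_msq_le j x : (forall v, box p v -> `|rV_dot (x - lattice q j) v| <= 1) ->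
  (msq phi h x <= (expR 1 / ((2 * p) ^+ n * cos 1) ^+ 2)%:E *
    \sum_(l <oo) (((l`!)%:R^-1)%:E * msq phi (piece l j) x))%E.
Proof.
move=> xj; set d := (2 * p) ^+ n * cos 1.
have d0 : 0 < d by rewrite mulr_gt0 ?cos1_gt0// exprn_gt0// mulr_gt0.
have term0 (l : nat) : (0 <= ((l`!)%:R^-1)%:E * msq phi (piece l j) x)%E.
  by rewrite mule_ge0 ?msq_ge0// lee_fin.
apply: msq_le => t /andP[t0 t1].
have t1' : `|t| <= 1 by rewrite gtr0_norm// ltW.
set E := evolution phi t h x.
suff key : (((d * cmod E) ^+ 2)%:E <=
    (expR 1)%:E * \sum_(l <oo) (((l`!)%:R^-1)%:E * msq phi (piece l j) x))%E.
  have -> : (cmod E) ^+ 2 = (d ^+ 2)^-1 * (d * cmod E) ^+ 2.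
    by field; rewrite gt_eqF.
  rewrite [expR 1 / _]mulrC 2!(EFinM (d ^+ 2)^-1) -muleA; apply: lee_wpmul2l => //.
  by rewrite lee_fin invr_ge0 sqr_ge0.
apply: (@le_trans _ _ ((cmod (evolution phi t
    (localized phi p q h (fun r => cexpi (t * r)) j) x)) ^+ 2)%:E).
  rewrite -(dirichlet_evolution phi_cont pq mh hM h0 osc) cmodM lee_fin.
  have dE0 : 0 <= d * cmod E := mulr_ge0 (ltW d0) (cmod_ge0 E).
  rewrite lerXn2r ?nnegrE ?dE0 -?cmodM ?cmod_ge0// cmodM.
  by rewrite ler_wpM2r ?cmod_ge0//; exact: dirichlet_lower.
(* The bound 1 is relaxed to exp(B), which also bounds all truncated series. *)
have ge : good B (fun r => cexpi (t * r)) (expR B).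
  have [? h1] := good_cexpi B t; split=> // r rB.
  by rewrite (le_trans (h1 r rB))// -expR0 ler_expR.
have cv := cvg_sqr (cvg_cmod (evolution_localized_cvg phi_cont pq mh hM h0 osc j t x (expR_ge0 B)
  (fun L => good_texp L t1') ge (fun r => texp_cvg (t * r)))).
apply: (EFin_lim_le cv) => L.
apply: (@le_trans _ _ (expR 1 * \sum_(l < L) (l`!)%:R^-1 *
    (cmod (evolution phi t (piece l j) x)) ^+ 2)%:E).
  rewrite lee_fin; apply: le_trans (@cauchy_schwarz_sum _ L (fun l => (l`!)%:R^-1)
    (fun l => cmod (evolution phi t (piece l j) x)) _ _ _) => //; last first.
    apply: le_trans (exp_series_le L ler01); apply: ler_sum => l _.
    by rewrite expr1n mulr1.
  rewrite lerXn2r ?nnegrE ?cmod_ge0//.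
    by apply: sumr_ge0 => l _; rewrite mulr_ge0 ?cmod_ge0.
  rewrite evolution_localized_texp (le_trans (cmod_sum _ _ _))//.
  apply: ler_sum => l _; rewrite cmodM cmod_real ler_wpM2r ?cmod_ge0//.
  rewrite ger0_norm ?mulr_ge0 ?exprn_ge0 ?(ltW t0)// ler_piMr//.
  by rewrite exprn_ile1// ltW.
rewrite EFinM; apply: lee_wpmul2l; first by rewrite lee_fin expR_ge0.
apply: le_trans (nneseries_lim_ge L (fun l _ _ => term0 l)).
rewrite big_mkord -sumEFin; apply: lee_sum => l _; rewrite EFinM.
apply: lee_wpmul2l; first by rewrite lee_fin.
by apply: msq_ge; rewrite t0.
Qed.

(** Bessel in v at fixed xi gives (2 q)^n K^2 times the integral of |h(xi - v)|^2 over the box of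
    size p. Integrating in xi first, by Tonelli, then produces the volume (2 p)^n. *)
Lemma bessel_localized (e : R -> R[i]) (K : R) (J : seq 'rV[int]_n) :
  uniq J -> good B e K -> 0 <= K ->
  (\sum_(j <- J) L2sq (localized phi p q h e j) <=
   ((2 * q) ^+ n * (2 * p) ^+ n * K ^+ 2)%:E * L2sq h)%E.
Proof.
move=> uJ ge K0; have [me _] := ge.
have q0 : 0 < q by exact: lt_le_trans pq.
pose g (x : 'rV[R]_n) : \bar R := ((cmod (h x)) ^+ 2)%:E.
have g0 x : (0 <= g x)%E by rewrite lee_fin sqr_ge0.
have mg : measurable_fun setT g.
  by apply/measurable_EFinP; apply: measurable_funX; exact: measurable_cmod.
pose F (z : 'rV[R]_n * 'rV[R]_n) : \bar R := ((\1_(@box R n p) z.2 : R)%:E * g (z.1 - z.2)%R)%E.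
have F0 z : (0 <= F z)%E by rewrite mule_ge0// lee_fin.
have mbox : measurable_fun setT (fun v => (\1_(@box R n p) v : R)%:E).
  by apply/measurable_EFinP; apply: measurable_indic; exact: measurable_box.
have mF : measurable_fun setT F.
  apply: emeasurable_funM; first exact: (measurableT_comp mbox measurable_snd).
  by apply: (measurableT_comp mg); exact: measurable_rVB.
have mF1 xi : measurable_fun setT (fun v => F (xi, v)).
  exact: (measurableT_comp mF (pair1_measurable xi)).
have iF : (\int[lebesgue_rV]_xi \int[lebesgue_rV]_v F (xi, v) =
    ((2 * p) ^+ n)%:E * L2sq h)%E.
  rewrite fubini_tonelli//.
  transitivity (\int[lebesgue_rV]_v ((\1_(@box R n p) v : R)%:E * L2sq h))%E.
    apply: eq_integral => v _; rewrite /F /= ge0_integralZl//; last first.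
      by apply: (measurableT_comp mg); apply: measurable_rVB => //; exact: measurable_cst.
    by congr (_ * _)%E; exact: (ge0_integral_rV_translate (- v) mg g0).
  rewrite ge0_integralZr//; last exact: L2sq_ge0.
  rewrite integral_indic//; last exact: measurable_box.
  by rewrite setIT; congr (_ * _)%E; exact: (lebesgue_boxE p_gt0).
have ml j : measurable_fun setT
    (fun xi => ((cmod (localized phi p q h e j xi)) ^+ 2)%:E : \bar R).
  apply/measurable_EFinP; apply: measurable_funX; apply: measurable_cmod.
  exact: cmeas_localized.
rewrite /L2sq -ge0_integral_sum//; last by move=> j x _; rewrite lee_fin sqr_ge0.
have mI : measurable_fun setT (fun xi => (\int[lebesgue_rV]_v F (xi, v))%E).
  exact: measurable_fun_fubini_tonelli_F.
apply: (@le_trans _ _ (\int[lebesgue_rV]_xi (((2 * q) ^+ n * K ^+ 2)%:E *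
    \int[lebesgue_rV]_v F (xi, v)))%E); last first.
  rewrite ge0_integralZl//; last 2 first.
  - by move=> x _; apply: integral_ge0.
  - by rewrite lee_fin mulr_ge0 ?sqr_ge0// exprn_ge0// mulr_ge0// ltW.
  by rewrite iF muleA -EFinM mulrAC.
apply: ge0_le_integral => //.
- by move=> x _; apply: sume_ge0 => j _; rewrite lee_fin sqr_ge0.
- by apply: emeasurable_sum => j.
- exact: measurable_funeM.
move=> xi _; have hs := supp_shifted xi ge K0.
rewrite sumEFin (EFinM ((2 * q) ^+ n)) -muleA.
have b1 := bessel q0 uJ hs.
apply: (@le_trans _ _ (@boxvol R n q * Rsq (shifted phi p h e xi))%:E); first by rewrite lee_fin.
rewrite EFinM; apply: lee_wpmul2l; first by rewrite lee_fin ltW// boxvol_gt0.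
have fs := integrable_fin_num measurableT (bounded_supp_sqr hs).
rewrite /Rsq /Rintegral fineK// -ge0_integralZl//; last by rewrite lee_fin sqr_ge0.
apply: ge0_le_integral => //.
- by move=> x _; rewrite lee_fin sqr_ge0.
- apply/measurable_EFinP; apply: measurable_funX; apply: measurable_cmod.
  by case: hs.
- exact: measurable_funeM.
move=> v _; rewrite /F /g /= -!EFinM lee_fin.
apply: (@le_trans _ _ ((K * cmod (cindic (@box R n p) v * h (xi - v))) ^+ 2)).
  rewrite lerXn2r ?nnegrE ?mulr_ge0 ?cmod_ge0//.
  exact: (cmod_shifted h0 osc _ _ ge K0).
rewrite exprMn cmodM exprMn cmod_real ger0_norm// indicE.
by case: (_ \in _); rewrite ?expr1n// expr0n.
Qed.

End localized_bounds.

Lemma nneseries_le_bound {R : realType} (u : nat -> \bar R) (c : \bar R) :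
  (forall k, 0 <= u k)%E -> (forall m, \sum_(0 <= k < m) u k <= c)%E ->
  (\sum_(k <oo) u k <= c)%E.
Proof.
move=> u0 uc; apply: lime_le; first exact: is_cvg_nneseries.
exact: nearW.
Qed.

(** * Covering R^n by cubes around the lattice points *)

Section tiles.
Context {R : realType} {n : nat}.
Variable q : R.
Hypothesis q_gt0 : 0 < q.
Implicit Types (j : 'rV[int]_n) (x : 'rV[R]_n).

(** Closed cubes: common faces are counted several times, which is harmless in an upper bound for a
    nonnegative integral. *)
Definition tile j : set 'rV[R]_n := [set x | box (pi / q / 2) (x - lattice q j)].

Lemma measurable_tile j : measurable (tile j).
Proof.
rewrite -[X in measurable X]setTI; apply: measurable_rVB => //; exact: measurable_box.
Qed.

Lemma tile_cover x : exists j, tile j x.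
Proof.
pose d : R := pi / q; have d0 : 0 < d by rewrite divr_gt0// pi_gt0.
(* Each coordinate is rounded to a nearest multiple of d. *)
exists (\row_i Num.floor (x 0 i / d + 1 / 2)) => i.
rewrite !mxE -/d; set f := Num.floor _.
have /andP[f1 f2] := floor_itv (x 0 i / d + 1 / 2).
rewrite -/f in f1 f2; rewrite intrD in f2.
have xE : x 0 i = d * (x 0 i / d) by rewrite mulrC divfK// gt_eqF.
rewrite [in X in `|X|]xE -mulrBr normrM gtr0_norm// ler_pM2l//.
by rewrite ler_norml; apply/andP; split; lra.
Qed.

(** Countable subadditivity along an enumeration of Z^n, codes of no point standing for the empty
    set. Each partial sum runs over a finite duplicate-free family, where the hypothesis applies. *)
Lemma ge0_integral_tiles (f : 'rV[R]_n -> \bar R) (c : \bar R) :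
  measurable_fun setT f -> (forall x, 0 <= f x)%E ->
  (forall J : seq 'rV[int]_n, uniq J ->
    (\sum_(j <- J) \int[lebesgue_rV]_(x in tile j) f x <= c)%E) ->
  (\int[lebesgue_rV]_x f x <= c)%E.
Proof.
move=> mf f0 fc.
pose A (k : nat) : set 'rV[R]_n := oapp tile set0 (@pickle_inv 'rV[int]_n k).
have mA k : measurable (A k) by rewrite /A; case: pickle_inv => //= j; exact: measurable_tile.
have mfA k : measurable_fun setT (f \_ (A k)).
  by apply/(measurable_restrictT _ (mA k)); exact: measurable_funTS.
have fA0 k x : (0 <= (f \_ (A k)) x)%E by rewrite patchE; case: ifP.
apply: (@le_trans _ _ (\int[lebesgue_rV]_x \sum_(k <oo) (f \_ (A k)) x)%E).
  apply: ge0_le_integral => //.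
  - exact: ge0_emeasurable_sum.
  - move=> x _; have [j jx] := tile_cover x.
    have := @nneseries_lim_ge _ (fun k => (f \_ (A k)) x) xpredT 0 (pickle j).+1
      (fun k _ _ => fA0 k x).
    apply: le_trans; rewrite big_nat_recr//= [X in (_ <= _ + X)%E]patchE /A.
    by rewrite pickleK_inv/= mem_set//; apply: leeDr; apply: sume_ge0 => k _; exact: fA0.
rewrite integral_nneseries//; apply: nneseries_le_bound => [k|m].
  exact: integral_ge0.
apply: le_trans (fc (pmap (@pickle_inv 'rV[int]_n) (index_iota 0 m)) _); last first.
  by apply: pmap_uniq (iota_uniq _ _); exact: pickle_invK.
rewrite big_pmap; apply: lee_sum => k _; rewrite -integral_mkcond /A.
by case: pickle_inv => //=; rewrite integral_set0.
Qed.

End tiles.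

(** * The global estimate for data supported in one frequency box *)

Section frequency_localized.
Context {R : realType} {n : nat}.
Implicit Types (x y xi eta v : 'rV[R]_n) (j : 'rV[int]_n) (h : 'rV[R]_n -> R[i]).
Hypothesis n_gt0 : (0 < n)%N.
Variable phi : 'rV[R]_n -> R.
Hypothesis phi_cont : continuous phi.
Variables (a s K B0 : R).
Hypotheses (a_ge1 : 1 <= a) (s_ge0 : 0 <= s) (K_ge0 : 0 <= K) (B0_ge0 : 0 <= B0).
Hypothesis phi_lip : forall r xi eta, 0 < r -> box r xi -> box r eta ->
  `|phi xi - phi eta| <= B0 * r `^ (a - 1) * \sum_(i < n) `|xi 0 i - eta 0 i|.
Hypothesis local_estimate : forall l r y h, 1 <= l -> 1 <= l * r -> bounded_supp r h ->
  (\int[lebesgue_rV]_(x in eball y l) msq phi h x <=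
   (K * ((l * r) `^ s) ^+ 2)%:E * L2sq h)%E.

Let mphi : measurable_fun setT phi.
Proof. exact: continuous_measurable_rV. Qed.

Let n1 : 1 <= n%:R :> R. Proof. by rewrite ler1n. Qed.

(* The oscillation of phi between points of the box of size 2N at distance
   at most N^(1-a) in each coordinate. *)
Let B : R := B0 * 2 `^ (a - 1) * n%:R.

(** The factor (pi n)^n / cos(1)^2 is Bessel's constant divided by the square of the localizing
    function, e is the total of the weights 1/l!, 2^s comes from the enlarged frequency box, and
    exp(B^2) is the sum of B^(2 l)/l!. *)
Definition global_constant : R :=
  (pi * n%:R) ^+ n / cos 1 ^+ 2 * expR 1 * K * (2 `^ s) ^+ 2 * expR (B ^+ 2).

Lemma global_constant_ge0 : 0 <= global_constant.
Proof.
rewrite !mulr_ge0 ?expR_ge0 ?sqr_ge0 ?exprn_ge0 ?invr_ge0 ?sqr_ge0//.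
by rewrite mulr_ge0// pi_ge0.
Qed.

Lemma frequency_localized_estimate N h : 1 <= N -> bounded_supp N h ->
  (\int[lebesgue_rV]_x msq phi h x <=
   (global_constant * (N `^ (a * s)) ^+ 2)%:E * L2sq h)%E.
Proof.
move=> N1 hh; have N0 : 0 < N by exact: lt_le_trans N1.
have ih := bounded_supp_cintegrable hh; have [mh [M hM] h0] := hh.
have n0 : 0 < n%:R :> R by exact: lt_le_trans n1.
have n1' : 1 <= n%:R :> R := n1.
have n0' : n%:R != 0 :> R by rewrite gt_eqF.
have pi0 := pi_gt0 R; have pi2 := pi_ge2 R.
have sum_const (z : R) : \sum_(i < n) z = n%:R * z by rewrite sumr_const card_ord mulr_natl.
pose lam := N `^ (a - 1).
have lam1 : 1 <= lam by rewrite -(powRr0 N) ler_powR// subr_ge0.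
have lam0 : 0 < lam by exact: lt_le_trans lam1.
have lam0' : lam != 0 by rewrite gt_eqF.
pose p := lam^-1; have p0 : 0 < p by rewrite invr_gt0.
have p1 : p <= 1 by rewrite invf_le1.
(* This makes the tile side pi / q equal to lam / n: a tile lies in the ball of radius [lam], and a
   point of it, relative to the centre, pairs with the box of size p to at most 1/2. *)
pose q := pi * n%:R * p.
have pq : p <= q by rewrite ler_peMl// ?(ltW p0)//; nra.
have q0 : 0 < q by exact: lt_le_trans pq.
have B_ge0 : 0 <= B by rewrite !mulr_ge0 ?powR_ge0.
have osc xi v : box p v -> box N (xi - v) -> `|phi (xi - v) - phi xi| <= B.
  (* The point xi may leave the box of size N, but it stays in the one of size 2 N since p <= 1 <=
     N; hence the factor 2^(a-1) in [B]. *)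
  move=> bv bx; have N20 : 0 < 2 * N by rewrite mulr_gt0.
  have b1 : box (2 * N) (xi - v) by move=> i; rewrite (le_trans (bx i))//; lra.
  have b2 : box (2 * N) xi.
    move=> i; rewrite -(subrK (v 0 i) (xi 0 i)) (le_trans (ler_normD _ _))//.
    by have := bx i; have := bv i; rewrite !mxE; lra.
  apply: (le_trans (phi_lip N20 b1 b2)).
  have -> : B = B0 * (2 * N) `^ (a - 1) * (n%:R * p).
    by rewrite powRM ?(ltW N0)// -/lam /p /B; field.
  apply: ler_wpM2l; first by rewrite mulr_ge0 ?powR_ge0.
  rewrite -sum_const.
  by apply: ler_sum => i _; rewrite !mxE addrAC subrr sub0r normrN; exact: bv.
have spacing : pi / q / 2 = lam / (2 * n%:R).
  by rewrite /q /p; move: (@pi R) (lt0r_neq0 pi0) => P P0; field; rewrite lam0' n0'.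
have near_tile j x v : tile q j x -> box p v -> `|rV_dot (x - lattice q j) v| <= 1.
  move=> jx bv; rewrite (le_trans (ler_norm_sum _ _ _))//.
  apply: (@le_trans _ _ (\sum_(i < n) (2 * n%:R)^-1)).
    apply: ler_sum => i _; rewrite normrM.
    have -> : (2 * n%:R)^-1 = (pi / q / 2) * p :> R.
      by rewrite spacing /p; field; rewrite ?lam0' ?n0'.
    exact: (ler_pM (normr_ge0 _) (normr_ge0 _) (jx i) (bv i)).
  rewrite sum_const.
  have -> : n%:R * (2 * n%:R)^-1 = 1 / 2 :> R by field.
  lra.
have tile_ball j : tile q j `<=` eball (lattice q j) lam.
  move=> x jx; rewrite /eball /= /enorm.
  rewrite -(ger0_norm (ltW lam0)) -sqrtr_sqr ltr_sqrt ?exprn_gt0//.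
  apply: (@le_lt_trans _ _ (\sum_(i < n) (lam / (2 * n%:R)) ^+ 2)).
    apply: ler_sum => i _; rewrite -expr2 -real_normK ?num_real// lerXn2r ?nnegrE//.
      by rewrite divr_ge0 ?mulr_ge0 ?(ltW lam0)// ltW.
    by rewrite -spacing; exact: jx.
  rewrite sum_const.
  have -> : n%:R * (lam / (2 * n%:R)) ^+ 2 = lam ^+ 2 * (4 * n%:R)^-1 :> R by field.
  by rewrite gtr_pMr ?exprn_gt0// invf_lt1; lra.
(* [c] is the loss in [localized_msq_le], [K'] that of the local estimate at radius [lam] and
   frequencies up to N + p, and [D] that of Bessel. *)
pose c := expR 1 / ((2 * p) ^+ n * cos 1) ^+ 2.
pose K' := K * ((lam * (N + p)) `^ s) ^+ 2.
pose D := (2 * q) ^+ n * (2 * p) ^+ n.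
pose H l j := localized phi p q h (ipow l) j.
have c0 : 0 <= c by rewrite divr_ge0 ?expR_ge0 ?sqr_ge0.
have K'0 : 0 <= K' by rewrite mulr_ge0 ?sqr_ge0.
have D0 : 0 <= D.
  by rewrite /D mulr_ge0// exprn_ge0// mulr_ge0// ltW.
have w0 (l : nat) : 0 <= (l`!)%:R^-1 :> R by rewrite invr_ge0.
have cw0 (l : nat) : 0 <= c * (l`!)%:R^-1 * K' := mulr_ge0 (mulr_ge0 c0 (w0 l)) K'0.
have mH l j : measurable_fun setT (msq phi (H l j)).
  by apply: measurable_msq => //; exact: (cintegrable_piece phi_cont pq B_ge0 mh hM h0 osc).
have tile_estimate j : (\int[lebesgue_rV]_(x in tile q j) msq phi h x <=
    \sum_(l <oo) ((c * (l`!)%:R^-1 * K')%:E * L2sq (H l j)))%E.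
  have mt := measurable_tile q j.
  apply: (@le_trans _ _ (\int[lebesgue_rV]_(x in tile q j)
      \sum_(l <oo) ((c * (l`!)%:R^-1)%:E * msq phi (H l j) x))%E).
    apply: ge0_le_integral => //.
    - by move=> x _; exact: msq_ge0.
    - by apply: measurable_funTS; exact: measurable_msq.
    - apply: measurable_funTS; apply: ge0_emeasurable_sum => //.
      + by move=> l x _ _; rewrite mule_ge0 ?msq_ge0// lee_fin mulr_ge0.
      + by move=> l _; exact: measurable_funeM.
    - move=> x jx; apply: (le_trans (localized_msq_le phi_cont p0 pq B_ge0 mh hM h0 osc
        (fun v => near_tile j x v jx))).
      rewrite -/c -nneseriesZl; last by move=> l _; rewrite mule_ge0 ?msq_ge0// lee_fin.
      by under eq_eseriesr do rewrite muleA -EFinM.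
  rewrite integral_nneseries//; last 2 first.
  - by move=> l; apply: measurable_funTS; exact: measurable_funeM.
  - by move=> l x _; rewrite mule_ge0 ?msq_ge0// lee_fin mulr_ge0.
  apply: lee_nneseries => l.
    by move=> _ _; apply: integral_ge0 => x _; rewrite mule_ge0 ?msq_ge0// lee_fin mulr_ge0.
  move=> _; rewrite ge0_integralZl//; last 3 first.
  - exact: measurable_funTS.
  - by move=> x _; exact: msq_ge0.
  - by rewrite lee_fin mulr_ge0.
  rewrite (EFinM _ K') -muleA; apply: lee_wpmul2l; first by rewrite lee_fin mulr_ge0.
  have hs := bounded_supp_localized phi_cont pq mh hM h0 osc j (good_ipow B_ge0 l)
    (exprn_ge0 l B_ge0).
  have lr : 1 <= lam * (N + p) by nra.
  apply: le_trans (local_estimate (lattice q j) lam1 lr hs).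
  apply: ge0_subset_integral => //.
  - exact: measurable_eball.
  - exact: measurable_funTS.
  - by move=> x _; exact: msq_ge0.
apply: (ge0_integral_tiles q0).
- exact: measurable_msq.
- by move=> x; exact: msq_ge0.
move=> J uJ; have L0 := L2sq_ge0 h.
apply: (@le_trans _ _ (\sum_(j <- J) \sum_(l <oo) ((c * (l`!)%:R^-1 * K')%:E * L2sq (H l j)))%E).
  by apply: lee_sum => j _; exact: tile_estimate.
(* The sums are exchanged so that Bessel can be applied over the tiles for each power l
   separately. *)
rewrite -nneseries_sum; last first.
  by move=> j l _; apply: mule_ge0 (L2sq_ge0 _); rewrite lee_fin.
apply: nneseries_le_bound => [l|m].
  by apply: sume_ge0 => j _; apply: mule_ge0 (L2sq_ge0 _); rewrite lee_fin.
apply: (@le_trans _ _ (\sum_(0 <= l < m) (c * (l`!)%:R^-1 * K' * (D * (B ^+ l) ^+ 2))%:E * L2sq h)%E).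
  apply: lee_sum => l _; rewrite -ge0_sume_distrr; last by move=> j _; exact: L2sq_ge0.
  rewrite (EFinM _ (D * _)) -muleA; apply: lee_wpmul2l; first by rewrite lee_fin.
  exact: (bessel_localized phi_cont p0 pq mh hM h0 osc uJ (good_ipow B_ge0 l)
    (exprn_ge0 l B_ge0)).
rewrite -ge0_sume_distrl; last first.
  by move=> l _; rewrite lee_fin; apply: mulr_ge0 (cw0 l) (mulr_ge0 D0 (sqr_ge0 _)).
apply: lee_wpmul2r => //; rewrite sumEFin lee_fin.
have -> : \sum_(0 <= l < m) c * (l`!)%:R^-1 * K' * (D * (B ^+ l) ^+ 2) =
    c * K' * D * \sum_(l < m) (l`!)%:R^-1 * (B ^+ 2) ^+ l.
  rewrite big_mkord mulr_sumr; apply: eq_bigr => l _.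
  by rewrite exprAC; ring.
have -> : global_constant * (N `^ (a * s)) ^+ 2 =
    (c * D) * (K * ((2 * N `^ a) `^ s) ^+ 2) * expR (B ^+ 2).
  rewrite powRM ?powR_ge0// powRrM /global_constant.
  (* Here the powers of p cancel, and with them the dependence on N. *)
  have -> : c * D = (pi * n%:R) ^+ n / cos 1 ^+ 2 * expR 1.
    have -> : D = (pi * n%:R) ^+ n * ((2 * p) ^+ n) ^+ 2.
      have E : 2 * q = pi * n%:R * (2 * p) by rewrite /q; ring.
      by rewrite /D E exprMn expr2 mulrA.
    rewrite /c; set P := (2 * p) ^+ n; have P0 : P != 0.
      by rewrite expf_neq0// mulf_neq0// gt_eqF.
    by field; rewrite P0 gt_eqF// cos1_gt0.
  ring.
have -> : c * K' * D = c * D * K' by ring.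
have Na : lam * N = N `^ a.
  have := @powRD _ N (a - 1) 1; rewrite subrK powRr1 ?(ltW N0)// => <- //.
  by rewrite (gt_eqF N0) implybT.
have Na1 : 1 <= N `^ a by rewrite -Na; nra.
have cD0 := mulr_ge0 c0 D0.
apply: ler_pM.
- exact: mulr_ge0.
- by apply: sumr_ge0 => l _; rewrite mulr_ge0// exprn_ge0// sqr_ge0.
- apply: ler_wpM2l => //; apply: ler_wpM2l => //.
  rewrite lerXn2r ?nnegrE ?powR_ge0//; apply: ge0_ler_powR => //.
  + by rewrite nnegrE mulr_ge0 ?addr_ge0 ?(ltW lam0) ?(ltW N0) ?(ltW p0).
  + by rewrite nnegrE mulr_ge0 ?powR_ge0.
  (* Here lam (N + p) = N^a + 1 <= 2 N^a. *)
  + by rewrite mulrDr Na divff// mulr_natl mulr2n lerD2l.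
- by apply: exp_series_le; exact: sqr_ge0.
Qed.

End frequency_localized.

(** * Dyadic summation over frequency shells *)

Section dyadic.
Context {R : realType} {n : nat}.
Implicit Types (x y xi eta v : 'rV[R]_n) (h : 'rV[R]_n -> R[i]).

Lemma normr_le_japanese x i : `|x 0 i| <= japanese x.
Proof.
rewrite -(ger0_norm (japanese_ge0 x)) -(ler_pXn2r (ltn0Sn 1)) ?nnegrE//.
rewrite !real_normK ?num_real// japanese_sqr /rV_dot (bigD1 i)//= -expr2.
by rewrite ler_wpDl// lerDl sumr_ge0// => j _; rewrite -expr2 sqr_ge0.
Qed.

Lemma japanese_ge1 x : 1 <= japanese x.
Proof.
rewrite -(ger0_norm (japanese_ge0 x)) -[leLHS]ger0_norm// -(ler_pXn2r (ltn0Sn 1)) ?nnegrE//.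
by rewrite !real_normK ?num_real// japanese_sqr expr1n lerDl rV_dotxx_ge0.
Qed.

(** The indicator of a cubic dyadic shell, written as a difference so that partial sums telescope;
    the shell k = 0 is the whole unit box. *)
Definition shell (k : nat) x : R := \1_(@box R n (2 ^+ k)) x -
  (if k is k'.+1 then \1_(@box R n (2 ^+ k')) x else 0).

Lemma measurable_shell k : measurable_fun setT (shell k).
Proof.
apply: measurable_funB; first by apply: measurable_indic; exact: measurable_box.
by case: k => [|k]; [exact: measurable_cst|apply: measurable_indic; exact: measurable_box].
Qed.

Lemma sum_shell L x : \sum_(k < L.+1) shell k x = \1_(@box R n (2 ^+ L)) x.
Proof.
elim: L => [|L IH]; first by rewrite big_ord1 /shell subr0.
by rewrite big_ord_recr /= IH /shell addrC subrK.
Qed.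

(** On a shell with k > 0 some coordinate exceeds 2^(k-1), and so does [japanese x]; for k = 0 the
    bound is [japanese_ge1]. *)
Lemma shellP k x :
  shell k x = 0 \/ [/\ shell k x = 1, box (2 ^+ k) x & 2 ^+ k <= 2 * japanese x].
Proof.
have J1 := japanese_ge1 x.
rewrite /shell !indicE; have [b1|b1] := pselect (box (2 ^+ k) x); last first.
  left; rewrite memNset//; case: k b1 => [|k] b1; first by rewrite subr0.
  rewrite indicE memNset ?subr0// => b2; apply: b1 => i; apply: (le_trans (b2 i)).
  by rewrite ler_weXn2l// ler1n.
rewrite mem_set//; case: k b1 => [|k] b1.
  by right; rewrite subr0; split => //; rewrite expr0; lra.
rewrite indicE; have [b2|b2] := pselect (box (2 ^+ k) x).
  by left; rewrite mem_set// subrr.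
right; rewrite memNset// subr0; split => //.
have /existsNP[i /negP] := b2; rewrite -ltNge => xi.
by rewrite exprS ler_pM2l// (le_trans (ltW xi))// normr_le_japanese.
Qed.

Variable phi : 'rV[R]_n -> R.
Hypothesis mphi : measurable_fun setT phi.

Definition shell_part h k x : R[i] := (shell k x)%:C%C * h x.

Lemma evolution_sum (h_ : nat -> 'rV[R]_n -> R[i]) L t x :
  (forall k, cintegrable lebesgue_rV (h_ k)) ->
  evolution phi t (fun xi => \sum_(k < L) h_ k xi) x = \sum_(k < L) evolution phi t (h_ k) x.
Proof.
move=> ih; rewrite -cint_sum; last by move=> k; exact: cintegrable_evolution.
by apply: eq_cint => xi; rewrite mulr_sumr.
Qed.

Lemma cmod_shell_part h k x : cmod (shell_part h k x) = shell k x * cmod (h x).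
Proof.
by rewrite cmodM cmod_real; case: (shellP k x) => [->|[-> _ _]]; rewrite ?normr0 ?normr1.
Qed.

Lemma bounded_supp_shell_part h k M : cmeas h -> (forall x, cmod (h x) <= M) ->
  bounded_supp (2 ^+ k) (shell_part h k).
Proof.
move=> mh hM; have M0 : 0 <= M := le_trans (cmod_ge0 _) (hM 0); split.
- by apply: cmeasM => //; apply: cmeas_real; exact: measurable_shell.
- exists M => x; rewrite cmod_shell_part.
  by case: (shellP k x) => [->|[-> _ _]]; rewrite ?mul0r ?mul1r.
- move=> x bx; rewrite /shell_part.
  by case: (shellP k x) => [->|[_ b _]]; rewrite ?mul0r// in bx *.
Qed.

Lemma evolution_shell_cvg h t x : cintegrable lebesgue_rV h ->
  cmod (evolution phi t (fun xi => \sum_(k < L.+1) shell_part h k xi) x - evolution phi t h x)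
    @[L --> \oo] --> (0 : R).
Proof.
move=> ih; have [mh _] := ih.
have E L xi : \sum_(k < L.+1) shell_part h k xi = cindic (@box R n (2 ^+ L)) xi * h xi.
  by rewrite /cindic -sum_shell rmorph_sum mulr_suml.
apply: (@cint_dominated _ _ _ _ _ _ (fun xi => cmod (h xi))).
- move=> L; apply: cmeasM; first exact: cmeas_evolution_kernel.
  under eq_fun do rewrite E; apply: cmeasM => //.
  by apply: cmeas_cindic; exact: measurable_box.
- by apply: cmeasM => //; exact: cmeas_evolution_kernel.
- exact: cintegrable_cmod.
- move=> L xi; rewrite E !cmodM cmod_cexpi mul1r.
  by rewrite ler_piMl ?cmod_ge0// cmod_cindic_le1.
(* At a fixed xi the truncated sum eventually equals h xi. *)
move=> xi; apply: cvg_near_cst.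
have [k jk] : exists k : nat, japanese xi <= 2 ^+ k.
  exists (Num.bound (japanese xi)); apply: (le_trans (ltW (archi_boundP (japanese_ge0 xi)))).
  by rewrite -natrX ler_nat ltnW// ltn_expl.
near=> L.
have bL : box (2 ^+ L) xi.
  move=> i; rewrite (le_trans (normr_le_japanese xi i))// (le_trans jk)//.
  by rewrite ler_weXn2l ?ler1n//; near: L; exact: nbhs_infty_ge.
by rewrite E /cindic indicE mem_set// mul1r subrr cmod0.
Unshelve. all: by end_near. Qed.

Variables (a s s' G : R).
Hypotheses (G_ge0 : 0 <= G) (as0 : 0 <= a * s) (ass' : a * s < s').
Hypothesis localized_estimate : forall N h, 1 <= N -> bounded_supp N h ->
  (\int[lebesgue_rV]_x msq phi h x <= (G * (N `^ (a * s)) ^+ 2)%:E * L2sq h)%E.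

(* The loss d of regularity makes the dyadic pieces summable. *)
Let d := s' - a * s.
Let gain (k : nat) : R := ((2 ^+ k) `^ d) ^+ 2.
Let rho : R := ((2 `^ d) ^+ 2)^-1.

Let gain_rho k : (gain k)^-1 = rho ^+ k.
Proof.
have E : (2 ^+ k) `^ d = (2 `^ d) ^+ k.
  by rewrite -(powR_mulrn k) ?ler0n// -powRrM mulrC powRrM powR_mulrn ?powR_ge0.
by rewrite /gain /rho E exprVn exprAC.
Qed.

Let gain_gt0 k : 0 < gain k.
Proof. by rewrite exprn_gt0// powR_gt0// exprn_gt0. Qed.

Let rho_lt1 : 0 < rho < 1.
Proof.
have h : 1 < 2 `^ d.
  suff : 1 `^ d < 2 `^ d by rewrite powR1.
  by apply: gt0_ltr_powR; rewrite ?nnegrE ?subr_gt0 ?ltr1n.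
by rewrite invr_gt0 exprn_gt0 ?powR_gt0//= invf_lt1 ?exprn_gt0 ?powR_gt0// expr_gt1// ltW.
Qed.

Let sum_gainV L : \sum_(k < L) (gain k)^-1 <= (1 - rho)^-1.
Proof.
have /andP[r0 r1] := rho_lt1; have r1' : 0 < 1 - rho by rewrite subr_gt0.
rewrite -[leRHS]mul1r ler_pdivlMr//.
suff -> : (\sum_(k < L) (gain k)^-1) * (1 - rho) = 1 - rho ^+ L.
  by rewrite gerBl exprn_ge0// ltW.
elim: L => [|L IH]; first by rewrite big_ord0 mul0r expr0 subrr.
by rewrite big_ord_recr/= mulrDl IH gain_rho exprS; ring.
Qed.

(** Cauchy-Schwarz with the geometric weights 1/gain, whose sum is at most 1/(1 - rho); the factor
    [gain] on the right is paid for by the excess regularity. *)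
Lemma msq_shell_le h x M : cintegrable lebesgue_rV h -> (forall x, cmod (h x) <= M) ->
  (msq phi h x <= ((1 - rho)^-1)%:E *
     \sum_(k <oo) ((gain k)%:E * msq phi (shell_part h k) x))%E.
Proof.
move=> ih hM; have [mh _] := ih; have /andP[r0 r1] := rho_lt1.
have W0 : 0 <= (1 - rho)^-1 by rewrite invr_ge0 subr_ge0 ltW.
have term0 k : (0 <= (gain k)%:E * msq phi (shell_part h k) x)%E.
  by rewrite mule_ge0 ?msq_ge0// lee_fin ltW.
apply: msq_le => t t01.
apply: (EFin_lim_le (cvg_sqr (cvg_cmod (evolution_shell_cvg t x ih)))) => L.
have ik k := bounded_supp_cintegrable (bounded_supp_shell_part k mh hM).
rewrite evolution_sum//.
apply: (@le_trans _ _ ((1 - rho)^-1 * \sum_(k < L.+1) (gain k)^-1 *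
    (gain k * cmod (evolution phi t (shell_part h k) x)) ^+ 2)%:E).
  rewrite lee_fin; apply: le_trans (@cauchy_schwarz_sum _ L.+1 (fun k => (gain k)^-1)
    (fun k => gain k * cmod (evolution phi t (shell_part h k) x)) _ _ _) => //; last first.
    by move=> k; rewrite invr_ge0 ltW.
  rewrite lerXn2r ?nnegrE ?cmod_ge0//.
    by apply: sumr_ge0 => k _; rewrite mulKf ?gt_eqF// cmod_ge0.
  rewrite (le_trans (cmod_sum _ _ _))//; apply: ler_sum => k _.
  by rewrite mulKf// gt_eqF.
rewrite EFinM; apply: lee_wpmul2l; first by rewrite lee_fin.
apply: le_trans (nneseries_lim_ge L.+1 (fun k _ _ => term0 k)).
rewrite big_mkord -sumEFin; apply: lee_sum => k _.
have gk : gain k != 0 by rewrite gt_eqF.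
have -> : (gain k)^-1 * (gain k * cmod (evolution phi t (shell_part h k) x)) ^+ 2 =
    gain k * cmod (evolution phi t (shell_part h k) x) ^+ 2.
  by move: (gain k) gk => g gk; field.
rewrite EFinM.
apply: lee_wpmul2l; first by rewrite lee_fin ltW.
exact: msq_ge.
Qed.

(** The three factors come from the geometric series, from the estimate on one box, and from 2^k <=
    2 [japanese x] on the shell of index k. *)
Definition summed_constant : R := (1 - rho)^-1 * G * (2 `^ s') ^+ 2.

Lemma summed_constant_ge0 : 0 <= summed_constant.
Proof.
have /andP[r0 r1] := rho_lt1.
by rewrite !mulr_ge0 ?sqr_ge0// invr_ge0 subr_ge0 ltW.
Qed.

Lemma global_estimate h M : cintegrable lebesgue_rV h -> (forall x, cmod (h x) <= M) ->
  (\int[lebesgue_rV]_x msq phi h x <= summed_constant%:E * weightsq s' h)%E.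
Proof.
move=> ih hM; have [mh _] := ih; have /andP[r0 r1] := rho_lt1.
have W0 : 0 <= (1 - rho)^-1 by rewrite invr_ge0 subr_ge0 ltW.
have s'0 : 0 <= s' by rewrite (le_trans as0)// ltW.
have hk k := bounded_supp_shell_part k mh hM.
have mk k : measurable_fun setT (msq phi (shell_part h k)).
  by apply: measurable_msq => //; exact: bounded_supp_cintegrable (hk k).
have g0 k : 0 <= gain k by exact: ltW.
have mf k : measurable_fun setT (fun x => ((gain k)%:E * msq phi (shell_part h k) x)%E).
  exact: measurable_funeM.
have f0 k x : (0 <= (gain k)%:E * msq phi (shell_part h k) x)%E.
  by rewrite mule_ge0 ?msq_ge0// lee_fin.
apply: (@le_trans _ _ (((1 - rho)^-1)%:E *
    \sum_(k <oo) ((gain k)%:E * \int[lebesgue_rV]_x msq phi (shell_part h k) x))%E).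
  have -> : (\sum_(k <oo) ((gain k)%:E * \int[lebesgue_rV]_x msq phi (shell_part h k) x) =
      \int[lebesgue_rV]_x \sum_(k <oo) ((gain k)%:E * msq phi (shell_part h k) x))%E.
    rewrite integral_nneseries//; apply: eq_eseriesr => k _.
    by rewrite ge0_integralZl ?lee_fin// => x _; exact: msq_ge0.
  rewrite -ge0_integralZl//; last 2 first.
  - exact: ge0_emeasurable_sum.
  - by move=> x _; exact: nneseries_ge0.
  apply: ge0_le_integral => //.
  - by move=> x _; exact: msq_ge0.
  - exact: measurable_msq.
  - by apply: measurable_funeM; exact: ge0_emeasurable_sum.
  - by move=> x _; exact: msq_shell_le hM.
rewrite /summed_constant -mulrA EFinM -muleA; apply: lee_wpmul2l; first by rewrite lee_fin.
apply: nneseries_le_bound => [k|m].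
  by rewrite mule_ge0 ?lee_fin ?integral_ge0// => x _; exact: msq_ge0.
have mL k : measurable_fun setT (fun xi => ((cmod (shell_part h k xi)) ^+ 2)%:E : \bar R).
  apply/measurable_EFinP; apply: measurable_funX; apply: measurable_cmod.
  by have [] := hk k.
have mw : measurable_fun setT (fun xi => ((japanese xi `^ s' * cmod (h xi)) ^+ 2)%:E : \bar R).
  apply/measurable_EFinP; apply: measurable_funX; apply: measurable_funM.
    by apply: (measurableT_comp (measurable_powR _)); exact: measurable_japanese.
  exact: measurable_cmod.
pose u (k : nat) : R := ((2 ^+ k) `^ s') ^+ 2.
have u0 k : 0 <= u k by exact: sqr_ge0.
apply: (@le_trans _ _ (\sum_(0 <= k < m) (G%:E *
    \int[lebesgue_rV]_xi ((u k)%:E * ((cmod (shell_part h k xi)) ^+ 2)%:E)))%E).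
  apply: lee_sum => k _; rewrite ge0_integralZl ?lee_fin//; last first.
    by move=> x _; rewrite lee_fin sqr_ge0.
  have k1 : 1 <= 2 ^+ k :> R by rewrite exprn_ege1// ler1n.
  apply: (@le_trans _ _ ((gain k)%:E * ((G * ((2 ^+ k) `^ (a * s)) ^+ 2)%:E *
      L2sq (shell_part h k)))%E).
    by apply: lee_wpmul2l; [rewrite lee_fin|exact: localized_estimate].
  rewrite !muleA -!EFinM; apply: lee_wpmul2r; first exact: L2sq_ge0.
  (* The gain and the loss combine exactly: 2^(k d) 2^(k a s) = 2^(k s'). *)
  rewrite lee_fin mulrCA ler_wpM2l// /gain -exprMn -powRD.
    by rewrite /d subrK.
  by rewrite (gt_eqF (lt_le_trans ltr01 k1)) implybT.
rewrite -ge0_sume_distrr; last first.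
  by move=> k _; apply: integral_ge0 => x _; rewrite -EFinM lee_fin mulr_ge0// sqr_ge0.
rewrite EFinM -muleA; apply: lee_wpmul2l; first by rewrite lee_fin.
rewrite -ge0_integral_sum//; last 2 first.
- by move=> k; exact: measurable_funeM.
- by move=> k x _; rewrite -EFinM lee_fin mulr_ge0// sqr_ge0.
rewrite /weightsq -ge0_integralZl//; last by move=> x _; rewrite lee_fin sqr_ge0.
apply: ge0_le_integral => //.
- by move=> x _; apply: sume_ge0 => k _; rewrite -EFinM lee_fin mulr_ge0// sqr_ge0.
- by apply: emeasurable_sum => k; exact: measurable_funeM.
- exact: measurable_funeM.
move=> x _; under eq_bigr do rewrite -EFinM; rewrite sumEFin -EFinM lee_fin -exprMn.
set A := (2 `^ s' * _) ^+ 2.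
have A0 : 0 <= A by exact: sqr_ge0.
(* One more term puts the sum in the form of [sum_shell], also for m = 0; the shells then add up to
   an indicator, at most 1. *)
apply: (@le_trans _ _ (\sum_(k < m.+1) shell k x * A)).
  have sA k : 0 <= shell k x * A.
    by case: (shellP k x) => [->|[-> _ _]]; rewrite ?mul0r ?mul1r.
  apply: (@le_trans _ _ (\sum_(k < m) shell k x * A)); last first.
    by rewrite [leRHS]big_ord_recr/= lerDl.
  rewrite big_mkord.
  apply: ler_sum => k _; rewrite cmod_shell_part.
  case: (shellP k x) => [->|[-> _ kJ]]; first by rewrite !mul0r expr0n mulr0.
  rewrite !mul1r /u /A -exprMn mulrA -powRM ?japanese_ge0//.
  rewrite lerXn2r ?nnegrE ?mulr_ge0 ?cmod_ge0 ?powR_ge0// ler_wpM2r ?cmod_ge0//.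
  apply: ge0_ler_powR => //.
  - by rewrite nnegrE exprn_ge0.
  - by rewrite nnegrE mulr_ge0 ?japanese_ge0.
by rewrite -mulr_suml sum_shell ler_piMl// indicE; case: (_ \in _).
Qed.

End dyadic.

(** * Lipschitz bounds from variations along the axes *)

Section coordinatewise_lipschitz.
Context {R : realType} {n : nat}.
Implicit Types (x y xi eta : 'rV[R]_n).

(** The coordinates of eta are replaced by those of xi one at a time. Every intermediate point stays
    in the box, and each move is along an axis, where partial derivatives give control. *)
Lemma lipschitz_coordinates (f : 'rV[R]_n -> R) (r L : R) :
  (forall x i (t : R), box r x -> box r (x + t *: delta_mx 0 i) ->
    `|f (x + t *: delta_mx 0 i) - f x| <= L * `|t|) ->
  forall xi eta, box r xi -> box r eta ->
    `|f xi - f eta| <= L * \sum_(i < n) `|xi 0 i - eta 0 i|.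
Proof.
move=> fL xi eta bxi beta.
pose z (k : nat) : 'rV[R]_n := \row_i (if (i < k)%N then xi 0 i else eta 0 i).
have z0 : z 0%N = eta by apply/rowP => i; rewrite mxE.
have zn : z n = xi by apply/rowP => i; rewrite mxE ltn_ord.
have bz k : box r (z k) by move=> i; rewrite mxE; case: ifP.
have zS (i : 'I_n) : z i.+1 = z i + (xi 0 i - eta 0 i) *: delta_mx 0 i.
  apply/rowP => j; rewrite !mxE eqxx /= ltnS leq_eqVlt.
  have [->|ji] := eqVneq j i; first by rewrite eqxx ltnn mulr1 addrC subrK.
  by rewrite -(inj_eq val_inj) in ji; rewrite (negbTE ji) mulr0 addr0.
have -> : f xi - f eta = \sum_(0 <= k < n) (f (z k.+1) - f (z k)).
  by rewrite (telescope_sumr (fun k => f (z k)))// z0 zn.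
rewrite big_mkord mulr_sumr.
apply: (le_trans (ler_norm_sum _ _ _)); apply: ler_sum => i _.
by rewrite zS; apply: fL; rewrite -?zS; exact: bz.
Qed.

Lemma lipschitz_box_continuous (f : 'rV[R]_n -> R) (K : R -> R) :
  (forall r xi eta, 0 < r -> box r xi -> box r eta ->
    `|f xi - f eta| <= K r * \sum_(i < n) `|xi 0 i - eta 0 i|) ->
  continuous f.
Proof.
move=> fK x; apply/(@cvgrPdist_lt _ _ _ (nbhs x) (nbhs_filter x)) => e e0; apply/rV_nearP.
(* A box that contains x together with all points within sup distance 1 of it. *)
pose r := 1 + \sum_(i < n) `|x 0 i|.
have xr i : `|x 0 i| + 1 <= r.
  by rewrite /r addrC lerD2l (bigD1 i)//= lerDl sumr_ge0.
have r0 : 0 < r by rewrite ltr_pwDl// sumr_ge0.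
pose c := (`|K r| + 1) * n.+1%:R.
have c0 : 0 < c by rewrite mulr_gt0// ltr_pwDr.
exists (Num.min 1 (e / c)) => [|y xy]; first by rewrite lt_min ltr01 divr_gt0.
have bx : box r x by move=> i; rewrite (le_trans _ (xr i))// lerDl.
have by_ : box r y.
  move=> i; apply: le_trans (xr i); have := xy i; rewrite lt_min => /andP[h _].
  by rewrite -[y 0 i](subrK (x 0 i)) addrC (le_trans (ler_normD _ _))// lerD// distrC ltW.
apply: (le_lt_trans (fK r x y r0 bx by_)).
have ec0 : 0 < e / c by rewrite divr_gt0.
apply: (@le_lt_trans _ _ (`|K r| * (n%:R * (e / c)))).
  rewrite (le_trans (ler_norm _))// normrM ler_wpM2l// ger0_norm ?sumr_ge0//.
  have -> : n%:R * (e / c) = \sum_(i < n) (e / c) by rewrite sumr_const card_ord mulr_natl.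
  apply: ler_sum => i _; apply: ltW; apply: lt_le_trans (xy i) _.
  by rewrite ge_min lexx orbT.
have eE : e = (`|K r| + 1) * (n.+1%:R * (e / c)).
  by rewrite [RHS]mulrA -/c mulrC divfK// gt_eqF.
rewrite [ltRHS]eE -natr1; have k0 : 0 <= `|K r| by []; have n0 : 0 <= n%:R :> R by [].
by move: (e / c) ec0 (`|K r|) k0 (n%:R) n0 => u u0 k k0 m m0; nra.
Qed.

End coordinatewise_lipschitz.

(** * The phase with value 0 at the origin, and its Lipschitz bound *)

Section regularization.
Context {R : realType} {n : nat}.
Implicit Types (x y xi eta v : 'rV[R]_n) (h : 'rV[R]_n -> R[i]).
Hypothesis n_gt0 : (0 < n)%N.
Variables (a : R) (phi : 'rV[R]_n -> R).
Hypothesis a_ge1 : 1 <= a.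
Hypothesis phi_smooth : smooth_on [set xi | xi != 0] phi.
Hypothesis phi_homogeneous : forall (r : R) xi, 0 < r -> xi != 0 ->
  phi (r *: xi) = r `^ a * phi xi.
Hypothesis phi_bound : forall alpha : 'I_n -> nat, exists c : R,
  forall xi, xi != 0 ->
    `|mpartial alpha phi xi| <= c * enorm xi `^ (a - (mdegree alpha)%:R).

(** For a >= 1 the value 0 is the only one compatible with homogeneity at the origin. *)
Definition regularized xi : R := if xi == 0 then 0 else phi xi.

Lemma regularized_homogeneous (r : R) xi : 0 < r ->
  regularized (r *: xi) = r `^ a * regularized xi.
Proof.
move=> r0; rewrite /regularized scaler_eq0 (gt_eqF r0) /=.
by case: eqVneq => [_|xi0]; rewrite ?mulr0// phi_homogeneous.
Qed.

Lemma regularized_le : exists2 c, 0 <= c &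
  forall xi, `|regularized xi| <= c * enorm xi `^ a.
Proof.
have [c hc] := phi_bound (fun=> 0%N); exists `|c| => // xi; rewrite /regularized.
case: eqVneq => [_|xi0]; first by rewrite normr0 mulr_ge0// powR_ge0.
have := hc _ xi0; have i0 : 'I_n := Ordinal n_gt0.
have := @mpartial_single R n i0 0 phi.
rewrite (_ : (fun j => _) = (fun=> 0%N)); last by apply/funext => j; case: ifP.
move=> -> /=; rewrite /mdegree big1// subr0 => /le_trans; apply.
by rewrite ler_wpM2r ?powR_ge0// ler_norm.
Qed.

Lemma partial_phi_le : exists2 c, 0 <= c &
  forall i xi, xi != 0 -> `|partial i phi xi| <= c * enorm xi `^ (a - 1).
Proof.
have H (i : 'I_n) : exists c : R, forall xi, xi != 0 ->
    `|partial i phi xi| <= c * enorm xi `^ (a - 1).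
  have [c hc] := phi_bound (fun j => if j == i then 1 else 0)%N.
  exists c => xi /hc; rewrite mpartial_single /= /mdegree -big_mkcond/=.
  by rewrite big_pred1_eq.
have [c hc] := choice H.
exists (\sum_(i < n) `|c i|) => [|i xi xi0]; first exact: sumr_ge0.
apply: (le_trans (hc i xi xi0)); apply: ler_wpM2r; first exact: powR_ge0.
by rewrite (le_trans (ler_norm _))// (bigD1 i)//= lerDl sumr_ge0.
Qed.

Lemma enorm_box (r : R) x : 0 <= r -> box r x -> enorm x <= n%:R * r.
Proof.
move=> r0 bx; have n1 : 1 <= n%:R :> R by rewrite ler1n.
rewrite /enorm -[leRHS]ger0_norm ?mulr_ge0// -sqrtr_sqr ler_wsqrtr//.
apply: (le_trans (rV_dot_box bx)); rewrite exprMn ler_wpM2r ?sqr_ge0//.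
by rewrite expr2 ler_peMl.
Qed.

Lemma enorm_axis (t : R) (i : 'I_n) : enorm (t *: delta_mx 0 i) = `|t|.
Proof.
rewrite /enorm rV_dotZl rV_dotZr /rV_dot (bigD1 i)//= big1; last first.
  by move=> j ji; rewrite !mxE (negbTE ji) andbF mul0r.
by rewrite !mxE !eqxx mulr1 addr0 mulr1 -expr2 sqrtr_sqr.
Qed.

(** The mean value theorem fails if the segment meets the origin. In that case both endpoints lie on
    the axis and the size bound |phi(xi)| <= c |xi|^a replaces it, the two distances to the origin
    adding up to t. *)
Lemma regularized_axis_lip : exists2 L, 0 <= L &
  forall (r : R) x (i : 'I_n) (t : R), 0 < r -> 0 <= t -> box r x ->
    box r (x + t *: delta_mx 0 i) ->
    `|regularized (x + t *: delta_mx 0 i) - regularized x| <= L * r `^ (a - 1) * t.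
Proof.
have [c0 c00 h0] := regularized_le; have [c1 c10 h1] := partial_phi_le.
have a1 : 0 <= a - 1 by rewrite subr_ge0.
have n1 : 1 <= n%:R :> R by rewrite ler1n.
exists (c0 + c1 * n%:R `^ (a - 1)) => [|r x i t r0 t0 bx bxt].
  by rewrite addr_ge0 ?mulr_ge0 ?powR_ge0.
set e := delta_mx 0 i in bxt *.
have P0 := powR_ge0 r (a - 1).
have [hit|nohit] := pselect (exists2 s, 0 <= s <= t & x + s *: e = 0).
  have [s /andP[s0 st] xs] := hit.
  have xE : x = (- s) *: e by rewrite scaleNr; apply/eqP; rewrite -addr_eq0 xs.
  have xtE : x + t *: e = (t - s) *: e by rewrite xE scalerBl scaleNr addrC.
  (* Here u <= r, so u^a = u^(a-1) u <= r^(a-1) u; this uses a >= 1. *)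
  have xi_le (u : R) : 0 <= u -> box r (u *: e) \/ box r (- u *: e) ->
      u `^ a <= r `^ (a - 1) * u.
    move=> u0 b; have ur : u <= r.
      by case: b => /(_ i); rewrite !mxE !eqxx mulr1 ?normrN ger0_norm.
    rewrite -mulr_powRB1 ?(lt_le_trans ltr01 a_ge1)// mulrC ler_wpM2r//.
    by apply: ge0_ler_powR => //; rewrite nnegrE// ltW.
  have E1 : enorm x = s by rewrite xE enorm_axis normrN ger0_norm.
  have E2 : enorm (x + t *: e) = t - s by rewrite xtE enorm_axis ger0_norm ?subr_ge0.
  have e1 := h0 x; have e2 := h0 (x + t *: e); rewrite E1 in e1; rewrite E2 in e2.
  have s1 : s `^ a <= r `^ (a - 1) * s by apply: xi_le => //; right; rewrite -xE.
  have s2 : (t - s) `^ a <= r `^ (a - 1) * (t - s).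
    by apply: xi_le; rewrite ?subr_ge0//; left; rewrite -xtE.
  rewrite (le_trans (ler_normB _ _))// (le_trans (lerD e2 e1))//.
  rewrite -mulrDr; apply: (@le_trans _ _ (c0 * (r `^ (a - 1) * t))).
    by rewrite ler_wpM2l//; lra.
  rewrite -mulrA ler_wpM2r ?mulr_ge0// lerDl mulr_ge0// powR_ge0.
have n0 (s : R) : 0 <= s <= t -> x + s *: e != 0.
  by move=> st; apply/eqP => E; apply: nohit; exists s.
have reg s : 0 <= s <= t -> regularized (x + s *: e) = phi (x + s *: e).
  by move=> /n0 /negbTE E; rewrite /regularized E.
have d s : 0 <= s <= t -> derivable phi (x + s *: e) e.
  by move=> st; have [_ H] := phi_smooth [::] (n0 s st); exact: H.
have [s st E] := line_MVT t0 d.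
have tt : 0 <= t <= t by rewrite t0 lexx.
have tz : 0 <= (0 : R) <= t by rewrite lexx.
have := reg _ tz; rewrite scale0r addr0 => ->; rewrite reg// E normrM ger0_norm//.
rewrite mulrC ler_wpM2r//; apply: (le_trans (h1 i _ (n0 s st))).
have bs : box r (x + s *: e).
  have /andP[s0 s1] := st.
  move=> j; have := bx j; have := bxt j; rewrite !mxE /=.
  have [->|ji] := eqVneq j i; last by rewrite !mulr0 !addr0.
  by rewrite !mulr1 !ler_norml => /andP[? ?] /andP[? ?]; apply/andP; split; lra.
apply: (@le_trans _ _ (c1 * (n%:R * r) `^ (a - 1))).
  apply: ler_wpM2l => //; apply: ge0_ler_powR => //.
  - by rewrite nnegrE sqrtr_ge0.
  - by rewrite nnegrE mulr_ge0// ltW.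
  - by apply: enorm_box bs; exact: ltW.
by rewrite powRM ?(ltW r0)// mulrA ler_wpM2r// lerDr.
Qed.

Lemma regularized_lip : exists2 L, 0 <= L &
  forall (r : R) xi eta, 0 < r -> box r xi -> box r eta ->
    `|regularized xi - regularized eta| <=
    L * r `^ (a - 1) * \sum_(i < n) `|xi 0 i - eta 0 i|.
Proof.
have [L L0 hL] := regularized_axis_lip; exists L => // r xi eta r0.
apply: lipschitz_coordinates => x i t bx bxt.
have [t0|t0] := leP 0 t; first by rewrite (ger0_norm t0); exact: hL.
(* A backward step is the forward step from the other endpoint. *)
have E : x = x + t *: delta_mx 0 i + (- t) *: delta_mx 0 i by rewrite scaleNr addrK.
rewrite distrC (ltr0_norm t0) {1}E; apply: hL => //; first by rewrite oppr_ge0 ltW.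
by rewrite -E.
Qed.

End regularization.

(** * From norms to integrals of squares, and from phi to its regularization *)

Section norms.
Context {R : realType} {n : nat}.
Implicit Types (x xi : 'rV[R]_n) (f h : 'rV[R]_n -> R[i]) (phi : 'rV[R]_n -> R).

Lemma poweR2_le (x y : \bar R) : (0 <= x)%E -> (0 <= y)%E -> (x `^ 2 <= y `^ 2)%E -> (x <= y)%E.
Proof.
have E (z : \bar R) : (0 <= z)%E -> ((z `^ 2) `^ 2^-1 = z)%E.
  by move=> z0; rewrite -poweRrM divff// poweRe1.
move=> x0 y0 xy; rewrite -(E x)// -(E y)//.
by apply: gt0_ler_poweR => //; rewrite in_itv/= poweR_ge0 leey.
Qed.

Lemma poweR2_homo (x y : \bar R) : (0 <= x)%E -> (x <= y)%E -> (x `^ 2 <= y `^ 2)%E.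
Proof.
move=> x0 xy; apply: gt0_ler_poweR => //; rewrite in_itv/= leey andbT//.
exact: le_trans xy.
Qed.

Lemma EFin_poweR2 (c : R) : 0 <= c -> (c%:E `^ 2 = (c ^+ 2)%:E)%E.
Proof. by move=> c0; rewrite poweR_EFin powR_mulrn. Qed.

Lemma maximal_function_ge0 phi f x : (0 <= maximal_function phi f x)%E.
Proof.
apply: (@le_trans _ _ (cmod (propagator phi (1 / 2) f x))%:E).
  by rewrite lee_fin cmod_ge0.
by apply: ereal_sup_ubound; exists (1 / 2) => //=; apply/andP; split; lra.
Qed.

(** Squaring is increasing on [0, +oo], hence commutes with the supremum; for one of the two
    inequalities the square root of [msq] serves as an upper bound. *)
Lemma maximal_function_sqr phi f x :
  (maximal_function phi f x `^ 2 = msq phi (fourier f) x)%E.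
Proof.
have m0 := maximal_function_ge0 phi f x; have s0 := msq_ge0 phi (fourier f) x.
apply/le_anti/andP; split.
  have E : ((msq phi (fourier f) x `^ 2^-1) `^ 2 = msq phi (fourier f) x)%E.
    by rewrite -poweRrM mulVf// poweRe1.
  rewrite -[leRHS]E; apply: poweR2_homo => //.
  apply: ge_ereal_sup => _ [t t01 <-].
  have c0 : (0 <= (cmod (propagator phi t f x))%:E :> \bar R)%E by rewrite lee_fin cmod_ge0.
  apply: (poweR2_le c0 (poweR_ge0 _ _)); rewrite E (EFin_poweR2 (cmod_ge0 _)).
  exact: msq_ge.
apply: msq_le => t t01; rewrite -EFin_poweR2 ?cmod_ge0//.
apply: poweR2_homo; first by rewrite lee_fin cmod_ge0.
by apply: ereal_sup_ubound; exists t.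
Qed.

Lemma L2norm_on_sqr (D : set 'rV[R]_n) phi f :
  (L2norm_on D (maximal_function phi f) `^ 2 =
   \int[lebesgue_rV]_(x in D) msq phi (fourier f) x)%E.
Proof.
rewrite /L2norm_on poweR_Lnorm ?pnatr_eq0// [in RHS]integral_mkcond.
apply: eq_integral => x _; rewrite !patchE; case: ifP => _; last by rewrite abse0 poweR0r.
by rewrite gee0_abs ?maximal_function_ge0// maximal_function_sqr.
Qed.

Lemma sobolev_norm_sqr (s : R) f : (sobolev_norm s f `^ 2 = weightsq s (fourier f))%E.
Proof.
rewrite /sobolev_norm poweR_Lnorm ?pnatr_eq0//; apply: eq_integral => x _.
have x0 : 0 <= japanese x `^ s * cmod (fourier f x) by rewrite mulr_ge0 ?powR_ge0 ?cmod_ge0.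
by rewrite gee0_abs ?lee_fin//; exact: EFin_poweR2.
Qed.

Lemma L2norm_on_le (D : set 'rV[R]_n) phi f (s C : R) : 0 <= C ->
  (L2norm_on D (maximal_function phi f) <= C%:E * sobolev_norm s f)%E <->
  (\int[lebesgue_rV]_(x in D) msq phi (fourier f) x <= (C ^+ 2)%:E * weightsq s (fourier f))%E.
Proof.
move=> C0; rewrite -L2norm_on_sqr -sobolev_norm_sqr.
have l0 : (0 <= L2norm_on D (maximal_function phi f))%E by exact: Lnorm_ge0.
have w0 : (0 <= sobolev_norm s f)%E by exact: Lnorm_ge0.
rewrite -EFin_poweR2// -poweRM ?lee_fin//; split; first exact: poweR2_homo.
by apply: poweR2_le => //; rewrite mule_ge0 ?lee_fin.
Qed.

(** The two integrands differ at most at the origin, a null set because n > 0. *)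
Lemma evolution_regularized phi t h x : (0 < n)%N -> measurable_fun setT (regularized phi) ->
  cintegrable lebesgue_rV h -> evolution phi t h x = evolution (regularized phi) t h x.
Proof.
move=> n_gt0 mr ih.
have mphi : measurable_fun setT phi.
  (* Measurability of [phi], whose value at 0 is arbitrary, follows by correcting the regularization
     at one point. *)
  rewrite (_ : phi = (fun xi => regularized phi xi + phi 0 * \1_[set (0 : 'rV[R]_n)] xi)).
    apply: measurable_funD => //; apply: measurable_funM => //.
    by apply: measurable_indic; exact: measurable_rV_set1.
  apply/funext => xi; rewrite /regularized indicE.
  case: eqVneq => [->|xi0]; first by rewrite mem_set// mulr1 add0r.
  by rewrite memNset ?mulr0 ?addr0// => /eqP; exact/negP.
have i1 := cintegrable_evolution t x mphi ih; have i2 := cintegrable_evolution t x mr ih.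
have ae (g : R[i] -> R) : {ae lebesgue_rV, forall xi, [set: 'rV[R]_n] xi ->
    (g (cexpi (rV_dot x xi + t * phi xi) * h xi))%:E =
    (g (cexpi (rV_dot x xi + t * regularized phi xi) * h xi))%:E}.
  exists [set 0]; split; [exact: measurable_rV_set1|exact: lebesgue_rV_set1|].
  move=> xi /=; apply: contra_notP => xi0 _; congr (g (cexpi (_ + t * _) * _))%:E.
  by rewrite /regularized; case: eqVneq.
rewrite /evolution /cint; congr Complex; rewrite /Rintegral; congr fine;
  apply: ae_eq_integral => //; try exact: ae; apply/measurable_EFinP.
- by case: i1 => -[].
- by case: i2 => -[].
- by case: i1 => -[].
- by case: i2 => -[].
Qed.

End norms.

Theorem theorem2p1 (R : realType) (n : nat) (a s0 : R) (phi : 'rV[R]_n -> R)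
  (n_ge1 : (1 <= n)%N) (a_ge1 : 1 <= a) (s0_gt0 : 0 < s0)
  (phi_smooth : smooth_on [set xi | xi != 0] phi)
  (phi_homogeneous : forall (r : R) (xi : 'rV[R]_n), 0 < r -> xi != 0 ->
    phi (r *: xi) = r `^ a * phi xi)
  (phi_bound : forall alpha : 'I_n -> nat, exists c : R,
    forall xi : 'rV[R]_n, xi != 0 ->
      `|mpartial alpha phi xi| <= c * enorm xi `^ (a - (mdegree alpha)%:R))
  (phi_gradient : exists m : R,
    [/\ [set enorm (gradient phi xi) | xi in [set xi | enorm xi = 1]] m,
        lbound [set enorm (gradient phi xi) | xi in [set xi | enorm xi = 1]] m
      & 0 < m])
  (local_estimate : forall s : R, s0 < s -> exists C : R,
    forall f : 'rV[R]_n -> R[i], schwartz f ->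
      (L2norm_on unit_ball (maximal_function phi f)
        <= C%:E * sobolev_norm s f)%E) :
  forall s : R, a * s0 < s -> exists C : R,
    forall f : 'rV[R]_n -> R[i], schwartz f ->
      (L2norm_on setT (maximal_function phi f) <= C%:E * sobolev_norm s f)%E.
Proof.
move=> s' as0s'; pose psi := regularized phi.
have a0 : 0 < a by exact: lt_le_trans a_ge1.
have [L L0 lip] := regularized_lip n_ge1 a_ge1 phi_smooth phi_bound.
have cpsi : continuous psi := lipschitz_box_continuous (K := fun r => L * r `^ (a - 1)) lip.
have mpsi : measurable_fun setT psi by exact: continuous_measurable_rV.
have hom (c : R) (xi : 'rV[R]_n) : 0 < c -> psi (c *: xi) = c `^ a * psi xi.
  by move=> c0; exact: (regularized_homogeneous phi_homogeneous).
have msqE f x : schwartz f -> msq phi (fourier f) x = msq psi (fourier f) x.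
  move=> sf; rewrite /msq; congr ereal_sup; apply: eq_imagel => t _.
  by rewrite evolution_regularized//; exact: cintegrable_fourier.
have msqI (D : set 'rV[R]_n) f : schwartz f ->
    (\int[lebesgue_rV]_(x in D) msq phi (fourier f) x =
     \int[lebesgue_rV]_(x in D) msq psi (fourier f) x)%E.
  by move=> sf; apply: eq_integral => x _; rewrite msqE.
(* The midpoint of s0 and s'/a: the local estimate holds at s, and a s < s' leaves a margin for the
   dyadic sum. *)
pose s := (s0 + s' / a) / 2.
have s0s' : s0 < s' / a by rewrite ltr_pdivlMr// mulrC.
have s0s : s0 < s by rewrite /s; lra.
have ss' : a * s < s'.
  by rewrite mulrC -ltr_pdivlMr// /s; lra.
have s_ge0 : 0 <= s by rewrite (le_trans (ltW s0_gt0))// ltW.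
have [C hC] := local_estimate s s0s.
(* The given constant may be negative; its absolute value makes squaring the estimate legitimate. *)
have loc f : schwartz f -> (\int[lebesgue_rV]_(x in unit_ball) msq psi (fourier f) x <=
    (`|C| ^+ 2)%:E * weightsq s (fourier f))%E.
  move=> sf; rewrite -msqI//.
  apply/(L2norm_on_le _ _ _ _ (normr_ge0 C)); apply: (le_trans (hC f sf)).
  by apply: lee_wpmul2r; [exact: Lnorm_ge0|rewrite lee_fin ler_norm].
have [K K0 hK] := extended_local_estimate n_ge1 cpsi s_ge0 (sqr_ge0 `|C|) loc.
have loc2 := scaled_local_estimate cpsi (ltW a0) hom K0 hK.
have glob := frequency_localized_estimate n_ge1 cpsi a_ge1 s_ge0 K0 L0 lip loc2.
have G0 := @global_constant_ge0 R n a s K L K0.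
have as_ge0 : 0 <= a * s by rewrite mulr_ge0// ltW.
exists (Num.sqrt (summed_constant a s s' (@global_constant R n a s K L))) => f sf.
apply/(L2norm_on_le _ _ _ _ (sqrtr_ge0 _)).
rewrite sqr_sqrtr; last exact: summed_constant_ge0.
rewrite msqI//.
(* Since the weight is at most 1, its decay bound makes the Fourier transform bounded, so that every
   shell part is an admissible datum. *)
have [B B0 hB] := fourier_decay sf n_ge1.
apply: (global_estimate mpsi G0 as_ge0 ss' glob (cintegrable_fourier sf n_ge1) (M := B)) => xi.
apply: (le_trans (hB xi)); rewrite ler_piMr// /pweight.
apply: (@le_trans _ _ (\prod_(i < n) 1)); last by rewrite big1.
by apply: ler_prod => i _; rewrite invr_ge0 invf_le1 ?lerDl ?sqr_ge0 ?addr_ge0 ?ltr_pwDl ?sqr_ge0.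
Qed.
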